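(* Let $m\in\mathbb{N}$. The set of piecewise expanding maps $f\in\mathcal{X}_m$ satisfying the separation condition is residual in $(\mathcal{X}_m,d)$.
   Context: Fix $m\in\mathbb{N}$. A map $f\colon[0,1]\to[0,1]$ is piecewise expanding on $m$ intervals if there are a constant $\sigma>1$ and intervals $I_1,\dots,I_m$ such that (1) $[0,1]=\bigcup_{i=1}^m I_i$ and $\mathrm{int}(I_i)\cap\mathrm{int}(I_j)=\emptyset$ for $i\ne j$; (2) $f$ is $C^1$ and $|f'|\ge\sigma$ on each $I_i$; (3) $f'$ is Lipschitz on each $I_i$. The partition $\mathcal{P}_f=\{I_1(f),\dots,I_m(f)\}$ has boundary points $0=a_0(f)<a_1(f)<\dots<a_m(f)=1$ (the intervals being ordered from left to right). $\mathcal{X}_m$ is the set of all such maps, with the metric $d(f,g)=\rho(\mathcal{P}_f,\mathcal{P}_g)+\rho_0(f,g)+\rho_{\mathrm{Lip}}(f',g')$, where $\rho(\mathcal{P}_f,\mathcal{P}_g)=\max_{1\le i\le m-1}|a_i(f)-a_i(g)|$, $\rho_0(f,g)=\max_{1\le i\le m}\|f-g\circ\eta_i\|_{C^0(I_i(f))}$, $\rho_{\mathrm{Lip}}(f',g')=\max_{1\le i\le m}\{\|f'-g'\circ\eta_i\|_{\mathrm{Lip}(I_i(f))}+\|g'-f'\circ\eta_i^{-1}\|_{\mathrm{Lip}(I_i(g))}\}$, and $\eta_i\colon I_i(f)\to I_i(g)$ is the affine map sending the endpoints $a_{i-1}(f),a_i(f)$ to $a_{i-1}(g),a_i(g)$ respectively;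 $\|\cdot\|_{C^0}$ and $\|\cdot\|_{\mathrm{Lip}}$ are the usual norms of continuous and Lipschitz functions. Residual means: complement of a meagre set. An acip of $f$ is an $f$-invariant Borel probability measure absolutely continuous with respect to Lebesgue measure on $[0,1]$. The set of ergodic acips of $f$ is finite and nonempty (known); denote it $\{\mu_1,\dots,\mu_r\}$. $A_\mu:=\operatorname{supp}\mu$ is the smallest closed set of full $\mu$-measure. A pair $(f,\mu)$ with $\mu$ an acip of $f$ is exact if $\bigcap_{n\ge0}f^{-n}(\mathcal{B})$, $\mathcal{B}$ the Borel $\sigma$-algebra, consists of $\mu$-null sets and their complements. It is known that for each $i$ there are $k_i\in\mathbb{N}$ and a probability measure $\nu_i$ which is an acip of $f^{k_i}$ such that $\mu_i=\frac1{k_i}\sum_{j=0}^{k_i-1}f^j_*\nu_i$ and $(f^{k_i},f^j_*\nu_i)$ is exact for all $j$; the sets $\Lambda_{i,j}:=\operatorname{supp}f^j_*\nu_i$, with $j$ running over $k_i$ consecutive indices, are the mixing components of $\mu_i$, and $\mathrm{Per}(\mu_i):=k_i$ is its mixing period. All of these supports are finite unions of intervals. Boundary $\partial$ and interior are relative to $\mathbb{R}$. Let $D=\{a_1(f),\dots,a_{m-1}(f)\}$ and let $D_{f^n}$ be the set of $x\in[0,1]$ with $f^k(x)\in D$ for some $0\le k<n$. The map $f$ satisfies the separation condition if for all ergodic acips $\mu,\nu$ of $f$: (1) $A_\mu\cap A_\nu=\emptyset$ whenever $\mu\ne\nu$; (2) the mixing components are separated, i.e. $\Lambda_{i,j}\cap\Lambda_{i',j'}=\emptyset$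 whenever $(i,j)\ne(i',j')$; (3) $D_{f^k}\cap\partial A_\mu=\emptyset$ where $k=\mathrm{Per}(\mu)$; (4) $(0,1)\cap\partial A_\mu$ does not contain any periodic point of $f$. *)

(* Defs.v *)
From HB Require Import structures.
From mathcomp Require Import all_boot all_order all_algebra.
From mathcomp Require Import all_classical all_reals all_analysis.
Import Order.TTheory GRing.Theory Num.Theory.
Import numFieldNormedType.Exports.

Set Implicit Arguments.
Unset Strict Implicit.
Unset Printing Implicit Defensive.

Local Open Scope classical_set_scope.
Local Open Scope ring_scope.

Section baire_category.
Context {T : topologicalType}.

Definition nowhere_dense (A : set T) : Prop := (closure A)° = set0.

Definition meagre (A : set T) : Prop :=
  exists F : nat -> set T,
    (forall n, nowhere_dense (F n)) /\ A `<=` \bigcup_n F n.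

Definition residual (A : set T) : Prop := meagre (~` A).

Definition boundary (A : set T) : set T := closure A `\` A°.

End baire_category.

Section functions_on_sets.
Context {R : realType}.
Implicit Types (A : set R) (h : R -> R).

Definition slope_on h (x y : R) : R := (h y - h x) / (y - x).

(* The derivative of the restriction of h to A; at an endpoint of an interval A
   that belongs to A it is the one-sided derivative. *)
Definition derivable_on A h (x : R) : Prop :=
  cvg (slope_on h x y @[y --> within (A `\ x) (nbhs x)]).

Definition derive_on A h (x : R) : R :=
  lim (slope_on h x y @[y --> within (A `\ x) (nbhs x)]).

Definition C1_on A h : Prop :=
  (forall x, A x -> derivable_on A h x) /\
  {within A, continuous (derive_on A h)}.

Definition C0_norm A h : R := sup [set `|h x| | x in A].

Definition lip_const A h : R :=
  sup [set r | exists x y, [/\ A x, A y, x != y & r = `|h x - h y| / `|x - y|]].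

Definition Lip_norm A h : R := C0_norm A h + lip_const A h.

End functions_on_sets.

(* An element is a map f together with the partition I_1, ..., I_m, which f
   alone need not determine (f may be smooth at a cut point).  Each I_i is an
   interval with endpoints a_(i-1) < a_i that may contain none, one or both of
   them, so f may jump at the cut points and its value there is a one-sided
   limit.  The interiors of the I_i are ]a_(i-1), a_i[, hence disjoint.
   Maps from [0, 1] to itself are represented by their extension by 0 to R.
   The index i : 'I_m stands for the (i + 1)-st interval. *)
Record pwexp (R : realType) (m : nat) := PWExp {
  pw_fun :> R -> R ;
  pw_cut : 'I_m.+1 -> R ;
  pw_int : 'I_m -> set R ;
  pw_out : forall x, ~ `[0, 1]%classic x -> pw_fun x = 0 ;
  pw_maps : forall x, `[0, 1]%classic x -> `[0, 1]%classic (pw_fun x) ;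
  pw_cut0 : pw_cut ord0 = 0 ;
  pw_cut1 : pw_cut ord_max = 1 ;
  pw_cut_lt : forall i : 'I_m,
    pw_cut (widen_ord (leqnSn m) i) < pw_cut (lift ord0 i) ;
  pw_int_sub : forall i : 'I_m,
    `]pw_cut (widen_ord (leqnSn m) i), pw_cut (lift ord0 i)[%classic
      `<=` pw_int i /\
    pw_int i
      `<=` `[pw_cut (widen_ord (leqnSn m) i), pw_cut (lift ord0 i)]%classic ;
  pw_cover : \bigcup_(i in [set: 'I_m]) pw_int i = `[0, 1]%classic ;
  pw_C1 : forall i, C1_on (pw_int i) pw_fun ;
  pw_expanding : exists2 sigma : R, 1 < sigma &
    forall i x, pw_int i x -> sigma <= `|derive_on (pw_int i) pw_fun x| ;
  pw_lip : forall i, [lipschitz derive_on (pw_int i) pw_fun x | x in pw_int i]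
}.

Section distance.
Context {R : realType} {m : nat}.
Implicit Types (f g : pwexp R m) (i : 'I_m).

Definition pw_left f i : R := pw_cut f (widen_ord (leqnSn m) i).
Definition pw_right f i : R := pw_cut f (lift ord0 i).
Definition pw_open f i : set R := `]pw_left f i, pw_right f i[%classic.

Definition pw_der f i : R -> R := derive_on (pw_int f i) f.

(* The increasing affine map eta_i from I_i(f) to I_i(g); its inverse is
   eta g f i. *)
Definition eta f g i (x : R) : R :=
  pw_left g i + (x - pw_left f i) *
    ((pw_right g i - pw_left g i) / (pw_right f i - pw_left f i)).

Definition rho_cut f g : R :=
  \big[Num.max/0]_(i < m.+1 | (0 < i < m)%N) `|pw_cut f i - pw_cut g i|.

Definition rho_0 f g : R :=
  \big[Num.max/0]_(i < m) C0_norm (pw_int f i) (fun x => f x - g (eta f g i x)).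

(* eta_i may send an endpoint belonging to I_i(f) to one outside I_i(g), where
   the derivative of g on I_i(g) is not defined.  The norms are therefore taken
   over the open intervals; as the derivatives are continuous on the I_i, this
   does not change them when I_i(f) and I_i(g) contain the same endpoints. *)
Definition rho_Lip f g : R :=
  \big[Num.max/0]_(i < m)
    (Lip_norm (pw_open f i) (fun x => pw_der f i x - pw_der g i (eta f g i x)) +
     Lip_norm (pw_open g i) (fun x => pw_der g i x - pw_der f i (eta g f i x))).

Definition pw_dist f g : R := rho_cut f g + rho_0 f g + rho_Lip f g.

(* The topology of pw_dist: a set is open when it contains a ball around each
   of its points. *)
Definition pw_op (O : set (pwexp R m)) : Prop :=
  forall f, O f -> exists2 e : R, 0 < e & forall g, pw_dist f g < e -> O g.

Lemma pw_opT : pw_op setT.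
Proof. by move=> f _; exists 1. Qed.

Lemma pw_opI : setI_closed pw_op.
Proof.
move=> A B oA oB f [/oA[a a0 Aa] /oB[b b0 Bb]].
exists (Num.min a b); first by rewrite lt_min a0.
by move=> g; rewrite lt_min => /andP[/Aa Ag /Bb Bg].
Qed.

Lemma pw_op_bigU (I : Type) (F : I -> set (pwexp R m)) :
  (forall j : I, pw_op (F j)) -> pw_op (\bigcup_j F j).
Proof.
move=> oF f [j _ /oF[e e0 Fe]]; exists e => // g /Fe Fg.
by exists j.
Qed.

HB.instance Definition _ := gen_eqMixin (pwexp R m).
HB.instance Definition _ := gen_choiceMixin (pwexp R m).
HB.instance Definition _ :=
  isOpenTopological.Build (pwexp R m) pw_opT pw_opI pw_op_bigU.

End distance.

(* A measure on [0, 1] is a Borel measure on R giving mass 1 to [0, 1].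
   Measures of the library are also defined, arbitrarily, on non-measurable
   sets: equality of measures is tested on Borel sets only. *)
Section invariant_measures.
Context {R : realType}.
Let T := measurableTypeR R.
Implicit Types (f : R -> R) (mu nu : set T -> \bar R) (P Q : probability T R).

Definition push mu f : set T -> \bar R := pushforward mu (f : T -> T).

Definition same_measure mu nu : Prop :=
  forall A : set T, measurable A -> mu A = nu A.

Definition acip f mu : Prop :=
  [/\ mu `[0, 1]%classic = 1%E,
      same_measure (push mu f) mu &
      mu `<< @lebesgue_measure R].

Definition ergodic f mu : Prop :=
  forall A : set T, measurable A ->
    `[0, 1]%classic `&` f @^-1` A = A -> mu A = 0%E \/ mu A = 1%E.

Definition ergodic_acip f mu : Prop := acip f mu /\ ergodic f mu.

Definition msupport mu : set R :=
  \bigcap_(C in [set C : set R | closed C /\ mu (~` C) = 0%E]) C.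

Definition is_exact f mu : Prop :=
  acip f mu /\
  forall A : set T,
    (forall n : nat, exists2 B : set T, measurable B &
       A = `[0, 1]%classic `&` iter n f @^-1` B) ->
    mu A = 0%E \/ mu (`[0, 1]%classic `\` A) = 0%E.

Definition mixing_decomposition f mu (k : nat) P : Prop :=
  [/\ (0 < k)%N,
      acip (iter k f) P,
      same_measure mu
        (fun A => (k%:R^-1)%:E * \sum_(j < k) push P (iter j f) A)%E &
      forall j : nat, is_exact (iter k f) (push P (iter j f))].

(* A decomposition of length k can be repeated to get one of any multiple of k
   in which each component occurs several times; the mixing period and the
   mixing components are those of a decomposition of least length. *)
Definition mixing_cycle f mu (k : nat) P : Prop :=
  mixing_decomposition f mu k P /\
  forall l Q, mixing_decomposition f mu l Q -> (k <= l)%N.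

Definition mixing_period f mu (k : nat) : Prop :=
  exists P, mixing_cycle f mu k P.

Definition mixing_component f P (j : nat) : set R :=
  msupport (push P (iter j f)).

End invariant_measures.

Section separation_condition.
Context {R : realType} {m : nat}.
Implicit Type f : pwexp R m.

Definition cut_set f : set R :=
  [set pw_cut f i | i in [set i : 'I_m.+1 | (0 < i < m)%N]].

Definition singular_set f (n : nat) : set R :=
  [set x | `[0, 1]%classic x /\
           exists2 k : nat, (k < n)%N & cut_set f (iter k f x)].

Record separation_condition f : Prop := SeparationCondition {
  sep_supports : forall mu nu : probability (measurableTypeR R) R,
    ergodic_acip f mu -> ergodic_acip f nu -> ~ same_measure mu nu ->
    msupport mu `&` msupport nu = set0 ;
  sep_components_of_one : forall (mu P : probability (measurableTypeR R) R) k,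
    ergodic_acip f mu -> mixing_cycle f mu k P ->
    forall i j : nat, (i < k)%N -> (j < k)%N -> i != j ->
    mixing_component f P i `&` mixing_component f P j = set0 ;
  sep_components_of_two : forall (mu nu P Q : probability (measurableTypeR R) R)
      k l,
    ergodic_acip f mu -> ergodic_acip f nu -> ~ same_measure mu nu ->
    mixing_cycle f mu k P -> mixing_cycle f nu l Q ->
    forall i j : nat, (i < k)%N -> (j < l)%N ->
    mixing_component f P i `&` mixing_component f Q j = set0 ;
  sep_singular : forall (mu : probability (measurableTypeR R) R) k,
    ergodic_acip f mu -> mixing_period f mu k ->
    singular_set f k `&` boundary (msupport mu) = set0 ;
  sep_periodic : forall mu : probability (measurableTypeR R) R,
    ergodic_acip f mu ->
    forall x, (`]0, 1[%classic `&` boundary (msupport mu)) x ->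
    forall p : nat, (0 < p)%N -> iter p f x != x
}.

End separation_condition.

(* Main.v *)
From HB Require Import structures.
Require Import Defs.
From mathcomp Require Import all_boot all_order all_algebra.
From mathcomp Require Import all_classical all_reals all_analysis.
From mathcomp Require Import measurable_realfun ring lra zify.
Import Order.TTheory GRing.Theory Num.Theory.
Import numFieldNormedType.Exports.

Set Implicit Arguments.
Unset Strict Implicit.
Unset Printing Implicit Defensive.

Local Open Scope classical_set_scope.
Local Open Scope ring_scope.

(* Let U be the set of points around which an absolutely continuous measure mu that is
   invariant under an iterate of f is equivalent to Lebesgue measure.  It is open, f maps
   U minus the cut points into the corresponding set of f_* mu, and a Lasota-Yorke
   estimate for the dual operator shows that U has full mu-measure; so the support of mu
   is the closure of U.  By expansion, all components of U have length at least some d,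
   hence U has finitely many boundary points, and pulling such a point back along branches
   must end at a branch end: every boundary point of a support is the image f^n(v) of a
   one-sided limit v of f at the end of a branch, at which the support accumulates on that
   side.  Call f generic when the points f^n(v), for all the 2m one-sided limits v and all
   n, are pairwise distinct and are not cut points.  For a generic f two supports with
   disjoint open parts cannot share a boundary point, and no boundary point is periodic or
   falls onto a cut, which gives the separation condition (distinct ergodic acips, and
   distinct mixing components, being mutually singular).  Being generic up to time N is an
   open condition, because f^n(v) depends continuously on f as long as the orbit avoids
   the cuts.  It is dense: adding a small polynomial on each branch moves the N-th points
   of the orbits independently of each other and leaves the previous ones in place. *)

(** * Branches *)

(** The Lasota-Yorke estimate is dual so that neither variation nor a transfer operator enters: a
    test function [g] is measured by its integrals over segments, composition with [f] shrinks them
    by about [s^-1] inside one branch, and the effect of the cuts is absorbed in a bounded step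
    function. Lebesgue points of density 0 arbitrarily close to one of positive density would give
    test functions with bounded primitives and unbounded integrals; this produces intervals where
    the density is positive almost everywhere. The separation conditions concern one measure, two
    measures, or a cycle of components. Each case is a family [nu] over a finite index type permuted
    by [kappa] as [f] pushes the measures forward, so boundary points are studied once. The
    topological claims there are proved by mass: exceptional sets that pull back into smaller ones
    are null, while a nonempty open part of a core is not. A perturbation must keep the values in
    [[0, 1]]. So being generic up to time [N] also asks for one-sided limits strictly between 0 and
    1, which a slight contraction of [f] towards 1/2 provides. *)

Section slopes.
Context {R : realType}.
Implicit Types (A : set R) (h : R -> R) (x y l : R).

(** The limit behind [derive_on] written with epsilons: it passes to subsets, sums and multiples
    without a choice of [lim], and it determines [derive_on] wherever [x] is a limit point of
    [A]. *)
Definition has_slope A h x l :=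
  forall e, 0 < e -> exists2 d, 0 < d &
    forall y, A y -> y != x -> `|y - x| < d -> `|l - slope_on h x y| < e.

Lemma has_slopeP A h x l :
  has_slope A h x l <-> slope_on h x y @[y --> within (A `\ x) (nbhs x)] --> l.
Proof.
split=> [H|H].
  apply/(@cvgrPdist_lt R R) => e /H[d d0 Hd].
  apply/nbhs_ballP; exists d => //= y; rewrite /ball /= distrC => yx [Ay /eqP nyx].
  exact: Hd.
move=> e e0; have /(@cvgrPdist_lt R R)/(_ e e0)/nbhs_ballP[d /= d0 Hd] := H.
exists d => // y Ay yx yd; apply: (Hd y); first by rewrite /ball /= distrC.
by split=> //; exact/eqP.
Qed.

Definition limit_pt A x := forall d, 0 < d -> exists2 y, A y & y != x /\ `|y - x| < d.

Lemma limit_pt_proper A x : limit_pt A x -> ProperFilter (within (A `\ x) (nbhs x)).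
Proof.
move=> H; apply: Build_ProperFilter_ex => P /nbhs_ballP[d /= d0 Hd].
have [y Ay [yx yd]] := H d d0; exists y; apply: (Hd y).
  by rewrite /ball /= distrC.
by split => //; exact/eqP.
Qed.

Lemma has_slope_derivable A h x l : has_slope A h x l -> derivable_on A h x.
Proof. by move=> /has_slopeP H; apply/cvg_ex; exists l. Qed.

Lemma has_slope_derive A h x l : limit_pt A x -> has_slope A h x l ->
  derive_on A h x = l.
Proof.
move=> /limit_pt_proper PA /has_slopeP H; exact: (@cvg_lim R).
Qed.

Lemma derivable_has_slope A h x : derivable_on A h x ->
  has_slope A h x (derive_on A h x).
Proof. by move=> H; exact/has_slopeP. Qed.

Lemma has_slopeS A B h x l : B `<=` A -> has_slope A h x l -> has_slope B h x l.
Proof.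
by move=> BA H e /H[d d0 Hd]; exists d => // y /BA; exact: Hd.
Qed.

Lemma eq_has_slope A h k x l : (forall y, A y -> h y = k y) -> A x ->
  has_slope A h x l -> has_slope A k x l.
Proof.
move=> hk Ax H e /H[d d0 Hd]; exists d => // y Ay yx yd.
by rewrite /slope_on -!hk//; exact: Hd.
Qed.

Lemma has_slopeD A h k x l l' : has_slope A h x l -> has_slope A k x l' ->
  has_slope A (fun y => h y + k y) x (l + l').
Proof.
move=> /has_slopeP H /has_slopeP K; apply/has_slopeP.
rewrite (_ : slope_on _ x = (fun y => slope_on h x y + slope_on k x y)).
  exact: cvgD.
by apply/funext => y; rewrite /slope_on -mulrDl opprD addrACA.
Qed.

Lemma has_slopeM A h x l c : has_slope A h x l ->
  has_slope A (fun y => c * h y) x (c * l).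
Proof.
move=> /has_slopeP H; apply/has_slopeP.
rewrite (_ : slope_on _ x = (fun y => c * slope_on h x y)).
  exact: cvgMr.
by apply/funext => y; rewrite /slope_on mulrA mulrBr.
Qed.

Lemma has_slope_cst A x c : has_slope A (fun=> c) x 0.
Proof.
by move=> e e0; exists 1 => // y _ _ _; rewrite /slope_on subrr mul0r subrr normr0.
Qed.

Lemma has_slope_is_derive h x l : has_slope setT h x l <-> is_derive x 1 h l.
Proof.
split=> [H|[d1 d2]].
  suff H' : t^-1 *: ((h \o shift x) (t *: (1:R)) - h x) @[t --> 0^'] --> l.
    by apply: DeriveDef; [apply/cvg_ex; exists l|exact: (@cvg_lim R)].
  apply/(@cvgrPdist_lt R R) => e /H[d d0 Hd].
  apply/nbhs_ballP; exists d => //= t; rewrite /ball /= sub0r normrN => td t0.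
  have := Hd (t + x) I; rewrite addrK; move=> /(_ _ td).
  rewrite /slope_on addrK mulrC /GRing.scale/= mulr1; apply.
  by rewrite -subr_eq0 addrK.
move=> e e0; have H' : t^-1 *: ((h \o shift x) (t *: (1:R)) - h x) @[t --> 0^'] --> l.
  by rewrite -d2; exact: d1.
have /(@cvgrPdist_lt R R)/(_ e e0)/nbhs_ballP[d /= d0 Hd] := H'.
exists d => // y _ yx yd.
have := Hd (y - x); rewrite /ball /= sub0r normrN => /(_ yd).
rewrite subr_eq0 => /(_ yx).
by rewrite /slope_on /= /GRing.scale/= mulr1 subrK mulrC.
Qed.

Lemma has_slope_nbhs A B h x l : (exists2 d, 0 < d & forall y, `|y - x| < d -> B y -> A y) ->
  has_slope A h x l -> has_slope B h x l.
Proof.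
move=> [d d0 AB] H e /H[d' d0' Hd]; exists (Num.min d d').
  by rewrite lt_min d0.
by move=> y By yx; rewrite lt_min => /andP[yd yd']; apply: Hd => //; exact: AB.
Qed.

Lemma has_slope_continuous A h x l : A x -> has_slope A h x l ->
  forall e, 0 < e -> exists2 d, 0 < d & forall y, A y -> `|y - x| < d -> `|h y - h x| < e.
Proof.
move=> Ax H e e0; have [d d0 Hd] := H 1 ltr01.
have l0 : 0 < `|l| + 1 by rewrite ltr_wpDl.
exists (Num.min d (e / (`|l| + 1))); first by rewrite lt_min d0 divr_gt0.
move=> y Ay; rewrite lt_min => /andP[yd ye].
have [->|yx] := eqVneq y x; first by rewrite subrr normr0.
have := Hd y Ay yx yd => {}Hd.
have : `|slope_on h x y| <= `|l| + 1.
  rewrite -[slope_on _ _ _](subKr l); apply: (le_trans (ler_normB _ _)).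
  by rewrite lerD2l ltW.
rewrite /slope_on normrM normfV ler_pdivrMr ?normr_gt0 ?subr_eq0// => /le_lt_trans; apply.
by rewrite mulrC -ltr_pdivlMr.
Qed.

End slopes.

Section branches.
Context {R : realType} {m : nat}.
Implicit Types (f : pwexp R m) (i : 'I_m) (x y : R).

Lemma pw_left_lt_right f i : pw_left f i < pw_right f i.
Proof. exact: pw_cut_lt. Qed.

Lemma pw_open_int f i : pw_open f i `<=` pw_int f i.
Proof. by have [] := pw_int_sub f i. Qed.

Lemma pw_int_closed f i x : pw_int f i x -> pw_left f i <= x <= pw_right f i.
Proof. by have [_ H] := pw_int_sub f i => /H; rewrite /= in_itv. Qed.

Lemma pw_int_limit_pt f i x : pw_int f i x -> limit_pt (pw_open f i) x.
Proof.
move=> Ix d d0; have := pw_left_lt_right f i; have /andP[] := pw_int_closed Ix.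
rewrite /pw_open; set a := pw_left f i; set b := pw_right f i => ax xb ab.
have [xb'|bx] := ltP x b.
  exists (x + Num.min (d / 2) ((b - x) / 2)).
    rewrite /= in_itv/=; have : 0 < Num.min (d / 2) ((b - x) / 2).
      by rewrite lt_min; apply/andP; split; lra.
    have : Num.min (d / 2) ((b - x) / 2) <= (b - x) / 2 by rewrite ge_min lexx orbT.
    by move=> h1 h2; apply/andP; split; lra.
  have h0 : 0 < Num.min (d / 2) ((b - x) / 2).
    by rewrite lt_min; apply/andP; split; lra.
  have h1 : Num.min (d / 2) ((b - x) / 2) <= d / 2 by rewrite ge_min lexx.
  split; first by rewrite gt_eqF// ltrDl.
  by rewrite addrAC subrr add0r gtr0_norm//; lra.
exists (x - Num.min (d / 2) ((x - a) / 2)).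
  rewrite /= in_itv/=; have : 0 < Num.min (d / 2) ((x - a) / 2).
    by rewrite lt_min; apply/andP; split; lra.
  have : Num.min (d / 2) ((x - a) / 2) <= (x - a) / 2 by rewrite ge_min lexx orbT.
  by move=> h1 h2; apply/andP; split; lra.
have h0 : 0 < Num.min (d / 2) ((x - a) / 2).
  by rewrite lt_min; apply/andP; split; lra.
have h1 : Num.min (d / 2) ((x - a) / 2) <= d / 2 by rewrite ge_min lexx.
split; first by rewrite lt_eqF// gtrDl oppr_lt0.
by rewrite addrAC subrr add0r normrN gtr0_norm//; lra.
Qed.

Lemma limit_ptS (A B : set R) x : A `<=` B -> limit_pt A x -> limit_pt B x.
Proof. by move=> AB H d /H[y /AB By yx]; exists y. Qed.

Lemma pw_der_slope f i x : pw_int f i x -> has_slope (pw_int f i) f x (pw_der f i x).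
Proof. by move=> Ix; apply: derivable_has_slope; have [H _] := pw_C1 f i; exact: H. Qed.

Lemma pw_der_is_derive f i x : pw_open f i x -> is_derive x 1 f (pw_der f i x).
Proof.
move=> Ox; apply/has_slope_is_derive.
apply: has_slope_nbhs (pw_der_slope (pw_open_int Ox)).
move: Ox; rewrite /pw_open /= in_itv/= => /andP[ax xb].
exists (Num.min (x - pw_left f i) (pw_right f i - x)).
  by rewrite lt_min !subr_gt0 ax.
move=> y; rewrite lt_min => /andP[h1 h2] _; apply: pw_open_int.
rewrite /pw_open /= in_itv/=; move: h1 h2; rewrite !ltr_norml => /andP[h1 h2] /andP[h3 h4].
by apply/andP; split; lra.
Qed.

Record pw_const f (s M L : R) : Prop := PwConst {
  pwc_gt1 : 1 < s ;
  pwc_L : 0 < L ;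
  pwc_lb : forall i x, pw_int f i x -> s <= `|pw_der f i x| ;
  pwc_ub : forall i x, pw_int f i x -> `|pw_der f i x| <= M ;
  pwc_lip : forall i x y, pw_int f i x -> pw_int f i y ->
    `|pw_der f i x - pw_der f i y| <= L * `|x - y| }.

Lemma pw_cut_mono f : {mono pw_cut f : i j / (i <= j)%N >-> i <= j}.
Proof.
have H : forall k (kk : (k < m.+1)%N) (jj : (k.+1 < m.+1)%N),
    pw_cut f (Ordinal kk) < pw_cut f (Ordinal jj).
  move=> k kk jj; have := pw_cut_lt f (Ordinal (jj : (k < m)%N)).
  rewrite (_ : widen_ord _ _ = Ordinal kk); last exact/val_inj.
  rewrite (_ : lift _ _ = Ordinal jj); last first.
    by apply/val_inj; rewrite /= /bump leq0n.
  by [].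
have H2 : forall n k (kk : (k < m.+1)%N) (jj : (k + n.+1 < m.+1)%N),
    pw_cut f (Ordinal kk) < pw_cut f (Ordinal jj).
  elim=> [|n IH] k kk jj.
    have jj' : (k.+1 < m.+1)%N by rewrite -addn1.
    have -> : Ordinal jj = Ordinal jj' by apply/val_inj; rewrite /= addn1.
    exact: H.
  have jj' : (k + n.+1 < m.+1)%N by by apply: leq_ltn_trans jj; rewrite leq_add2l.
  apply: lt_trans (IH k kk jj') _.
  have j2 : ((k + n.+1).+1 < m.+1)%N by rewrite -addnS.
  have -> : Ordinal jj = Ordinal j2 by apply/val_inj; rewrite /= addnS.
  exact: H.
have H3 : forall i j : 'I_m.+1, (i < j)%N -> pw_cut f i < pw_cut f j.
  move=> [i ii] [j jj] /= ij.
  have e : j = (i + (j - i.+1).+1)%N by rewrite addnS -addSn subnKC.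
  have jj' : (i + (j - i.+1).+1 < m.+1)%N by rewrite -e.
  have -> : Ordinal jj = Ordinal jj' by exact: val_inj.
  exact: H2.
move=> i j; case: (ltngtP i j) => [ij|ij|/val_inj->].
- by apply/ltW/H3.
- by apply/negbTE; rewrite -ltNge; exact: H3.
- by rewrite lexx.
Qed.

Lemma pw_cut01 f (k : 'I_m.+1) : 0 <= pw_cut f k <= 1.
Proof.
rewrite -(pw_cut0 f) -(pw_cut1 f) !(@pw_cut_mono f) /=.
by rewrite -ltnS ltn_ord.
Qed.

Lemma pw_open01 f i x : pw_open f i x -> 0 < x < 1.
Proof.
rewrite /pw_open /= in_itv/= => /andP[h1 h2].
have /andP[h3 _] := pw_cut01 f (widen_ord (leqnSn m) i).
have /andP[_ h4] := pw_cut01 f (lift ord0 i).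
by apply/andP; split; [exact: le_lt_trans h1|exact: lt_le_trans h4].
Qed.

Lemma pw_int01 f i x : pw_int f i x -> 0 <= x <= 1.
Proof.
move=> /pw_int_closed/andP[h1 h2].
have /andP[h3 _] := pw_cut01 f (widen_ord (leqnSn m) i).
have /andP[_ h4] := pw_cut01 f (lift ord0 i).
by apply/andP; split; [exact: le_trans h1|exact: le_trans h4].
Qed.

Lemma pw_fun01 f x : 0 <= x <= 1 -> 0 <= f x <= 1.
Proof.
have := pw_maps f; move=> /(_ x); rewrite /= !in_itv/= => H x01.
exact: H.
Qed.

Lemma iter01 f n x : 0 <= x <= 1 -> 0 <= iter n f x <= 1.
Proof. by elim: n => //= n IH /IH; exact: pw_fun01. Qed.

Lemma pw_consts f : exists s M L, pw_const f s M L.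
Proof.
have [s s1 Hs] := pw_expanding f.
have HL (i : 'I_m) : exists l, 0 < l /\ forall x y, pw_int f i x -> pw_int f i y ->
    `|pw_der f i x - pw_der f i y| <= l * `|x - y|.
  have [M [_ HM]] := pw_lip f i.
  exists (Num.max M 0 + 1); split; first by rewrite ltr_pwDr// le_max lexx orbT.
  move=> x y Ix Iy; apply: (HM (Num.max M 0 + 1) _ (x, y)) => //=.
  by rewrite ltr_pwDr// le_max lexx.
have [l Hl] := choice HL.
pose L := 1 + \sum_i l i.
have lL i : l i <= L.
  rewrite /L (bigD1 i)//= addrCA lerDl addr_ge0// sumr_ge0// => j _.
  by have [/ltW] := Hl j.
have L0 : 0 < L.
  by rewrite /L ltr_pwDl// sumr_ge0// => j _; have [/ltW] := Hl j.
pose c (i : 'I_m) := (pw_left f i + pw_right f i) / 2.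
have Ic i : pw_int f i (c i).
  apply: pw_open_int; rewrite /pw_open /c /= in_itv/=.
  by have := pw_left_lt_right f i => h; apply/andP; split; lra.
(* The derivative on the i-th branch differs from its value at the midpoint [c i] by at most [L],
   because the branch has length at most 1. *)
pose M := L + \sum_i `|pw_der f i (c i)|.
exists s, M, L; split => //; last first.
- by move=> i x y Ix Iy; apply: le_trans (ler_wpM2r _ (lL i)) => //; apply: (Hl i).2.
move=> i x Ix; rewrite -(subrK (pw_der f i (c i)) (pw_der f i x)).
apply: (le_trans (ler_normD _ _)); apply: lerD.
  apply: (le_trans ((Hl i).2 _ _ Ix (Ic i))).
  rewrite -[leRHS]mulr1; apply: ler_pM => //; first by have [/ltW] := Hl i.
  have /andP[h1 h2] := pw_int01 Ix; have /andP[h3 h4] := pw_int01 (Ic i).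
  by rewrite ler_norml; apply/andP; split; lra.
by rewrite (bigD1 i)//= lerDl sumr_ge0.
Qed.

Lemma pw_open_sub f i x y z : pw_open f i x -> pw_open f i y -> x <= z <= y -> pw_open f i z.
Proof.
rewrite /pw_open /= !in_itv/= => /andP[h1 _] /andP[_ h2] /andP[h3 h4].
by rewrite (lt_le_trans h1)//= (le_lt_trans h4).
Qed.

Lemma pw_open_continuous f i x : pw_open f i x -> {for x, continuous f}.
Proof.
move=> /pw_der_is_derive H; apply: differentiable_continuous.
by apply/derivable1_diffP; case: H.
Qed.

Lemma pw_open_continuous_itv f i x y : pw_open f i x -> pw_open f i y ->
  {within `[x, y], continuous f}.
Proof.
move=> Ox Oy; apply: continuous_in_subspaceT => z.
by rewrite inE /= in_itv/= => zxy; exact: pw_open_continuous (pw_open_sub Ox Oy zxy).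
Qed.

Lemma pw_MVT f i x y : pw_open f i x -> pw_open f i y -> x < y ->
  exists2 c, x < c < y & f y - f x = pw_der f i c * (y - x).
Proof.
move=> Ox Oy xy.
have [c||c] := @MVT R f (pw_der f i) x y xy.
- rewrite in_itv/= => /andP[h1 h2]; apply: pw_der_is_derive.
  by apply: pw_open_sub Ox Oy _; rewrite !ltW.
- exact: pw_open_continuous_itv Ox Oy.
- by rewrite in_itv/=; exists c.
Qed.

Lemma pw_lipP f s M L : pw_const f s M L -> forall i x y, pw_open f i x -> pw_open f i y ->
  s * `|x - y| <= `|f x - f y| <= M * `|x - y|.
Proof.
move=> [s1 L0 lb ub _] i.
suff H x y : pw_open f i x -> pw_open f i y -> x < y ->
    s * `|x - y| <= `|f x - f y| <= M * `|x - y|.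
  move=> x y Ox Oy; case: (ltgtP x y) => [xy|xy|->].
  - exact: H.
  - by rewrite distrC (distrC (f x)); exact: H.
  - by rewrite !subrr !normr0 !mulr0 lexx.
move=> Ox Oy xy; have [c /andP[xc cy] E] := pw_MVT Ox Oy xy.
rewrite distrC (distrC (f x)) E normrM.
have Ic : pw_int f i c by apply/pw_open_int/(pw_open_sub Ox Oy); rewrite !ltW.
by rewrite !ler_wpM2r ?lb ?ub.
Qed.

Lemma pw_const_M0 f s M L i : pw_const f s M L -> 0 < M.
Proof.
move=> [s1 _ lb ub _].
have Ic : pw_int f i ((pw_left f i + pw_right f i) / 2).
  apply: pw_open_int; rewrite /pw_open /= in_itv/=.
  by have := pw_left_lt_right f i => h; apply/andP; split; lra.
have := le_trans (lb _ _ Ic) (ub _ _ Ic); lra.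
Qed.

(* The continuous extension of the i-th branch, constant outside of I_i. *)
Definition bext f i x : R :=
  if x <= pw_left f i then lim (f y @[y --> (pw_left f i)^'+])
  else if pw_right f i <= x then lim (f y @[y --> (pw_right f i)^'-])
  else f x.

Lemma bext_open f i x : pw_open f i x -> bext f i x = f x.
Proof.
by rewrite /pw_open /= in_itv/= /bext => /andP[h1 h2]; rewrite leNgt h1/= leNgt h2.
Qed.

Lemma near_pw_left f i : \forall x \near (pw_left f i)^'+, pw_open f i x.
Proof.
near=> x; rewrite /pw_open /= in_itv/=; apply/andP; split; near: x.
  exact: nbhs_right_gt.
by apply: nbhs_right_lt; exact: pw_left_lt_right.
Unshelve. all: by end_near. Qed.

Lemma near_pw_right f i : \forall x \near (pw_right f i)^'-, pw_open f i x.
Proof.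
near=> x; rewrite /pw_open /= in_itv/=; apply/andP; split; near: x.
  by apply: nbhs_left_gt; exact: pw_left_lt_right.
exact: nbhs_left_lt.
Unshelve. all: by end_near. Qed.

(** The open branch is Lipschitz with constant [M], so the values of [f] near the end are Cauchy and
    the [lim] chosen in [bext] is a true limit. *)
Lemma bext_left f i : f y @[y --> (pw_left f i)^'+] --> bext f i (pw_left f i).
Proof.
rewrite /bext lexx; apply/cauchy_cvgP; apply: cauchy_exP => e e0.
have [s [M [L HC]]] := pw_consts f; have M0 := pw_const_M0 i HC.
set a := pw_left f i.
near a^'+ => z; exists (f z).
have Oz : pw_open f i z by near: z; exact: (@near_pw_left f i).
have za : z - a < e / M by rewrite ltrBlDl; near: z; apply: nbhs_right_lt; rewrite ltrDl divr_gt0.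
have az : a < z by near: z; exact: nbhs_right_gt.
change (\forall y \near a^'+, ball (f z) e (f y)); near=> y; rewrite /ball /=.
have Oy : pw_open f i y by near: y; exact: (@near_pw_left f i).
have ay : a < y by near: y; exact: nbhs_right_gt.
have yz : y < z by near: y; apply: nbhs_right_lt.
have /andP[_] := pw_lipP HC Oz Oy => /le_lt_trans; apply.
rewrite mulrC -ltr_pdivlMr//; apply: le_lt_trans za.
by rewrite gtr0_norm ?subr_gt0//; lra.
Unshelve. all: by end_near. Qed.

Lemma bext_right f i : f y @[y --> (pw_right f i)^'-] --> bext f i (pw_right f i).
Proof.
rewrite /bext lexx leNgt pw_left_lt_right/=; apply/cauchy_cvgP; apply: cauchy_exP => e e0.
have [s [M [L HC]]] := pw_consts f; have M0 := pw_const_M0 i HC.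
set a := pw_right f i.
near a^'- => z; exists (f z).
have Oz : pw_open f i z by near: z; exact: (@near_pw_right f i).
have za : a - z < e / M by rewrite ltrBlDl -ltrBlDr; near: z; apply: nbhs_left_gt; rewrite gtrBl divr_gt0.
have az : z < a by near: z; exact: nbhs_left_lt.
change (\forall y \near a^'-, ball (f z) e (f y)); near=> y; rewrite /ball /=.
have Oy : pw_open f i y by near: y; exact: (@near_pw_right f i).
have ay : y < a by near: y; exact: nbhs_left_lt.
have yz : z < y by near: y; apply: nbhs_left_gt.
have /andP[_] := pw_lipP HC Oz Oy => /le_lt_trans; apply.
rewrite mulrC -ltr_pdivlMr//; apply: le_lt_trans za.
by rewrite ltr0_norm ?subr_lt0//; lra.
Unshelve. all: by end_near. Qed.

Lemma bext_continuous f i : {within `[pw_left f i, pw_right f i], continuous (bext f i)}.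
Proof.
have ab := pw_left_lt_right f i.
apply/(continuous_within_itvP _ ab); split.
- move=> x xab; have Ox : pw_open f i x by [].
  have /= cf := pw_open_continuous Ox.
  rewrite /continuous_at /= bext_open//.
  apply: cvg_trans cf; apply: near_eq_cvg.
  have /andP[h1 h2] : pw_left f i < x < pw_right f i by move: xab; rewrite in_itv.
  near=> y; rewrite bext_open// /pw_open /= in_itv/=; apply/andP; split; near: y.
    exact: lt_nbhsr.
  exact: lt_nbhsl.
- apply: cvg_trans (@bext_left f i); apply: near_eq_cvg.
  by near do rewrite bext_open//; exact: (@near_pw_left f i).
- apply: cvg_trans (@bext_right f i); apply: near_eq_cvg.
  by near do rewrite bext_open//; exact: (@near_pw_right f i).
Unshelve. all: by end_near. Qed.

End branches.

(** * Measures given by a density *)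

Section density_measure.
Context d (T : measurableType d) (R : realType).
Variables (mu : {sigma_finite_measure set T -> \bar R}) (h : T -> R).
Hypotheses (h0 : forall x, 0 <= h x) (ih : mu.-integrable setT (EFin \o h)).

(** The two proofs are arguments so that the structure of a finite measure can be attached to this
    set function. *)
Definition dens of (forall x, 0 <= h x) & mu.-integrable setT (EFin \o h) :
  set T -> \bar R := fun A => (\int[mu]_(x in A) (h x)%:E)%E.

Let mh : measurable_fun setT (EFin \o h).
Proof. exact: measurable_int ih. Qed.

Let dens0 : dens h0 ih set0 = 0%E.
Proof. by rewrite /dens integral_set0. Qed.

Let dens_ge0 A : (0 <= dens h0 ih A)%E.
Proof. by apply: integral_ge0 => x _; rewrite lee_fin. Qed.

Let dens_sigma_additive : semi_sigma_additive (dens h0 ih).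
Proof.
move=> /= F mF tF mUF; rewrite /dens; apply: cvg_toP.
  apply: ereal_nondecreasing_is_cvgn => k n kn.
  by apply: lee_sum_nneg_natr => // j _ _; exact: dens_ge0.
rewrite ge0_integral_bigcup//=.
  exact: measurable_funTS mh.
by move=> x _; rewrite lee_fin.
Qed.

HB.instance Definition _ := isMeasure.Build _ _ _ (dens h0 ih)
  dens0 dens_ge0 dens_sigma_additive.

Let dens_fin : fin_num_fun (dens h0 ih).
Proof.
move=> A mA; rewrite ge0_fin_numE//.
have /integrableP[_] := integrableS measurableT mA (@subsetT _ A) ih.
rewrite (eq_integral (fun x => (h x)%:E)) // => x _.
by rewrite /= ger0_norm.
Qed.

HB.instance Definition _ := @Measure_isFinite.Build _ _ _ (dens h0 ih) dens_fin.

Lemma dens_dominates : dens h0 ih `<< mu.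
Proof.
apply/null_content_dominatesP => A mA A0; rewrite /dens.
by apply: null_set_integral => //; exact: measurable_funTS mh.
Qed.

(** [h] and the Radon-Nikodym derivative of [dens] have the same integrals over measurable sets,
    hence agree almost everywhere, and the change of variables known for the latter transfers to
    [h]. *)
Lemma ge0_integral_dens (f : T -> \bar R) E : (forall x, 0 <= f x)%E ->
    measurable E -> measurable_fun E f ->
  (\int[dens h0 ih]_(x in E) f x = \int[mu]_(x in E) (f x * (h x)%:E))%E.
Proof.
move=> f0 mE mf.
pose nu : {finite_measure set T -> \bar R} := dens h0 ih.
have numu : nu `<< mu := dens_dominates.
rewrite -[LHS](@Radon_Nikodym_SigmaFinite.change_of_variables _ _ _ nu mu numu)//.
have mRN : mu.-integrable setT (Radon_Nikodym_SigmaFinite.f nu mu).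
  exact: Radon_Nikodym_SigmaFinite.f_integrable.
have H : ae_eq mu E (Radon_Nikodym_SigmaFinite.f nu mu) (EFin \o h).
  apply: integral_ae_eq => //.
  - exact: integrableS mRN.
  - exact: measurable_funTS mh.
  - by move=> A AE mA; rewrite -Radon_Nikodym_SigmaFinite.f_integral.
apply: ae_eq_integral => //.
- by apply: emeasurable_funM => //; exact: measurable_funTS (measurable_int _ mRN).
- by apply: emeasurable_funM => //; exact: measurable_funTS mh.
- by apply: filterS H => x /= H Ex; rewrite H.
Qed.

End density_measure.

(** * Change of variables on a branch *)

Section change_of_variables.
Context {R : realType}.
Notation lam := (@lebesgue_measure R).
Notation T := (measurableTypeR R).

Section increasing.
Variables (phi psi : R -> R) (x y : R).
Hypotheses (xy : x < y) (mphi : measurable_fun setT (phi : T -> T))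
  (dphi : forall z, x <= z <= y -> is_derive z 1 phi (psi z))
  (cpsi : {within `[x, y], continuous psi})
  (psi_gt0 : forall z, x <= z <= y -> 0 < psi z).

Let h z : R := if (x <= z <= y) then psi z else 0.

Let h0 z : 0 <= h z.
Proof. by rewrite /h; case: ifP => // /psi_gt0/ltW. Qed.

Let hE : h = psi \_ `[x, y]%classic.
Proof.
by apply/funext => z; rewrite /h patchE mem_setE in_itv.
Qed.

Let ih : lam.-integrable setT (EFin \o h).
Proof.
rewrite hE -restrict_EFin; apply/integrable_restrict => //.
by rewrite setTI; apply: continuous_compact_integrable => //; exact: segment_compact.
Qed.

Let FTC u v : x <= u -> u <= v -> v <= y ->
  (\int[lam]_(z in `[u, v]) (psi z)%:E = (phi v - phi u)%:E)%E.
Proof.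
move=> xu + vy; rewrite le_eqVlt => /predU1P[->|uv].
  by rewrite subrr set_itv1 integral_set1.
have D z : u <= z <= v -> is_derive z 1 phi (psi z).
  by move=> /andP[uz zv]; apply: dphi; rewrite (le_trans xu)//= (le_trans zv).
have C z : u <= z <= v -> {for z, continuous phi}.
  move=> /D[d _]; apply: differentiable_continuous.
  exact/derivable1_diffP.
rewrite EFinB; apply: continuous_FTC2 => //.
- apply: continuous_subspaceW cpsi => z /=; rewrite !in_itv/= => /andP[uz zv].
  by rewrite (le_trans xu)//= (le_trans zv).
- split.
  + move=> z; rewrite in_itv/= => /andP[uz zv].
    by have [] := D z; rewrite ?ltW.
  + by apply: cvg_at_right_filter; apply: C; rewrite lexx ltW.
  + by apply: cvg_at_left_filter; apply: C; rewrite lexx ltW.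
- move=> z; rewrite in_itv/= => /andP[uz zv]; rewrite derive1E.
  by have [] := D z; rewrite ?ltW.
Qed.

Let C z : x <= z <= y -> {for z, continuous phi}.
Proof.
move=> /dphi[d _]; apply: differentiable_continuous.
exact/derivable1_diffP.
Qed.

Let inc u v : x <= u -> u < v -> v <= y -> phi u < phi v.
Proof.
move=> xu uv vy; have [||c] := @MVT R phi psi u v uv.
- move=> z; rewrite in_itv/= => /andP[uz zv]; apply: dphi.
  by rewrite (le_trans xu (ltW uz))//= (le_trans (ltW zv)).
- apply: continuous_in_subspaceT => z; rewrite inE /= in_itv/= => /andP[uz zv].
  by apply: C; rewrite (le_trans xu)//= (le_trans zv).
rewrite in_itv/= => /andP[uc cv] E.
rewrite -subr_gt0 E mulr_gt0 ?subr_gt0// psi_gt0//.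
by rewrite (le_trans xu (ltW uc))//= (le_trans (ltW cv)).
Qed.

Let inc_le u v : x <= u -> u <= v -> v <= y -> phi u <= phi v.
Proof.
by move=> xu; rewrite le_eqVlt => /predU1P[->//|uv vy]; exact/ltW/inc.
Qed.

Let m1 := @dens _ T R lam h h0 ih.
Let K : set R := `[phi x, phi y]%classic.

Let pre t : set R := phi @^-1` `]-oo, t].

Let mpre t : measurable (pre t : set T).
Proof.
by rewrite /pre -[X in measurable X]setTI; apply: mphi.
Qed.

Let m1pre t : m1 (pre t) = lam (`]-oo, t]%classic `&` K).
Proof.
have HX : m1 (pre t) = (\int[lam]_(z in pre t `&` `[x, y]%classic) (psi z)%:E)%E.
  rewrite /m1 /dens integral_mkcondr; apply: eq_integral => z _.
  by rewrite hE restrict_EFin.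
rewrite HX; have [tx|xt] := ltP t (phi x).
  rewrite [X in (\int[_]_(_ in X) _)%E](_ : _ = set0); last first.
    apply/seteqP; split=> z //=; rewrite /pre /= !in_itv/= => -[zt /andP[xz zy]].
    have := inc_le (lexx x) xz zy; rewrite leNgt => /negP; apply.
    exact: le_lt_trans tx.
  rewrite integral_set0 [X in lam X](_ : _ = set0) ?measure0//.
  apply/seteqP; split=> z //=; rewrite /K /= !in_itv/= => -[zt /andP[xz zy]].
  by have := lt_le_trans tx xz; rewrite ltNge zt.
(* [z] solves [phi z = t], or is [y] when [t] is at least [phi y]; the fundamental theorem of
   calculus then evaluates the integral of [psi] over [[x, z]]. *)
have [z /andP[xz zy] [z1 z2]] : exists2 z, x <= z <= y &
    (forall w, x <= w <= y -> (phi w <= t) = (w <= z)) /\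
    `]-oo, t]%classic `&` K = `[phi x, phi z]%classic.
  have [yt|ty] := leP (phi y) t.
    exists y; first by rewrite lexx ltW.
    split=> [w /andP[xw wy]|].
      by rewrite wy (le_trans _ yt)// inc_le.
    apply/seteqP; split=> w; rewrite /K /= !in_itv/=; first by case.
    by move=> /andP[h1 h2]; rewrite h1 h2 (le_trans h2).
  have [||z] := @IVT R phi x y t (ltW xy).
  - apply: continuous_in_subspaceT => z; rewrite inE /= in_itv/=; exact: C.
  - by rewrite ge_min xt/= le_max (ltW ty) orbT.
  rewrite in_itv/= => /andP[xz zy] pz; exists z; first by rewrite xz.
  split=> [w /andP[xw wy]|].
    rewrite -pz; have [wz|zw] := leP w z; first by rewrite inc_le.
    by apply/negbTE; rewrite -ltNge inc.
  rewrite pz; apply/seteqP; split=> w; rewrite /K /= !in_itv/=.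
    by move=> [-> /andP[->]].
  by move=> /andP[-> wt]; split => //=; rewrite (le_trans wt)// ltW.
rewrite z2 lebesgue_measure_itv/=.
rewrite [X in (\int[_]_(_ in X) _)%E](_ : _ = `[x, z]%classic); last first.
  apply/seteqP; split=> w; rewrite /pre /= !in_itv/=.
    by move=> [wt /andP[xw wy]]; rewrite xw /= -z1 ?xw.
  move=> /andP[xw wz]; rewrite xw (le_trans wz)//; split => //.
  by rewrite z1// xw (le_trans wz).
rewrite FTC//; have := inc_le (lexx x) xz zy; rewrite le_eqVlt lte_fin.
by case: ltgtP => // -> _; rewrite subrr.
Qed.

Let mK : measurable (K : set T).
Proof. exact: measurable_itv. Qed.

Let m2 : {measure set T -> \bar R} :=
  measure_function_pushforward__canonical__measure_function_Measure m1 mphi.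

Let m2_itv s t : s < t -> m2 `]s, t]%classic = lam (`]s, t]%classic `&` K).
Proof.
move=> st.
have E (Z : set R) : `]s, t]%classic `&` Z =
    (`]-oo, t]%classic `&` Z) `\` (`]-oo, s]%classic `&` Z).
  apply/seteqP; split=> w /=; rewrite !in_itv/=.
    move=> [/andP[sw wt] Zw]; split => // -[ws _].
    by move: sw; rewrite ltNge ws.
  move=> [[wt Zw] H]; split => //; rewrite wt andbT ltNge.
  by apply/negP => ws; apply: H.
have st' (Z : set R) : `]-oo, t]%classic `&` Z `&` (`]-oo, s]%classic `&` Z) = `]-oo, s]%classic `&` Z.
  apply/seteqP; split=> w /=; rewrite !in_itv/=; first by case.
  by move=> [ws Zw]; do 2 split => //; rewrite (le_trans ws)// ltW.
have lK : (lam K < +oo)%E.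
  by rewrite /K lebesgue_measure_itv/=; case: ifP => _; rewrite ?ltry// -EFinB ltry.
have lKI (Z : set T) : measurable Z -> (lam (Z `&` K) < +oo)%E.
  move=> mZ; apply: le_lt_trans lK; apply: le_measure; rewrite ?inE//.
  exact: measurableI.
have -> : lam (`]s, t]%classic `&` K) =
    (lam (`]-oo, t]%classic `&` K) - lam (`]-oo, s]%classic `&` K))%E.
  rewrite E [LHS]measureD; [|by apply: measurableI..|exact: lKI].
  by rewrite st'.
rewrite -!m1pre.
have -> : m2 `]s, t]%classic = m1 (pre t `\` pre s).
  by have := E setT; rewrite !setIT => ->.
rewrite [LHS]measureD; [|exact: mpre..|by rewrite [X in (X < _)%E]m1pre; exact: lKI].
congr (_ - m1 _)%E; rewrite /pre -preimage_setI.
by have := st' setT; rewrite !setIT => ->.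
Qed.

Let mCK : measurable (~` K : set T).
Proof. exact: measurableC. Qed.

(** Uniqueness of Lebesgue measure compares measures of the whole line on half-open intervals, so
    the image measure, carried by [K], is completed by Lebesgue measure off [K]. *)
Let m3 : {measure set T -> \bar R} := measure_add m2 (mrestr lam mCK).

Let m3_add A : m3 A = (m2 A + lam (A `&` ~` K))%E.
Proof. exact: measure_addE. Qed.

Let m3E (A : set T) : measurable A -> A `<=` K -> lam A = m2 A.
Proof.
move=> mA AK.
have -> : lam A = m3 A.
  apply: (@lebesgue_measure_unique R m3) => // _ [[s t]] _ <-.
  rewrite [(s, t).1]/= [(s, t).2]/=.
  have [st|ts] := ltP s t; last first.
    by rewrite set_itv_ge ?bnd_simp -?leNgt// !measure0.
  rewrite m3_add m2_itv// -measureU; last first.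
  - by rewrite setIACA setICr setI0.
  - exact: measurableI.
  - exact: measurableI.
  by rewrite -setIUr setUv setIT.
rewrite m3_add -[RHS]adde0; congr (_ + _)%E.
rewrite (_ : A `&` _ = set0) ?measure0//.
by apply/seteqP; split=> z // [/AK].
Qed.

(** The image under [phi] of the measure with density [psi] is Lebesgue measure on [K] ([m3E]), and
    integrals against an image measure are integrals of the composition. *)
Lemma increasing_change_of_variables (g : R -> \bar R) :
  measurable_fun setT (g : T -> \bar R) -> (forall z, 0 <= g z)%E ->
  (\int[lam]_(z in `[x, y]) (g (phi z) * (psi z)%:E) = \int[lam]_(z in `[phi x, phi y]) g z)%E.
Proof.
move=> mg g0.
rewrite -[RHS](@eq_measure_integral _ _ _ _ lam m2); last by move=> A mA AK; exact/esym/m3E.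
rewrite /m2 ge0_integral_pushforward//=; last exact: measurable_funS mg.
have mpK : measurable (phi @^-1` K : set T).
  by rewrite -[X in measurable X]setTI; exact: mphi.
rewrite ge0_integral_dens//; last first.
  by apply: (@measurable_comp _ _ _ _ _ _ setT) => //; exact: measurable_funTS.
rewrite integral_mkcond [RHS]integral_mkcond; apply: eq_integral => z _.
rewrite !patchE; case: ifPn => [|]; rewrite ?notin_setE ?inE/= in_itv/=.
  move=> zxy; rewrite ifT; first by rewrite /h zxy.
  have /andP[xz zy] := zxy.
  by rewrite inE /= /K /= in_itv/= !inc_le.
by move=> /negP nz; case: ifP => // _; rewrite /h (negbTE nz) mule0.
Qed.

End increasing.
End change_of_variables.

(** * Integrals of bounded measurable functions over segments *)

Section bounded_integrals.
Context {R : realType}.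
Notation lam := (@lebesgue_measure R).
Notation T := (measurableTypeR R).
Implicit Types (g k : R -> R) (a b B : R).

(** Not oriented: for [b < a] the segment is empty and the integral is 0. *)
Definition itg g a b : R := \int[lam]_(t in `[a, b]) g t.

(** An explicit bound gives integrability on the segment and propagates through sums and
    products. *)
Definition bmon a b g B : Prop :=
  measurable_fun (`[a, b]%classic : set T) (g : T -> R) /\
  forall t, a <= t <= b -> `|g t| <= B.

Lemma bmonS a b a' b' g B : a <= a' -> b' <= b -> bmon a b g B -> bmon a' b' g B.
Proof.
move=> aa bb [mg gB]; split.
  apply: measurable_funS mg => //; apply: subset_itv; rewrite bnd_simp//.
by move=> t /andP[h1 h2]; apply: gB; rewrite (le_trans aa)//= (le_trans h2).
Qed.

Lemma bmonT a b g B : measurable_fun setT (g : T -> R) -> (forall t, `|g t| <= B) ->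
  bmon a b g B.
Proof. by move=> mg gB; split => //; exact: measurable_funTS. Qed.

Lemma bmonD a b g k B B' : bmon a b g B -> bmon a b k B' ->
  bmon a b (fun t => g t + k t) (B + B').
Proof.
move=> [mg gB] [mk kB]; split; first exact: measurable_funD.
by move=> t tab; rewrite (le_trans (ler_normD _ _))// lerD ?gB ?kB.
Qed.

Lemma bmonN a b g B : bmon a b g B -> bmon a b (fun t => - g t) B.
Proof.
move=> [mg gB]; split; first exact: measurableT_comp.
by move=> t tab; rewrite normrN gB.
Qed.

Lemma bmonM a b g k B B' : bmon a b g B -> bmon a b k B' ->
  bmon a b (fun t => g t * k t) (B * B').
Proof.
move=> [mg gB] [mk kB]; split; first exact: measurable_funM.
by move=> t tab; rewrite normrM ler_pM// ?gB ?kB.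
Qed.

Lemma bmon_cst a b c : bmon a b (fun=> c) `|c|.
Proof. by split. Qed.

Lemma bmon_integrable a b g B : bmon a b g B -> lam.-integrable `[a, b] (EFin \o g).
Proof.
move=> [mg gB].
have lab : (lam `[a, b]%classic < +oo)%E.
  by rewrite lebesgue_measure_itv/=; case: ifP => _; rewrite -?EFinB ltry.
apply: (@measurable_bounded_integrable _ T R lam) => //.
exists B; split; first exact: num_real.
by move=> M BM t /=; rewrite in_itv/= => /gB h; exact: le_trans (ltW BM).
Qed.

(** Endpoints are null, so agreement inside suffices; piecewise definitions may then take any value
    at a cut. *)
Lemma eq_itg a b g k : (forall t, a < t < b -> g t = k t) ->
  measurable_fun (`[a, b]%classic : set T) (g : T -> R) ->
  measurable_fun (`[a, b]%classic : set T) (k : T -> R) ->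
  itg g a b = itg k a b.
Proof.
move=> gk mg mk; rewrite /itg /Rintegral.
have H (u : R -> R) : measurable_fun (`[a, b]%classic : set T) (u : T -> R) ->
    (\int[lam]_(t in `[a, b]) (u t)%:E = \int[lam]_(t in `]a, b[) (u t)%:E)%E.
  move=> mu; have mo : measurable_fun `]a, b[ (EFin \o u).
    apply/measurable_EFinP; apply: measurable_funS mu => //.
    by apply: subset_itvW; rewrite bnd_simp.
  by rewrite integral_itv_bndoo.
rewrite !H//; congr fine; apply: eq_integral => t; rewrite inE/= in_itv/= => /gk ->.
by [].
Qed.

Lemma itg_cst a b c : a <= b -> itg (fun=> c) a b = c * (b - a).
Proof.
move=> ab; rewrite /itg Rintegral_cst//= lebesgue_measure_itv/=.
rewrite lte_fin; move: ab; rewrite le_eqVlt => /predU1P[->|->].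
  by rewrite ltxx subrr.
by rewrite -EFinB.
Qed.

Lemma itgD a b g k B B' : bmon a b g B -> bmon a b k B' ->
  itg (fun t => g t + k t) a b = itg g a b + itg k a b.
Proof.
by move=> gB kB; rewrite /itg RintegralD//; [exact: bmon_integrable gB|exact: bmon_integrable kB].
Qed.

Lemma itgM a b g c B : bmon a b g B ->
  itg (fun t => c * g t) a b = c * itg g a b.
Proof.
by move=> gB; rewrite /itg RintegralZl//; exact: bmon_integrable gB.
Qed.

Lemma itgB a b g k B B' : bmon a b g B -> bmon a b k B' ->
  itg (fun t => g t - k t) a b = itg g a b - itg k a b.
Proof.
by move=> gB kB; rewrite /itg RintegralB//; [exact: bmon_integrable gB|exact: bmon_integrable kB].
Qed.

Lemma itg_le a b g k B B' : bmon a b g B -> bmon a b k B' ->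
  (forall t, a <= t <= b -> g t <= k t) -> itg g a b <= itg k a b.
Proof.
move=> gB kB gk; rewrite /itg.
apply: (le_Rintegral _ (bmon_integrable gB) (bmon_integrable kB)) => //.
Qed.

Lemma itg_bound a b g B : a <= b -> bmon a b g B -> `|itg g a b| <= B * (b - a).
Proof.
move=> ab gB; have cB := @bmon_cst a b B; have cNB := @bmon_cst a b (- B).
rewrite ler_norml -mulNr -!(itg_cst _ ab); apply/andP; split.
- by apply: (itg_le cNB gB) => t /(gB.2); rewrite ler_norml => /andP[].
- by apply: (itg_le gB cB) => t /(gB.2); rewrite ler_norml => /andP[].
Qed.

Lemma itg_split a b c g B : a <= c -> c <= b -> bmon a b g B ->
  itg g a b = itg g a c + itg g c b.
Proof.
move=> ac cb gB; have I := bmon_integrable gB.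
rewrite /itg -[LHS](subrK (\int[lam]_(t in `[a, c]) g t)) addrC; congr (_ + _).
rewrite (@Rintegral_itvB _ g (BLeft a) (BRight b) c I) ?bnd_simp//.
rewrite Rintegral_itv_obnd_cbnd//; apply: integrableS I => //.
by apply: subset_itv; rewrite bnd_simp.
Qed.

Lemma itg_pt a g : itg g a a = 0.
Proof. by rewrite /itg set_itv1 Rintegral_set1. Qed.

End bounded_integrals.

Section branch_change_of_variables.
Context {R : realType} {m : nat}.
Notation lam := (@lebesgue_measure R).
Notation T := (measurableTypeR R).
Variable f : pwexp R m.

Lemma pw_measurable : measurable_fun setT (f : T -> R).
Proof.
pose C := [set pw_cut f i | i in [set: 'I_m.+1]].
have mC : finite_set C by exact: finite_image.
have mO i : measurable (pw_open f i : set T) by exact: measurable_itv.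
have mout : measurable (~` `[0, 1]%classic : set T) by exact: measurableC.
(* A sequence, in order to have a countable union; indices from [m] on contribute the empty set. *)
pose O (n : nat) : set T := if insub n is Some i then pw_open f i else set0.
have mO' n : measurable (O n) by rewrite /O; case: insubP.
have mC' : measurable (C : set T).
  by apply: countable_measurable; [move=> t; exact: measurable_set1|exact: finite_set_countable].
rewrite (_ : setT = (~` `[0, 1]%classic) `|` (C `|` \bigcup_n O n)); last first.
  apply/seteqP; split=> // x _.
  have [x01|] := pselect (`[0, 1]%classic x); last by left.
  right; move: x01; rewrite -(pw_cover f) => -[i _ /pw_int_closed/andP[]].
  rewrite le_eqVlt => /predU1P[<- _|ax].
    by left; exists (widen_ord (leqnSn m) i).
  rewrite le_eqVlt => /predU1P[->|xb]; first by left; exists (lift ord0 i).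
  by right; exists i => //; rewrite /O valK /pw_open /= in_itv/= ax.
apply/measurable_funU => //.
  by apply: measurableU => //; exact: bigcup_measurable.
split.
  apply: (@eq_measurable_fun _ _ T R _ (fun=> 0)) => // x; rewrite inE => x01.
  by rewrite pw_out.
apply/measurable_funU => //; first exact: bigcup_measurable.
split.
  move=> mC'' Y mY; apply: countable_measurable; first by move=> t; exact: measurable_set1.
  by apply: finite_set_countable; exact: sub_finite_set mC.
apply/measurable_fun_bigcup => // n; rewrite /O; case: insubP => [i _ _|_].
  apply: open_continuous_measurable_fun; first exact: itv_open.
  by move=> x; rewrite inE; exact: pw_open_continuous.
exact: measurable_fun_set0.
Qed.

Lemma pw_der_continuous i x y : pw_open f i x -> pw_open f i y ->
  {within `[x, y], continuous (pw_der f i)}.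
Proof.
move=> Ox Oy; have [_] := pw_C1 f i; apply: continuous_subspaceW.
by move=> z; rewrite /= in_itv/= => /(pw_open_sub Ox Oy)/pw_open_int.
Qed.

(** The derivative is continuous on the branch and bounded away from 0, so a change of sign would
    contradict the intermediate value theorem. *)
Lemma pw_der_sign i : (forall z, pw_open f i z -> 0 < pw_der f i z) \/
  (forall z, pw_open f i z -> pw_der f i z < 0).
Proof.
have [s [M [L [s1 _ lb _ _]]]] := pw_consts f.
have n0 z : pw_open f i z -> pw_der f i z != 0.
  move=> /pw_open_int/lb; rewrite -normr_gt0; apply: lt_le_trans; lra.
have H x y : pw_open f i x -> pw_open f i y -> x <= y ->
    (0 < pw_der f i x) = (0 < pw_der f i y).
  move=> Ox Oy xy; apply/idP/idP => h; rewrite ltNge; apply/negP => h'.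
    have [|c] := @IVT R (pw_der f i) x y 0 xy (pw_der_continuous Ox Oy).
      by rewrite ge_min h' orbT le_max (ltW h).
    by rewrite in_itv/= => /(pw_open_sub Ox Oy)/n0/eqP.
  have [|c] := @IVT R (pw_der f i) x y 0 xy (pw_der_continuous Ox Oy).
    by rewrite ge_min h' le_max (ltW h) orbT.
  by rewrite in_itv/= => /(pw_open_sub Ox Oy)/n0/eqP.
have [[z Oz pz]|N] := pselect (exists2 z, pw_open f i z & 0 < pw_der f i z).
  left=> w Ow; have [wz|/ltW zw] := leP w z; first by rewrite (H w z).
  by rewrite -(H z w).
right=> z Oz; rewrite lt_neqAle n0//= leNgt; apply/negP => h.
by apply: N; exists z.
Qed.

End branch_change_of_variables.

Section branch_substitution.
Context {R : realType} {m : nat}.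
Notation lam := (@lebesgue_measure R).
Notation T := (measurableTypeR R).
Implicit Types (f : pwexp R m) (g : R -> R).

Lemma ge0_itgN g a b : measurable_fun setT (g : T -> R) -> (forall t, 0 <= g t) ->
  itg (fun t => g (- t)) (- b) (- a) = itg g a b.
Proof.
move=> mg g0; rewrite /itg /Rintegral; congr fine.
have mN : measurable_fun setT (-%R : T -> T) by exact: oppr_measurable.
pose lamN : {measure set T -> \bar R} :=
  measure_function_pushforward__canonical__measure_function_Measure lam mN.
rewrite -[RHS](@eq_measure_integral _ _ _ _ lam lamN); last first.
  by move=> A mA _; exact: lebesgue_measureN.
rewrite /lamN ge0_integral_pushforward//=; last 2 first.
- by apply/measurable_EFinP; exact: measurable_funTS.
- by move=> t _; rewrite lee_fin.
congr (\int[_]_(_ in _) _)%E; apply/seteqP; split => t /=; rewrite !in_itv/=.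
  by rewrite lerNl lerNr andbC.
by rewrite lerNl (lerNr a) andbC.
Qed.

Lemma pw_der_bmon f s M L i x y : pw_const f s M L -> pw_open f i x -> pw_open f i y ->
  bmon x y (pw_der f i) M.
Proof.
move=> [_ _ _ ub _] Ox Oy; split.
  apply: subspace_continuous_measurable_fun => //.
  exact: pw_der_continuous.
by move=> t /(pw_open_sub Ox Oy)/pw_open_int/ub.
Qed.

(** A decreasing branch is handled through the increasing map [- f] and the integrand [g (- t)]. *)
Let ge0_pw_substitution f i x y g : x < y -> pw_open f i x -> pw_open f i y ->
  measurable_fun setT (g : T -> R) -> (forall t, 0 <= g t) ->
  itg (fun t => g (f t) * `|pw_der f i t|) x y =
  itg g (Num.min (f x) (f y)) (Num.max (f x) (f y)).
Proof.
move=> xy Ox Oy mg g0; have O z : x <= z <= y -> pw_open f i z by exact: pw_open_sub.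
have D z : x <= z <= y -> is_derive z 1 f (pw_der f i z) by move=> /O/pw_der_is_derive.
have mvt := pw_MVT Ox Oy xy.
have [P|N] := pw_der_sign f i.
  have fxy : f x < f y.
    have [c /andP[xc cy] E] := mvt; rewrite -subr_gt0 E mulr_gt0 ?subr_gt0//.
    by apply: P; apply: O; rewrite !ltW.
  rewrite (min_idPl (ltW fxy)) (max_idPr (ltW fxy)).
  rewrite /itg /Rintegral; congr fine.
  rewrite -(@increasing_change_of_variables R f (pw_der f i) x y xy) //.
  - apply: eq_integral => z; rewrite inE/= in_itv/= => /O/P/gtr0_norm ->.
    by rewrite EFinM.
  - exact: pw_measurable.
  - exact: pw_der_continuous.
  - by move=> z /O/P.
  - exact/measurable_EFinP.
have fxy : f y < f x.
  have [c /andP[xc cy] E] := mvt; rewrite -subr_lt0 E pmulr_llt0 ?subr_gt0//.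
  by apply: N; apply: O; rewrite !ltW.
rewrite (min_idPr (ltW fxy)) (max_idPl (ltW fxy)) -[RHS]ge0_itgN//.
rewrite /itg /Rintegral; congr fine.
apply: (etrans _ (@increasing_change_of_variables R (fun t => - f t)
  (fun t => - pw_der f i t) x y xy _ _ _ _ (fun t => (g (- t))%:E) _ _)).
- apply: eq_integral => z; rewrite inE/= in_itv/= => /O/N/ltr0_norm ->.
  by rewrite EFinM opprK.
- apply: (@measurableT_comp _ _ _ _ _ _ (-%R : T -> T)); first exact: oppr_measurable.
  exact: pw_measurable.
- by move=> z /D h; exact: is_deriveN.
- move=> z; apply: continuousN; exact: pw_der_continuous.
- by move=> z /O/N; rewrite oppr_gt0.
- apply/measurable_EFinP; apply: (@measurableT_comp _ _ _ _ _ _ (g : T -> R)); first exact: mg.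
  exact: oppr_measurable.
- by move=> z /=; rewrite lee_fin.
Qed.

(** [g + B] is nonnegative; the constant function 1 gives the length of the image, and [B] times
    that identity is subtracted. *)
Lemma pw_substitution f i x y g B : x <= y -> pw_open f i x -> pw_open f i y ->
  measurable_fun setT (g : T -> R) -> (forall t, `|g t| <= B) ->
  itg (fun t => g (f t) * `|pw_der f i t|) x y =
  itg g (Num.min (f x) (f y)) (Num.max (f x) (f y)).
Proof.
rewrite le_eqVlt => /predU1P[->|xy] Ox Oy mg gB.
  by rewrite minxx maxxx !itg_pt.
have B0 : 0 <= B by exact: le_trans (normr_ge0 _) (gB 0).
set k1 := Num.min _ _; set k2 := Num.max _ _.
have [s [M [L HC]]] := pw_consts f.
have k12 : k1 <= k2 by rewrite /k1 /k2 ge_min !le_max lexx.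
have mB : measurable_fun setT ((fun t => g t + B) : T -> R) by exact: measurable_funD.
have gB0 t : 0 <= g t + B by rewrite -lerBlDr sub0r; have := gB t; rewrite ler_norml => /andP[].
have := ge0_pw_substitution xy Ox Oy mB gB0; rewrite -/k1 -/k2.
have := @ge0_pw_substitution f i x y (fun=> 1) xy Ox Oy; rewrite -/k1 -/k2.
rewrite (itg_cst _ k12) mul1r => /(_ (measurable_cst _) (fun=> ler01)) H1.
have bD : bmon x y (fun t => `|pw_der f i t|) M.
  have [md dM] := pw_der_bmon HC Ox Oy; split; first exact: measurableT_comp.
  by move=> t /dM; rewrite normr_id.
have bg : bmon x y (fun t => g (f t)) B.
  apply: bmonT => //.
  by apply: (@measurableT_comp _ _ _ _ _ _ (g : T -> R)) => //; exact: pw_measurable.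
have bk : bmon k1 k2 g B by exact: bmonT.
rewrite (itgD bk (@bmon_cst _ _ _ B)) (itg_cst _ k12).
have -> : itg (fun t => (g (f t) + B) * `|pw_der f i t|) x y =
    itg (fun t => g (f t) * `|pw_der f i t|) x y + B * (k2 - k1).
  have H2 : itg (fun t => `|pw_der f i t|) x y = k2 - k1.
    by rewrite -H1; congr itg; apply/funext => t; rewrite mul1r.
  rewrite -H2 -(itgM _ bD) -(itgD (bmonM bg bD) (bmonM (@bmon_cst _ x y B) bD)).
  by congr itg; apply/funext => t; rewrite mulrDl.
by move/addIr.
Qed.

End branch_substitution.

(** * Abel summation: integrals against monotone and Lipschitz weights *)

Section abel.
Context {R : realType}.
Notation lam := (@lebesgue_measure R).
Notation T := (measurableTypeR R).
Implicit Types (u w : R -> R).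

Lemma lipschitz_within_continuous (x y : R) w (K : R) :
  (forall u v : R, x <= u <= y -> x <= v <= y -> `|w u - w v| <= K * `|u - v|) ->
  {within `[x, y], continuous w}.
Proof.
move=> H; apply/subspace_continuousP => t /=; rewrite in_itv/= => txy.
apply/(@cvgrPdist_lt R R) => e e0.
have K1 : 0 < `|K| + 1 by rewrite ltr_wpDl.
apply/nbhs_ballP; exists (e / (`|K| + 1)) => /=; first by rewrite divr_gt0.
move=> z; rewrite /ball /= => tz; rewrite /= in_itv/= => zxy.
apply: (le_lt_trans (H _ _ txy zxy)).
have : K * `|t - z| <= (`|K| + 1) * `|t - z|.
  by rewrite ler_wpM2r// (le_trans (ler_norm K))// lerDl.
by move=> /le_lt_trans; apply; rewrite mulrC -ltr_pdivlMr.
Qed.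

(** The sum counts the integers from 1 to [N] not above [s], so it is the integer part of [s]. With
    [s] a rescaled weight, this is the error of a staircase approximation. *)
Lemma count_thresholds (N : nat) (s : R) : 0 <= s <= N%:R ->
  0 <= s - \sum_(j < N) (j.+1%:R <= s)%R%:R <= 1.
Proof.
elim: N s => [|N IH] s /andP[s0 sN].
  by rewrite big_ord0 subr0 s0 (le_trans sN).
rewrite big_ord_recr/=; have [sN'|Ns] := leP s N%:R.
  have -> : (N.+1%:R <= s) = false.
    by apply/negbTE; rewrite -ltNge (le_lt_trans sN')// ltr_nat.
  by rewrite addr0; apply: IH; rewrite s0.
have -> : \sum_(i < N) (i.+1%:R <= s)%R%:R = N%:R :> R.
  rewrite (eq_bigr (fun=> 1)); first by rewrite sumr_const card_ord.
  by move=> i _; rewrite (le_trans _ (ltW Ns))// ler_nat.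
move: sN; rewrite -natr1 => sN; case: (leP (N%:R + 1) s) => h1; rewrite /= ?mulr1n ?mulr0n; apply/andP; split; lra.
Qed.

Lemma bmon_threshold x y w W c : bmon x y w W -> bmon x y (fun t => (c <= w t)%R%:R) 1.
Proof.
move=> [mw wW]; split; last by move=> t _; case: (c <= w t); rewrite /= ?normr1 ?normr0.
rewrite (_ : (fun t => _) = (fun t => if c <= w t then 1 else 0)); last first.
  by apply/funext => t; case: (c <= w t).
by apply: measurable_fun_if => //; exact: measurable_fun_ler.
Qed.

Lemma bmon_sum x y (N : nat) (F : 'I_N -> R -> R) B : (forall j, bmon x y (F j) B) ->
  bmon x y (fun t => \sum_(j < N) F j t) (N%:R * B) /\
  itg (fun t => \sum_(j < N) F j t) x y = \sum_(j < N) itg (F j) x y.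
Proof.
elim: N F => [|N IH] F FB.
  have -> : (fun t => \sum_(j < 0) F j t) = fun=> 0.
    by apply/funext => t; rewrite big_ord0.
  have b0 : bmon x y (fun=> 0 : R) 0.
    by have := @bmon_cst R x y 0; rewrite normr0.
  rewrite mul0r big_ord0; split => //.
  apply: etrans (_ : itg (fun t => 0 * (fun=> 0) t) x y = 0).
    by congr itg; apply/funext => t; rewrite mulr0.
  by rewrite (itgM 0 b0) mul0r.
have -> : (fun t => \sum_(j < N.+1) F j t) =
    (fun t => \sum_(j < N) F (widen_ord (leqnSn N) j) t + F ord_max t).
  by apply/funext => t; rewrite big_ord_recr.
have [b1 E1] := IH (fun j => F (widen_ord (leqnSn N) j)) (fun j => FB _).
split; first by rewrite -natr1 mulrDl mul1r; exact: bmonD.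
by rewrite (itgD b1 (FB ord_max)) E1 big_ord_recr.
Qed.

(** Up to an error [W / N], the weight is [W / N] times the number of thresholds that it reaches.
    Superlevel sets of a nondecreasing weight are terminal segments of [[x, y]], over which [u] has
    integral at most [V]; [N] thresholds of height [W / N] give [V * W]. *)
Lemma abel_nondecreasing x y u w B V W : x <= y -> bmon x y u B -> bmon x y w W ->
  0 <= W ->
  (forall s t, x <= s -> s <= t -> t <= y -> `|itg u s t| <= V) ->
  (forall s t, x <= s -> s <= t -> t <= y -> 0 <= w s <= w t) ->
  `|itg (fun t => u t * w t) x y| <= V * W.
Proof.
move=> xy uB wW W0 uV wmon.
have V0 : 0 <= V by exact: le_trans (uV x x _ _ _).
have wW' t : x <= t <= y -> 0 <= w t <= W.
  move=> txy; have /andP[xt ty] := txy; have /andP[-> _] := wmon t t xt (lexx t) ty.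
  by have := wW.2 t txy; rewrite ler_norml => /andP[].
have step c : `|itg (fun t => u t * (c <= w t)%R%:R) x y| <= V.
  (* [z] is the supremum of the points where [w < c], or [x] if there are none; what [w] does at [z]
     itself does not affect the integral. *)
  have [z /andP[xz zy] [z1 z2]] : exists2 z, x <= z <= y &
      (forall t, x <= t -> t < z -> w t < c) /\ (forall t, z < t -> t <= y -> c <= w t).
    pose S := [set t | x <= t <= y /\ w t < c].
    have [[t0 [/andP[xt0 t0y] wt0]]|nS] := pselect (S !=set0); last first.
      exists x; rewrite ?lexx//; split=> [t xt|t xt ty].
        by rewrite ltNge xt.
      by rewrite leNgt; apply/negP => wc; apply: nS; exists t; split => //; rewrite (ltW xt).
    have sS : has_sup S.
      by split; [exists t0; split => //; rewrite xt0|exists y => t [/andP[]]].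
    exists (sup S).
      rewrite (le_trans xt0)/=; last by apply: ub_le_sup => //; [exact: sS.2|split=> //; rewrite xt0].
      by apply: ge_sup; [exact: sS.1|move=> t [/andP[]]].
    split=> [t xt tS|t St ty].
      have [t' [/andP[xt' t'y] wt'] tt'] := @sup_gt _ S t sS.1 tS.
      by apply: le_lt_trans wt'; have /andP[] := wmon t t' xt (ltW tt') t'y.
    have t0S : t0 <= sup S by apply: ub_le_sup; [exact: sS.2|split=> //; rewrite xt0].
    have xt : x <= t by rewrite (le_trans xt0)// (le_trans t0S)// ltW.
    rewrite leNgt; apply/negP => wc; move: St; rewrite ltNge => /negP; apply.
    by apply: ub_le_sup; [exact: sS.2|split=> //; rewrite xt].
  have buc := bmonM uB (bmon_threshold c wW).
  rewrite (itg_split xz zy buc).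
  have buc1 := bmonS (lexx x) zy buc; have buc2 := bmonS xz (lexx y) buc.
  have bu1 := bmonS (lexx x) zy uB; have bu2 := bmonS xz (lexx y) uB.
  rewrite (@eq_itg _ x z _ (fun t => 0 * u t)) ?(itgM _ bu1) ?mul0r ?add0r; last 3 first.
  - move=> t /andP[xt tz]; have := z1 t (ltW xt) tz; rewrite ltNge => /negbTE ->.
    by rewrite mulr0 mul0r.
  - by case: buc1.
  - by case: (bmonM (@bmon_cst _ x z 0) bu1).
  rewrite (@eq_itg _ z y _ u); first exact: uV.
  - by move=> t /andP[zt ty]; rewrite z2 ?mulr1// ltW.
  - by case: buc2.
  - by case: bu2.
have [W1|W1] := eqVneq W 0.
  rewrite W1 mulr0 (@eq_itg _ x y _ (fun t => 0 * u t)) ?(itgM _ uB) ?mul0r ?normr0//.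
  - move=> t /andP[xt ty]; have := wW' t; rewrite (ltW xt) (ltW ty) => /(_ isT).
    by rewrite W1 => /le_anti <-; rewrite mulr0 mul0r.
  - by case: (bmonM uB wW).
  - by case: (bmonM (@bmon_cst _ x y 0) uB).
have {}W1 : 0 < W by rewrite lt_neqAle eq_sym W1.
have B0 : 0 <= B by apply: le_trans (normr_ge0 _) (uB.2 x _); rewrite lexx.
apply/ler_addgt0Pr => e e0.
(* Large enough that a weight error of [W / N] costs at most [e] in the integral. *)
pose N := (Num.truncn (B * W * (y - x) / e)).+1.
have N0 : 0 < N%:R :> R by rewrite ltr0n.
have NB : B * (W / N%:R) * (y - x) <= e.
  have : B * W * (y - x) / e <= N%:R by rewrite ltW// truncnS_gt.
  rewrite ler_pdivrMr// => h.
  by rewrite mulrA mulrAC ler_pdivrMr// (mulrC e).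
pose F (j : 'I_N) t : R := u t * (j.+1%:R * (W / N%:R) <= w t)%R%:R.
have FB j : bmon x y (F j) (B * 1) by apply: bmonM => //; exact: bmon_threshold wW.
have [SB SE] := bmon_sum FB.
have cSB := bmonM (@bmon_cst _ x y (W / N%:R)) SB.
have uwB := bmonM uB wW.
rewrite -[itg _ x y](subrK (W / N%:R * itg (fun t => \sum_(j < N) F j t) x y)).
apply: (le_trans (ler_normD _ _)); rewrite addrC; apply: lerD.
  rewrite normrM SE gtr0_norm ?divr_gt0// mulrC -ler_pdivlMr ?divr_gt0//.
  apply: (le_trans (ler_norm_sum _ _ _)).
  have -> : V * W / (W / N%:R) = V * N%:R by field; rewrite !gt_eqF.
  apply: (@le_trans _ _ (\sum_(j < N) V)); first by apply: ler_sum => j _; exact: step.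
  by rewrite sumr_const card_ord mulr_natr.
apply: le_trans NB; rewrite -(itgM _ SB) -(itgB uwB cSB); apply: itg_bound => //.
split; first by have [] := bmonD uwB (bmonN cSB).
move=> t txy; rewrite /F -mulr_sumr mulrCA -mulrBr normrM; apply: ler_pM => //; first exact: uB.2.
have /andP[w0 w1] := wW' _ txy.
have WN : 0 < W / N%:R by rewrite divr_gt0.
rewrite -[X in `|X - _|](mulfVK (lt0r_neq0 WN)) -[X in `|X - _|]mulrC -mulrBr normrM (gtr0_norm WN).
rewrite -[leRHS]mulr1 ler_pM2l//.
have := @count_thresholds N (w t / (W / N%:R)).
rewrite divr_ge0 ?(ltW WN)//= ler_pdivrMr// (_ : N%:R * (W / N%:R) = W) => [/(_ w1)|]; last by field; rewrite gt_eqF.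
under eq_bigr do rewrite ler_pdivlMr//.
by move=> /andP[h1 h2]; rewrite ger0_norm.
Qed.

(** Adding [L * (t - x)] makes the weight nondecreasing, so the weight is a difference of two
    nondecreasing ones, bounded by [W + L * (y - x)] and by [L * (y - x)]. *)
Lemma abel_lipschitz x y u w B V W L : x <= y -> bmon x y u B -> bmon x y w W ->
  0 <= L ->
  (forall s t, x <= s -> s <= t -> t <= y -> `|itg u s t| <= V) ->
  (forall t, x <= t <= y -> 0 <= w t) ->
  (forall s t, x <= s <= y -> x <= t <= y -> `|w s - w t| <= L * `|s - t|) ->
  `|itg (fun t => u t * w t) x y| <= V * (W + 2 * L * (y - x)).
Proof.
move=> xy uB wW L0 uV w0 wL.
have yx0 : 0 <= y - x by rewrite subr_ge0.
have W0 : 0 <= W by apply: le_trans (normr_ge0 _) (wW.2 x _); rewrite lexx.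
have lB : bmon x y (fun t => L * (t - x)) (L * (y - x)).
  split; last first.
    move=> t /andP[xt ty]; rewrite normrM (ger0_norm L0) ler_wpM2l// ger0_norm ?subr_ge0//.
    by rewrite lerD2r.
  by apply: measurable_funM => //; apply: measurable_funB => //; exact: measurable_id.
have wlB := bmonD wW lB.
have A1 := abel_nondecreasing xy uB wlB (addr_ge0 W0 (mulr_ge0 L0 yx0)) uV.
have A2 := abel_nondecreasing xy uB lB (mulr_ge0 L0 yx0) uV.
have -> : itg (fun t => u t * w t) x y =
    itg (fun t => u t * (w t + L * (t - x))) x y - itg (fun t => u t * (L * (t - x))) x y.
  rewrite -(itgB (bmonM uB wlB) (bmonM uB lB)).
  by congr itg; apply/funext => t; rewrite -mulrBr addrK.
apply: (le_trans (ler_normB _ _)).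
have -> : V * (W + 2 * L * (y - x)) = V * (W + L * (y - x)) + V * (L * (y - x)) by ring.
apply: lerD; [apply: A1|apply: A2] => s t xs st ty.
  rewrite addr_ge0 ?w0 ?mulr_ge0 ?subr_ge0 ?xs ?(le_trans st)//=.
  have := wL t s; rewrite xs ty (le_trans xs st) (le_trans st ty) => /(_ isT isT).
  rewrite distrC ler_norml => /andP[_]; rewrite ger0_norm ?subr_ge0// => h; lra.
by rewrite mulr_ge0 ?subr_ge0//= ler_wpM2l// lerD2r.
Qed.

End abel.

Section branch_contraction.
Context {R : realType} {m : nat}.
Notation lam := (@lebesgue_measure R).
Notation T := (measurableTypeR R).
Implicit Types (f : pwexp R m) (g : R -> R).

Lemma pw_monotone f i : (forall x y, pw_open f i x -> pw_open f i y -> x < y -> f x < f y) \/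
  (forall x y, pw_open f i x -> pw_open f i y -> x < y -> f y < f x).
Proof.
have [P|N] := pw_der_sign f i; [left|right] => x y Ox Oy xy.
  have [c /andP[xc cy] E] := pw_MVT Ox Oy xy; rewrite -subr_gt0 E mulr_gt0 ?subr_gt0//.
  by apply/P/(pw_open_sub Ox Oy); rewrite !ltW.
have [c /andP[xc cy] E] := pw_MVT Ox Oy xy; rewrite -subr_lt0 E pmulr_llt0 ?subr_gt0//.
by apply/N/(pw_open_sub Ox Oy); rewrite !ltW.
Qed.

Lemma pw_between f i x y z : pw_open f i x -> pw_open f i y -> x <= z <= y ->
  Num.min (f x) (f y) <= f z <= Num.max (f x) (f y).
Proof.
move=> Ox Oy xzy; have Oz := pw_open_sub Ox Oy xzy.
have /andP[] := xzy; rewrite le_eqVlt => /predU1P[<- _|xz].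
  by rewrite ge_min le_max !lexx.
rewrite le_eqVlt => /predU1P[->|zy]; first by rewrite ge_min le_max !lexx !orbT.
rewrite ge_min le_max.
have [H|H] := pw_monotone f i; have h1 := ltW (H _ _ Ox Oz xz); have h2 := ltW (H _ _ Oz Oy zy).
  by rewrite h1 h2 orbT.
by rewrite h1 h2 orbT.
Qed.

(** Write [g \o f] as the product of [(g \o f) * |f'|] and [1 / |f'|]. Integrals of the first factor
    are integrals of [g] over image segments; the weight [1 / |f'|] is at most [s^-1] and Lipschitz
    with constant [L / s ^+ 2]. The resulting factor is below 1 once [y - x] is small. *)
Lemma branch_contraction f s M L i x y g B V :
  pw_const f s M L -> x <= y -> pw_open f i x -> pw_open f i y ->
  measurable_fun setT (g : T -> R) -> (forall t, `|g t| <= B) ->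
  (forall p q, Num.min (f x) (f y) <= p -> p <= q -> q <= Num.max (f x) (f y) ->
     `|itg g p q| <= V) ->
  `|itg (g \o f) x y| <= V * (s^-1 + 2 * (L / s ^+ 2) * (y - x)).
Proof.
move=> HC xy Ox Oy mg gB gV; have [s1 L0 lb ub lip] := HC.
have O z : x <= z <= y -> pw_open f i z by exact: pw_open_sub.
have s0 : 0 < s by lra.
have Dn0 t : x <= t <= y -> 0 < `|pw_der f i t|.
  by move=> /O/pw_open_int/lb; apply: lt_le_trans.
have [mD DM] := pw_der_bmon HC Ox Oy.
have bD : bmon x y (fun t => `|pw_der f i t|) M.
  split; first exact: measurableT_comp.
  by move=> t /DM; rewrite normr_id.
have bg : bmon x y (fun t => g (f t)) B.
  apply: bmonT => //.
  by apply: (@measurableT_comp _ _ _ _ _ _ (g : T -> R)) => //; exact: pw_measurable.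
pose w t := `|pw_der f i t|^-1.
have wlip u v : x <= u <= y -> x <= v <= y -> `|w u - w v| <= L / s ^+ 2 * `|u - v|.
  move=> uxy vxy; have u0 := Dn0 _ uxy; have v0 := Dn0 _ vxy.
  have -> : w u - w v = (`|pw_der f i v| - `|pw_der f i u|) / (`|pw_der f i u| * `|pw_der f i v|).
    by rewrite /w; field; rewrite !gt_eqF.
  rewrite normrM normfV (gtr0_norm (mulr_gt0 u0 v0)) ler_pdivrMr ?mulr_gt0//.
  apply: (le_trans (ler_dist_dist _ _)); rewrite distrC.
  apply: (le_trans (lip _ _ _ (pw_open_int (O _ uxy)) (pw_open_int (O _ vxy)))).
  rewrite (mulrAC L) -[leLHS]mulr1 -!mulrA ler_wpM2l ?(ltW L0)// ler_wpM2l//.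
  rewrite mulrC ler_pdivlMr ?exprn_gt0// mul1r expr2 ler_pM ?(ltW s0)//.
    exact/lb/pw_open_int/O.
  exact/lb/pw_open_int/O.
have bw : bmon x y w s^-1.
  split; last first.
    move=> t txy; rewrite /w normfV normr_id lef_pV2 ?posrE ?Dn0//.
    exact/lb/pw_open_int/O.
  apply: subspace_continuous_measurable_fun => //.
  apply: (@lipschitz_within_continuous _ _ _ _ (L / s ^+ 2) _).
  exact: wlip.
have -> : itg (g \o f) x y = itg (fun t => (g (f t) * `|pw_der f i t|) * w t) x y.
  apply: eq_itg; last first.
  - by have [] := bmonM (bmonM bg bD) bw.
  - by have [] := bg.
  - move=> t /andP[xt ty]; rewrite /w mulfK// gt_eqF// Dn0// !ltW//.
apply: (abel_lipschitz xy (bmonM bg bD) bw) => //.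
- by rewrite divr_ge0// ?(ltW L0)// exprn_ge0// ltW.
- move=> p q xp pq qy; have pO' : x <= p <= y by rewrite xp (le_trans pq).
  have qO' : x <= q <= y by rewrite qy (le_trans xp).
  have pO := O _ pO'; have qO := O _ qO'.
  rewrite (pw_substitution pq pO qO mg gB); apply: gV.
  + have /andP[h1 _] := pw_between Ox Oy (pO' : x <= p <= y).
    have /andP[h2 _] := pw_between Ox Oy (qO' : x <= q <= y).
    by rewrite le_min h1.
  + by rewrite ge_min !le_max lexx.
  + have /andP[_ h1] := pw_between Ox Oy (pO' : x <= p <= y).
    have /andP[_ h2] := pw_between Ox Oy (qO' : x <= q <= y).
    by rewrite ge_max h1.
- by move=> t _; rewrite invr_ge0.
Qed.

End branch_contraction.

(** * The Lasota-Yorke inequality *)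

Section finite_partitions.
Context {R : realType}.
Notation T := (measurableTypeR R).

(** Induction on the list of cuts: an interval is split at each cut inside it until none is left. *)
Lemma cut_induction (Q : R -> R -> Prop) (S : seq R) :
  (forall a b, a < b -> (forall z, z \in S -> ~~ (a < z < b)) -> Q a b) ->
  (forall a c b, a < c -> c < b -> Q a c -> Q c b -> Q a b) ->
  forall a b, a < b -> Q a b.
Proof.
move=> base comb; elim: S base => [|x S IH] base; first by move=> a b ab; exact: base.
apply: IH => a b ab abS; have [/andP[ax xb]|xab] := boolP (a < x < b).
  apply: (comb _ x) => //; apply: base => // z; rewrite inE => /predU1P[->|zS].
  - by rewrite ltxx andbF.
  - apply: contra (abS z zS) => /andP[-> h]; exact: lt_trans xb.
  - by rewrite ltxx.
  - apply: contra (abS z zS) => /andP[h ->]; rewrite andbT; exact: lt_trans h.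
by apply: base => // z; rewrite inE => /predU1P[->//|]; exact: abS.
Qed.

(** Trimming a length [d] off both ends changes the integral by at most [2 * B * d], which is
    arbitrarily small. *)
Lemma itg_inner (a b : R) (u : R -> R) (B V : R) : a <= b -> bmon a b u B -> 0 <= V ->
  (forall x y : R, a < x -> x <= y -> y < b -> `|itg u x y| <= V) ->
  forall x y : R, a <= x -> x <= y -> y <= b -> `|itg u x y| <= V.
Proof.
move=> ab uB V0 H x y ax xy yb; move: (xy); rewrite le_eqVlt => /predU1P[<-|xy'].
  by rewrite itg_pt normr0.
have B0 : 0 <= B by apply: le_trans (normr_ge0 _) (uB.2 a _); rewrite lexx.
apply/ler_addgt0Pr => e e0.
pose d := Num.min ((y - x) / 2) (e / 2 / (B + 1)).
have d0 : 0 < d by rewrite lt_min !divr_gt0 ?subr_gt0// ltr_wpDl.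
have d1 : d <= (y - x) / 2 by rewrite ge_min lexx.
have d2 : B * d <= e / 2.
  have : d <= e / 2 / (B + 1) by rewrite ge_min lexx orbT.
  rewrite ler_pdivlMr ?ltr_wpDl// => h; apply: le_trans h.
  by rewrite mulrC ler_pM2l// lerDl.
have xyB := bmonS ax yb uB.
have h1 : x <= x + d by lra.
have h2 : x + d <= y by lra.
have h3 : x + d <= y - d by lra.
have h4 : y - d <= y by lra.
rewrite (itg_split h1 h2 xyB) (itg_split h3 h4 (bmonS h1 (lexx y) xyB)).
have b1 := itg_bound h1 (bmonS (lexx x) h2 xyB).
have b3 := itg_bound h4 (bmonS (le_trans h1 h3) (lexx y) xyB).
have b2 := H (x + d) (y - d) (le_lt_trans ax _) h3 (lt_le_trans _ yb).
rewrite ltrDl gtrBl d0 in b2; have {}b2 := b2 isT isT.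
have E1 : x + d - x = d by lra.
have E2 : y - (y - d) = d by lra.
rewrite E1 in b1; rewrite E2 in b3.
apply: (le_trans (ler_normD _ _)); have := ler_normD (itg u (x + d) (y - d)) (itg u (y - d) y).
lra.
Qed.

(** [h] is the mean of [u] on each piece between cuts, so the primitive of [u - h] returns to 0 at
    every cut and errors do not accumulate over the pieces. [C] is the sum of the reciprocals of the
    piece lengths: it depends on the cuts and not on [u]. *)
Lemma step_average (S : seq R) (a b : R) : a < b -> exists2 C, 0 <= C &
  forall (u : R -> R) (B V : R), bmon a b u B -> 0 <= V ->
    (forall x y : R, a < x -> x <= y -> y < b -> (forall z, z \in S -> ~~ (x <= z <= y)) ->
       `|itg u x y| <= V) ->
  exists h : R -> R, [/\ measurable_fun setT (h : T -> R), forall t, `|h t| <= C * V,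
    itg (fun t => u t - h t) a b = 0 &
    forall t, a <= t <= b -> `|itg (fun t => u t - h t) a t| <= 2 * V].
Proof.
move: a b; apply: (@cut_induction _ S) => [a b ab abS|a c b ac cb [C1 C10 H1] [C2 C20 H2]].
  exists (b - a)^-1; first by rewrite invr_ge0 subr_ge0 ltW.
  move=> u B V uB V0 uV.
  have bV x y : a <= x -> x <= y -> y <= b -> `|itg u x y| <= V.
    apply: (itg_inner (ltW ab) uB V0) => {}x {}y ax xy yb; apply: uV => // z /abS.
    by apply: contra => /andP[xz zy]; rewrite (lt_le_trans ax xz) (le_lt_trans zy).
  pose c := itg u a b / (b - a).
  have ba0 : 0 < b - a by rewrite subr_gt0.
  have cV : `|c| <= (b - a)^-1 * V.
    by rewrite normrM normfV (gtr0_norm ba0) mulrC ler_wpM2l ?invr_ge0 ?(ltW ba0)// bV// ltW.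
  exists (fun=> c); split => //.
    by rewrite (itgB uB (bmon_cst a b c)) itg_cst ?(ltW ab)// divfK ?gt_eqF// subrr.
  move=> t /andP[at_ tb].
  rewrite (itgB (bmonS (lexx a) tb uB) (bmon_cst a t c)) itg_cst//.
  apply: (le_trans (ler_normB _ _)); rewrite mulrDl mul1r lerD//; first exact: bV.
  rewrite normrM [X in _ * X]ger0_norm ?subr_ge0//.
  apply: (@le_trans _ _ ((b - a)^-1 * V * (b - a))).
    by rewrite ler_pM ?subr_ge0// lerD2r.
  by rewrite mulrC mulrA mulfV ?mul1r ?gt_eqF.
exists (C1 + C2); first exact: addr_ge0.
move=> u B V uB V0 uV.
have [|h1 [mh1 hC1 E1 P1]] := H1 u B V (bmonS (lexx a) (ltW cb) uB) V0.
  by move=> x y ax xy yc; apply: uV => //; exact: lt_trans cb.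
have [|h2 [mh2 hC2 E2 P2]] := H2 u B V (bmonS (ltW ac) (lexx b) uB) V0.
  by move=> x y ax xy yc; apply: uV => //; exact: lt_trans ax.
pose h t := if t < c then h1 t else h2 t.
have mh : measurable_fun setT (h : T -> R).
  apply: measurable_fun_if => //; first exact: measurable_fun_ltr.
    exact: measurable_funTS.
  exact: measurable_funTS.
have hC t : `|h t| <= (C1 + C2) * V.
  rewrite /h mulrDl; case: ifP => _.
    by apply: (le_trans (hC1 t)); rewrite lerDl mulr_ge0.
  by apply: (le_trans (hC2 t)); rewrite lerDr mulr_ge0.
have bh x y : bmon x y h ((C1 + C2) * V) by exact: bmonT.
have bh1 x y : bmon x y h1 (C1 * V) by exact: bmonT.
have bh2 x y : bmon x y h2 (C2 * V) by exact: bmonT.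
have D1 t : a <= t -> t <= c -> itg (fun t => u t - h t) a t = itg (fun t => u t - h1 t) a t.
  move=> at_ tc; have ut := bmonS (lexx a) (le_trans tc (ltW cb)) uB.
  apply: eq_itg.
  - by move=> x /andP[_ xt]; rewrite /h (lt_le_trans xt).
  - by have [] := bmonD ut (bmonN (bh a t)).
  - by have [] := bmonD ut (bmonN (bh1 a t)).
have D2 t : c <= t -> t <= b -> itg (fun t => u t - h t) c t = itg (fun t => u t - h2 t) c t.
  move=> ct tb; have ut := bmonS (ltW ac) tb uB.
  apply: eq_itg.
  - by move=> x /andP[cx _]; rewrite /h ltNge (ltW cx).
  - by have [] := bmonD ut (bmonN (bh c t)).
  - by have [] := bmonD ut (bmonN (bh2 c t)).
exists h; split => //.
  rewrite (itg_split (ltW ac) (ltW cb) (bmonD uB (bmonN (bh a b)))).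
  by rewrite D1 ?(ltW ac)// D2 ?(ltW cb)// E1 E2 addr0.
move=> t /andP[at_ tb]; have [tc|ct] := leP t c.
  by rewrite D1// P1// at_.
rewrite (itg_split (ltW ac) (ltW ct) (bmonD (bmonS (lexx a) tb uB) (bmonN (bh a t)))).
by rewrite D1 ?(ltW ac)// D2 ?(ltW ct)// E1 add0r P2// (ltW ct).
Qed.

End finite_partitions.

Section lasota_yorke.
Context {R : realType} {m : nat}.
Notation lam := (@lebesgue_measure R).
Notation T := (measurableTypeR R).
Variable f : pwexp R m.
Implicit Types (g : R -> R).

Definition all_cuts : set R := [set pw_cut f i | i in [set: 'I_m.+1]].

Lemma finite_all_cuts : finite_set all_cuts.
Proof. exact: finite_image. Qed.

Lemma left_cut i : all_cuts (pw_left f i).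
Proof. by exists (widen_ord (leqnSn m) i). Qed.

Lemma right_cut i : all_cuts (pw_right f i).
Proof. by exists (lift ord0 i). Qed.

Lemma noncut_open x : 0 <= x <= 1 -> ~ all_cuts x -> exists i, pw_open f i x.
Proof.
move=> x01 nx; have : `[0, 1]%classic x by rewrite /= in_itv.
rewrite -(pw_cover f) => -[i _ /pw_int_closed/andP[]].
rewrite le_eqVlt => /predU1P[xE|ax]; first by case: nx; rewrite -xE; exact: left_cut.
rewrite le_eqVlt => /predU1P[xE|xb]; first by case: nx; rewrite xE; exact: right_cut.
by exists i; rewrite /pw_open /= in_itv/= ax.
Qed.

Lemma iter_measurable n : measurable_fun setT (iter n f : T -> R).
Proof.
elim: n => [|n IH]; first exact: measurable_id.
apply: (@measurableT_comp _ _ _ _ _ _ (f : T -> R)) => //; exact: pw_measurable.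
Qed.

Lemma noncut_segment x y : 0 <= x -> x <= y -> y <= 1 ->
  (forall z, x <= z <= y -> ~ all_cuts z) -> exists i, pw_open f i x /\ pw_open f i y.
Proof.
move=> x0 xy y1 H; have x01 : 0 <= x <= 1 by rewrite x0 (le_trans xy).
have xx : x <= x <= y by rewrite lexx.
have [i Ox] := noncut_open x01 (H _ xx); exists i; split => //.
move: Ox; rewrite /pw_open /= !in_itv/= => /andP[ax xb].
rewrite (lt_le_trans ax)//= ltNge; apply/negP => yb.
by apply: (H (pw_right f i)); [rewrite (ltW xb) yb|exact: right_cut].
Qed.

(** Multiples of [d] are added to the cuts of [f]; a segment longer than [d] contains the first
    multiple beyond its left end. *)
Lemma fine_cuts (d : R) : 0 < d -> exists C : set R, [/\ finite_set C, all_cuts `<=` C &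
  forall x y : R, 0 <= x -> x <= y -> y <= 1 -> (forall z, x <= z <= y -> ~ C z) -> y - x <= d].
Proof.
move=> d0; pose n := (Num.truncn (d^-1)).+2.
exists (all_cuts `|` [set (nat_of_ord k)%:R * d | k in [set: 'I_n]]); split.
- by rewrite finite_setU; split; [exact: finite_all_cuts|exact: finite_image].
- by move=> x; left.
move=> x y x0 xy y1 H; rewrite leNgt; apply/negP => dxy.
pose k := (Num.truncn (x / d)).+1.
have xd0 : 0 <= x / d by rewrite divr_ge0// ltW.
have xk : x < k%:R * d by rewrite -ltr_pdivrMr// truncnS_gt.
have kx : k%:R * d <= x + d.
  rewrite -natr1 mulrDl mul1r lerD2r -ler_pdivlMr//.
  by have /andP[] := truncn_itv xd0.
have kn : (k < n)%N.
  rewrite !ltnS; apply: le_truncn; rewrite -[leRHS]mul1r ler_pM2r ?invr_gt0//.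
  exact: le_trans y1.
apply: (H (k%:R * d)).
  rewrite (ltW xk)/= (le_trans kx)//; lra.
by right; exists (Ordinal kn).
Qed.

(** On [[0, 1]] these are the points whose orbit meets [C] before time [n] ([hit_iter]); the
    recursive form gives finiteness by pulling back one step at a time. *)
Fixpoint hit (C : set R) (n : nat) : set R :=
  if n is n'.+1 then C `|` [set x | 0 <= x <= 1 /\ hit C n' (f x)] else set0.

Lemma finite_preimage_pw (S : set R) : finite_set S ->
  finite_set [set x | 0 <= x <= 1 /\ S (f x)].
Proof.
move=> fS.
apply: (@sub_finite_set _ _ (all_cuts `|` \bigcup_(i in [set: 'I_m]) (pw_open f i `&` f @^-1` S))).
  move=> x [x01 Sx]; have [cx|/noncut_open] := pselect (all_cuts x); first by left.
  by move=> /(_ x01)[i Ox]; right; exists i.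
rewrite finite_setU; split; first exact: finite_all_cuts.
apply: bigcup_finite => // i _.
(* [g] selects the preimage of a value in the i-th branch, which is unique by expansion. *)
pose g (s : R) := xget 0 [set x | pw_open f i x /\ f x = s].
apply: (@sub_finite_set _ _ (g @` S)); last exact: finite_image.
move=> x [Ox Sx]; exists (f x) => //; rewrite /g.
case: xgetP => [y _ [Oy fyx]|/(_ x)[]//]; apply/eqP; rewrite -subr_eq0 -normr_eq0.
have [s [M [L HC]]] := pw_consts f.
have /andP[+ _] := pw_lipP HC Oy Ox; rewrite fyx subrr normr0.
rewrite pmulr_rle0; last by have := pwc_gt1 HC; lra.
by rewrite normr_le0 -normr_eq0.
Qed.

Lemma finite_hit C n : finite_set C -> finite_set (hit C n).
Proof.
move=> fC; elim: n => //= n IH; rewrite finite_setU; split => //.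
exact: finite_preimage_pw.
Qed.

Lemma hit_iter C n x : 0 <= x <= 1 ->
  hit C n x <-> exists2 k, (k < n)%N & C (iter k f x).
Proof.
elim: n x => [|n IH] x x01 /=; first by split=> // -[].
split=> [[Cx|[_ /IH]]|[[|k] kn Ck]].
- by exists 0%N.
- by move=> /(_ (pw_fun01 f x01))[k kn Ck]; exists k.+1 => //; rewrite iterSr.
- by left.
- right; split => //; apply/IH; first exact: pw_fun01.
  by exists k => //; rewrite -iterSr.
Qed.

Lemma pw_image_segment i x y q : pw_open f i x -> pw_open f i y -> x <= y ->
  Num.min (f x) (f y) <= q <= Num.max (f x) (f y) -> exists2 z, x <= z <= y & f z = q.
Proof.
move=> Ox Oy xy H; have [z] := IVT xy (pw_open_continuous_itv Ox Oy) H.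
by rewrite in_itv/=; exists z.
Qed.

(** A segment that misses [hit C N.+1] lies in one branch and has length at most [d], and its image
    misses [hit C N]; so each iterate contributes one factor of [branch_contraction]. *)
Lemma iter_contraction s M L C d : pw_const f s M L -> all_cuts `<=` C -> 0 < d ->
  (forall x y : R, 0 <= x -> x <= y -> y <= 1 -> (forall z, x <= z <= y -> ~ C z) -> y - x <= d) ->
  forall N (x y : R), 0 <= x -> x <= y -> y <= 1 -> (forall z, x <= z <= y -> ~ hit C N z) ->
  forall g (B V : R), measurable_fun setT (g : T -> R) -> (forall t, `|g t| <= B) ->
  (forall p q : R, 0 <= p -> p <= q -> q <= 1 -> `|itg g p q| <= V) ->
  `|itg (g \o iter N f) x y| <= (s^-1 + 2 * (L / s ^+ 2) * d) ^+ N * V.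
Proof.
move=> HC cutC d0 Cd; have [s1 L0 _ _ _] := HC; have s0 : 0 < s by lra.
set th := _ + _; have th0 : 0 <= th.
  have i0 : 0 < s^-1 by rewrite invr_gt0.
  have l0 : 0 < L / s ^+ 2 by rewrite divr_gt0// exprn_gt0.
  by rewrite ltW// addr_gt0// mulr_gt0// mulr_gt0.
elim=> [|N IH] x y x0 xy y1 nh g B V mg gB gV; first by rewrite expr0 mul1r; exact: gV.
have V0 : 0 <= V by apply: le_trans (normr_ge0 _) (gV 0 0 _ _ _).
have nC z : x <= z <= y -> ~ C z by move=> /nh h Cz; apply: h; left.
have [i [Ox Oy]] := noncut_segment x0 xy y1 (fun z zxy cz => nC z zxy (cutC _ cz)).
have -> : itg (g \o iter N.+1 f) x y = itg ((g \o iter N f) \o f) x y.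
  by congr itg; apply/funext => t /=; rewrite -iterSr.
have mgN : measurable_fun setT (g \o iter N f : T -> R).
  by apply: (@measurableT_comp _ _ _ _ _ _ (g : T -> R)) => //; exact: iter_measurable.
have H := @branch_contraction _ _ f s M L i x y (g \o iter N f) B (th ^+ N * V)
  HC xy Ox Oy mgN (fun t => gB _).
apply: (le_trans (H _)) => [p q hp pq hq|].
  have p0 : 0 <= p.
    have x01 : 0 <= x <= 1 by rewrite x0 (le_trans xy).
    have y01 : 0 <= y <= 1 by rewrite y1 (le_trans x0).
    have /andP[h1 _] := pw_fun01 f x01; have /andP[h2 _] := pw_fun01 f y01.
    by apply: le_trans hp; rewrite le_min h1.
  have q1 : q <= 1.
    have x01 : 0 <= x <= 1 by rewrite x0 (le_trans xy).
    have y01 : 0 <= y <= 1 by rewrite y1 (le_trans x0).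
    have /andP[_ h1] := pw_fun01 f x01; have /andP[_ h2] := pw_fun01 f y01.
    by apply: (le_trans hq); rewrite ge_max h1.
  apply: (IH p q p0 pq q1 _ g B V) => // z /andP[pz zq] hz.
  have [|w wxy fwz] := @pw_image_segment i x y z Ox Oy xy.
    by rewrite (le_trans hp)//= (le_trans zq).
  apply: (nh w wxy); right; rewrite /= fwz; split => //.
  have /andP[h1 h2] := wxy.
  by rewrite (le_trans x0)//= (le_trans h2).
rewrite (exprSr th) [leRHS]mulrAC ler_wpM2l ?mulr_ge0 ?exprn_ge0//.
have l0 : 0 < L / s ^+ 2 by rewrite divr_gt0// exprn_gt0.
have l2 : 0 <= 2 * (L / s ^+ 2) by apply: mulr_ge0 => //; exact: ltW.
rewrite /th lerD2l ler_wpM2l//.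
by apply: Cd => // z /nC.
Qed.

(* The Lasota-Yorke inequality in dual form: the sup norm of the primitive of [g] is the norm
   dual to the variation, and composing [g] with an iterate of [f] halves it up to the bounded
   error [h]. *)
Lemma lasota_yorke_step (K : nat) : (0 < K)%N -> exists N : nat, exists2 C : R,
  (K %| N)%N /\ (0 < N)%N & 0 <= C /\ forall g (B V : R), measurable_fun setT (g : T -> R) -> (forall t, `|g t| <= B) -> 0 <= V ->
  (forall b : R, 0 <= b <= 1 -> `|itg g 0 b| <= V) ->
  exists h : R -> R, [/\ measurable_fun setT (h : T -> R), forall t, `|h t| <= C * V &
    forall b : R, 0 <= b <= 1 -> `|itg (fun t => g (iter N f t) - h t) 0 b| <= V / 2].
Proof.
move=> K0; have [s [M [L HC]]] := pw_consts f.
have [s1 L0 _ _ _] := HC; have s0 : 0 < s by lra.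
have i0 : 0 < s^-1 by rewrite invr_gt0.
have i1 : s^-1 < 1 by rewrite invf_lt1.
have l0 : 0 < L / s ^+ 2 by rewrite divr_gt0// exprn_gt0.
(* Makes the contraction factor [th] equal to [(1 + s^-1) / 2], the midpoint of [s^-1] and 1. *)
pose d := (1 - s^-1) / (4 * (L / s ^+ 2)).
have d0 : 0 < d by rewrite divr_gt0 ?subr_gt0// mulr_gt0.
have [C [fC cutC Cd]] := fine_cuts d0.
have IC := iter_contraction HC cutC d0 Cd.
pose th := s^-1 + 2 * (L / s ^+ 2) * d.
have thE : th = (1 + s^-1) / 2 by rewrite /th /d; field; rewrite !gt_eqF.
have th0 : 0 <= th by rewrite thE; lra.
have th1 : th < 1 by rewrite thE; lra.
(* The factor 1/8 pays for two doublings, from the primitive to integrals over arbitrary segments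
   and in [step_average]; what remains is 1/2. *)
have [n0 Hn0] : exists n0, th ^+ n0 <= 8^-1.
  have th1' : `|th| < 1 by rewrite ger0_norm.
  have /(@cvgrPdist_le R R)/(_ 8^-1) := @cvg_expr R th th1'.
  have e0 : (0 : R) < 8^-1 by lra.
  move=> /(_ e0)[n _ Hn]; exists n; have := Hn n (leqnn n).
  by rewrite sub0r normrN ger0_norm// exprn_ge0.
(* A multiple of [K], since the measures to come are only assumed invariant under the [K]-th
   iterate. *)
pose N := (K * n0.+1)%N.
have NV : th ^+ N <= 8^-1.
  apply: le_trans Hn0; apply: ler_wiXn2l => //; first exact: ltW.
  by rewrite /N (leq_trans (leqnSn n0))// leq_pmull.
have /finite_seqP[S SE] := finite_hit N fC.
have [c c0 Hc] := @step_average R S 0 1 ltr01.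
exists N, c; first by rewrite /N dvdn_mulr// muln_gt0 K0.
split=> // g B V mg gB V0 gV.
have gV2 p q : 0 <= p -> p <= q -> q <= 1 -> `|itg g p q| <= 2 * V.
  move=> p0 pq q1; have b := @bmonT R 0 q g B mg gB.
  have := itg_split p0 pq b => /eqP; rewrite addrC -subr_eq => /eqP <-.
  apply: (le_trans (ler_normB _ _)).
  have h1 : `|itg g 0 q| <= V by apply: gV; rewrite q1 (le_trans p0).
  have h2 : `|itg g 0 p| <= V by apply: gV; rewrite p0 (le_trans pq).
  lra.
have V4 : 0 <= V / 4 by rewrite divr_ge0.
have bgN : bmon 0 1 (g \o iter N f) B.
  apply: bmonT; last by move=> t; exact: gB.
  by apply: (@measurableT_comp _ _ _ _ _ _ (g : T -> R)) => //; exact: iter_measurable.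
have [|h [mh hC _ P]] := Hc (g \o iter N f) B (V / 4) bgN V4.
  move=> x y x0 xy y1 nS; apply: (le_trans (IC N x y (ltW x0) xy (ltW y1) _ g B (2 * V) mg gB gV2)).
    move=> z zxy hz; have zS : z \in S by move: hz; rewrite SE.
    by move: (nS z zS); rewrite zxy.
  rewrite -/th; apply: (@le_trans _ _ (8^-1 * (2 * V))); last by lra.
  by rewrite ler_wpM2r// mulr_ge0.
exists h; split => //.
  move=> t; apply: (le_trans (hC t)); rewrite ler_wpM2l//; lra.
move=> b /P /le_trans; apply; lra.
Qed.

End lasota_yorke.

(** * Small primitives and integrals against a density *)

Section continuous_induction.
Context {R : realType}.

(** Take the supremum of the [t] with [Q 0 t]: locality at that point, combined with additivity,
    carries the property beyond it unless it is 1. *)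
Lemma local_induction (Q : R -> R -> Prop) :
  (forall c, 0 <= c <= 1 -> exists2 d, 0 < d &
     forall a b, 0 <= a -> a < b -> b <= 1 -> c - d < a -> b < c + d -> Q a b) ->
  (forall a c b, 0 <= a -> a < c -> c < b -> b <= 1 -> Q a c -> Q c b -> Q a b) ->
  Q 0 1.
Proof.
move=> loc comb; pose S := [set t | 0 < t <= 1 /\ Q 0 t].
have S1 : ubound S 1 by move=> t [/andP[]].
have [d0 d00 H0] : exists2 d, 0 < d & forall a b, 0 <= a -> a < b -> b <= 1 -> 0 - d < a -> b < 0 + d -> Q a b.
  by apply: loc; rewrite lexx ler01.
have [t0 t0S] : S !=set0.
  exists (Num.min (d0 / 2) 1); split.
    by rewrite lt_min ltr01 divr_gt0//= ge_min lexx orbT.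
  apply: H0 => //.
  - by rewrite lt_min ltr01 divr_gt0.
  - by rewrite ge_min lexx orbT.
  - by rewrite sub0r oppr_lt0.
  - by rewrite add0r gt_min; apply/orP; left; lra.
have sS : has_sup S by split; [exists t0|exists 1].
pose s := sup S.
have s01 : 0 < s <= 1.
  have [/andP[h1 h2] _] := t0S; rewrite (lt_le_trans h1)/=; last by apply: ub_le_sup; [exact: sS.2|].
  exact: ge_sup sS.1 S1.
have /andP[s0 s1] := s01.
have [d dd H] : exists2 d, 0 < d & forall a b, 0 <= a -> a < b -> b <= 1 -> s - d < a -> b < s + d -> Q a b.
  by apply: loc; rewrite s1 ltW.
have [t [/andP[t_0 t_1] Qt] ts] : exists2 t, S t & s - d < t.
  by apply: sup_gt sS.1 _; rewrite gtrBl.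
have tsle : t <= s by apply: ub_le_sup; [exact: sS.2|split => //; rewrite t_0].
pose e := Num.min 1 (s + d / 2).
have te : t <= e by rewrite le_min t_1 (le_trans tsle)// lerDl ltW// divr_gt0.
have Se : Q 0 e.
  move: te; rewrite le_eqVlt => /predU1P[<-//|te].
  apply: (comb _ t) => //; first by rewrite ge_min lexx.
  apply: H => //; [exact: ltW|by rewrite ge_min lexx|].
  by rewrite gt_min; apply/orP; right; lra.
have [e1|e1] := eqVneq e 1; first by rewrite e1 in Se.
have e_lt : e < 1 by rewrite lt_neqAle e1 ge_min lexx.
have eE : e = s + d / 2.
  by move: e_lt; rewrite /e; case: (leP 1 (s + d / 2)) => //; rewrite ltxx.
have : e <= s.
  by apply: ub_le_sup; [exact: sS.2|split => //; rewrite (lt_le_trans t_0 te) ltW].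
by rewrite eE; move=> h; lra.
Qed.

End continuous_induction.

Section weak_convergence.
Context {R : realType}.
Notation lam := (@lebesgue_measure R).
Notation T := (measurableTypeR R).
Implicit Types (u k h : R -> R).

(** On a short segment [k] is nearly constant, so the integral is [k c] times a small integral of
    [u], up to [B] times the oscillation of [k]; [local_induction] chains the short segments and
    yields one [d] for all [u]. *)
Lemma small_primitive_continuous k B e : continuous k -> 0 <= B -> 0 < e ->
  exists2 d, 0 < d & forall u, bmon 0 1 u B ->
    (forall x y : R, 0 <= x -> x <= y -> y <= 1 -> `|itg u x y| <= d) ->
    `|itg (fun t => u t * k t) 0 1| <= e.
Proof.
move=> ck B0 e0.
have kM a b : bmon a b k (sup [set `|k t| | t in `[a, b]%classic]).
  split.
    by apply: subspace_continuous_measurable_fun => //; apply: continuous_subspaceT.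
  move=> t tab; apply: ub_le_sup; last by exists t => //; rewrite /= in_itv.
  have /compact_bounded[M [_ HM]] : compact (k @` `[a, b]).
    by apply: continuous_compact; [exact: continuous_subspaceT|exact: segment_compact].
  exists (`|M| + 1) => _ [z zab <-]; apply: (HM (`|M| + 1)); last by exists z.
  by rewrite (le_lt_trans (ler_norm M))// ltrDl.
suff : exists2 d, 0 < d & forall u, bmon 0 1 u B ->
    (forall x y : R, 0 <= x -> x <= y -> y <= 1 -> `|itg u x y| <= d) ->
    `|itg (fun t => u t * k t) 0 1| <= e * (1 - 0) by rewrite subr0 mulr1.
apply: (local_induction (Q := fun a b => exists2 d, 0 < d & forall u, bmon 0 1 u B ->
    (forall x y : R, 0 <= x -> x <= y -> y <= 1 -> `|itg u x y| <= d) ->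
    `|itg (fun t => u t * k t) a b| <= e * (b - a))).
  move=> c c01.
  have eB : 0 < e / 2 / (B + 1) by rewrite !divr_gt0// ltr_wpDl.
  have /(@cvgrPdist_lt R R)/(_ _ eB)/nbhs_ballP[d /= d0 Hd] := ck c.
  exists d => // a b a0 ab b1 ca bc.
  have kc : 0 < `|k c| + 1 by rewrite ltr_wpDl.
  exists (e / 2 * (b - a) / (`|k c| + 1)).
    by rewrite divr_gt0// mulr_gt0 ?divr_gt0 ?subr_gt0.
  move=> u uB ud; have uab := bmonS a0 b1 uB.
  have kab := kM a b; have cab := @bmon_cst R a b (k c).
  have osc : bmon a b (fun t => u t * (k t - k c)) (B * (e / 2 / (B + 1))).
    split; first by have [] := bmonM uab (bmonD kab (bmonN cab)).
    move=> t tab; rewrite normrM ler_pM//; first exact: uab.2.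
    have /andP[at_ tb] := tab; rewrite distrC; apply/ltW/Hd; rewrite /ball /= ltr_norml.
    by apply/andP; split; lra.
  have -> : itg (fun t => u t * k t) a b =
      k c * itg u a b + itg (fun t => u t * (k t - k c)) a b.
    rewrite -(itgM _ uab) -(itgD (bmonM cab uab) osc).
    by congr itg; apply/funext => t; ring.
  apply: (le_trans (ler_normD _ _)).
  have -> : e * (b - a) = e / 2 * (b - a) + e / 2 * (b - a) by field.
  apply: lerD.
    rewrite normrM; have := ud a b a0 (ltW ab) b1.
    rewrite ler_pdivlMr// => h; apply: le_trans h; rewrite mulrC ler_wpM2l// lerDl//.
  apply: (le_trans (itg_bound (ltW ab) osc)).
  rewrite ler_wpM2r ?subr_ge0 ?(ltW ab)// mulrA ler_pdivrMr ?ltr_wpDl// mulrC.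
  by rewrite ler_wpM2l ?lerDl// ltW// divr_gt0.
move=> a c b a0 ac cb b1 [d1 d10 H1] [d2 d20 H2].
exists (Num.min d1 d2); first by rewrite lt_min d10.
move=> u uB ud.
have uk := bmonM (bmonS a0 b1 uB) (kM a b).
rewrite (itg_split (ltW ac) (ltW cb) uk).
apply: (le_trans (ler_normD _ _)).
have -> : e * (b - a) = e * (c - a) + e * (b - c) by ring.
apply: lerD; [apply: H1|apply: H2] => // x y x0 xy y1.
  by apply: (le_trans (ud x y x0 xy y1)); rewrite ge_min lexx.
by apply: (le_trans (ud x y x0 xy y1)); rewrite ge_min lexx orbT.
Qed.

Lemma bounded_Rintegrable (mu : {finite_measure set T -> \bar R}) (u : R -> R) B :
  measurable_fun setT (u : T -> R) -> (forall t, `|u t| <= B) ->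
  mu.-integrable setT (EFin \o (u : T -> R)).
Proof.
move=> mf uB.
have lmu : (mu setT < +oo)%E by rewrite -ge0_fin_numE// fin_num_measure.
apply: (@measurable_bounded_integrable _ T R mu) => //.
exists B; split; first exact: num_real.
by move=> M BM t _ /=; exact: le_trans (uB t) (ltW BM).
Qed.

Lemma bounded_Rintegral (mu : {finite_measure set T -> \bar R}) (u : R -> R) B :
  measurable_fun setT (u : T -> R) -> (forall t, `|u t| <= B) ->
  `|\int[mu]_t (u : T -> R) t| <= B * fine (mu setT).
Proof.
move=> mf uB; have I := bounded_Rintegrable mu mf uB.
apply: (le_trans (le_normr_Rintegral measurableT I)).
have IB := bounded_Rintegrable mu (measurable_cst B) (fun=> lexx `|B|).
rewrite -Rintegral_cst//; apply: le_Rintegral => //.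
apply: (@bounded_Rintegrable mu (fun t => `|u t|) B); first exact: measurableT_comp.
by move=> t; rewrite normr_id.
Qed.

(** The Radon-Nikodym density is made real valued and cut off to [[0, 1]], where all the mass lies.
    For a bounded [u] of either sign the integral formula follows from the nonnegative case applied
    to [u + B]. *)
Lemma finite_density (mu : {finite_measure set T -> \bar R}) :
  mu `<< lam -> mu (~` `[0, 1]%classic) = 0%E ->
  exists h : R -> R, [/\ forall t, 0 <= h t, lam.-integrable setT (EFin \o (h : T -> R)),
    forall t, ~ (0 <= t <= 1) -> h t = 0,
    forall A : set T, measurable A -> mu A = (\int[lam]_(t in A) (h t)%:E)%E &
    forall (u : R -> R) B, measurable_fun setT (u : T -> R) -> (forall t, `|u t| <= B) ->
      \int[mu]_t (u : T -> R) t = \int[lam]_(t in `[0, 1]) (u t * h t)].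
Proof.
move=> mul mu01.
have [F [F0 Ff IF FE]] := radon_nikodym_sigma_finite mul.
pose h0 t : R := fine (F t).
have h0E : EFin \o h0 = F by apply/funext => t /=; rewrite fineK.
pose h := h0 \_ (`[0, 1]%classic : set T).
have h_ge0 t : 0 <= h t by rewrite /h patchE; case: ifP => // _; rewrite fine_ge0.
have ih : lam.-integrable setT (EFin \o (h : T -> R)).
  rewrite -restrict_EFin; apply/integrable_restrict => //.
  by rewrite setTI h0E; exact: integrableS IF.
have hout t : ~ (0 <= t <= 1) -> h t = 0.
  by move=> t01; rewrite /h patchE; case: ifP => //; rewrite inE/= in_itv.
have m01 : measurable (`[0, 1]%classic : set T) by exact: measurable_itv.
have hE A : measurable (A : set T) -> mu A = (\int[lam]_(t in A) (h t)%:E)%E.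
  move=> mA; rewrite -[in LHS](setIT A) -(setUv `[0, 1]%classic) setIUr measureU; last first.
  - by rewrite setIACA setICr setI0.
  - by apply: measurableI => //; exact: measurableC.
  - exact: measurableI.
  rewrite [X in (_ + X)%E](_ : _ = 0%E) ?adde0.
    apply: (etrans (FE _ (measurableI _ _ mA m01))); rewrite integral_mkcondr; apply: eq_integral => t _.
    by rewrite /h !patchE -h0E; case: ifP.
  apply/eqP; rewrite -measure_le0 -mu01; apply: le_measure; rewrite ?inE//.
    by apply: measurableI => //; exact: measurableC.
  exact: measurableC.
exists h; split => //.
pose nu : {measure set T -> \bar R} := dens h_ge0 ih.
have muE (u : T -> R) : \int[mu]_t u t = \int[nu]_t u t.
  rewrite /Rintegral; congr fine; apply: eq_measure_integral => A mA _; exact: hE.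
have ge0 (u : R -> R) : measurable_fun setT (u : T -> R) -> (forall t, 0 <= u t) ->
    \int[mu]_t (u : T -> R) t = \int[lam]_(t in `[0, 1]) (u t * h t).
  move=> mf u0; rewrite muE /Rintegral; congr fine.
  rewrite ge0_integral_dens//; last exact/measurable_EFinP.
  rewrite [RHS]integral_mkcond; apply: eq_integral => t _; rewrite patchE.
  case: ifPn => [_|]; first by rewrite EFinM.
  by rewrite notin_setE/= in_itv/= => /hout ->; rewrite mule0.
move=> u B mf uB.
have B0 : 0 <= B by apply: le_trans (normr_ge0 _) (uB 0).
have gB0 t : 0 <= u t + B by rewrite -lerBlDr sub0r; have := uB t; rewrite ler_norml => /andP[].
have mB : measurable_fun setT ((fun t => u t + B) : T -> R) by exact: measurable_funD.
have := ge0 _ mB gB0; have := ge0 (fun=> B) (measurable_cst _) (fun=> B0) => H1 H2.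
have ihh : lam.-integrable `[0, 1] (EFin \o (h : T -> R)) by exact: (integrableS _ _ _ ih).
have iM (v : R -> R) C : measurable_fun setT (v : T -> R) -> (forall t, `|v t| <= C) ->
    lam.-integrable `[0, 1] (EFin \o ((fun t => v t * h t) : T -> R)).
  move=> mv vC; apply: (@le_integrable _ T R lam _ _ _ (fun t => (C * h t)%:E)) => //.
  - apply/measurable_EFinP; apply: measurable_funM; first exact: measurable_funTS.
    by apply/measurable_EFinP; exact: measurable_int ihh.
  - move=> t _ /=; rewrite lee_fin !normrM ler_wpM2r//.
    by apply: (le_trans (vC t)); exact: ler_norm.
  - by apply: eq_integrable (integrableZl _ C ihh) => // t _; rewrite /= EFinM.
have I1 := bounded_Rintegrable mu mf uB.
have I2 := bounded_Rintegrable mu (measurable_cst B) (fun=> lexx `|B|).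
rewrite RintegralD// H1 in H2.
apply: (@addIr _ (\int[lam]_(t in `[0, 1]) (B * h t))); rewrite H2.
rewrite -RintegralD//; last 2 first.
- exact: iM mf uB.
- exact: iM (measurable_cst _) (fun=> lexx `|B|).
by apply: eq_Rintegral => t _; rewrite mulrDl.
Qed.

End weak_convergence.

Section weak_null.
Context {R : realType}.
Notation lam := (@lebesgue_measure R).
Notation T := (measurableTypeR R).

(** [h] is approximated in mean on [[0, 1]] by a continuous function, handled by
    [small_primitive_continuous]; the bound on [u] controls the remainder. *)
Lemma small_primitive_density (h : R -> R) (B e : R) :
  lam.-integrable setT (EFin \o (h : T -> R)) -> 0 <= B -> 0 < e ->
  exists2 d, 0 < d & forall u : R -> R, measurable_fun setT (u : T -> R) ->
    (forall t, `|u t| <= B) ->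
    (forall x y : R, 0 <= x -> x <= y -> y <= 1 -> `|itg u x y| <= d) ->
    `|\int[lam]_(t in `[0, 1]) (u t * h t)| <= e.
Proof.
move=> ih B0 e0.
have i01 : lam.-integrable `[0, 1] (EFin \o (h : T -> R)) by exact: (integrableS _ _ _ ih).
have l01 : (lam `[0%R, 1%R]%classic < +oo)%E by rewrite lebesgue_measure_itv/= lte_fin ltr01 -EFinB ltry.
have [k_ [ck ik]] := @approximation_continuous_integrable R `[0, 1]%classic h (measurable_itv _) l01 i01.
have e1 : 0 < e / 2 / (B + 1) by rewrite !divr_gt0// ltr_wpDl.
have idiff n : lam.-integrable `[0, 1] (EFin \o ((fun t => h t - k_ n t) : T -> R)).
  by rewrite (_ : _ \o _ = (EFin \o h) \- (EFin \o k_ n))%E//; exact: integrableB.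
move=> /fine_cvgP[_ /(@cvgrPdist_lt R R)/(_ _ e1)[n _ /(_ n (leqnn n))]] /=.
rewrite sub0r normrN.
have -> : fine (\int[lam]_(z in `[0%R, 1%R]) (`|h z - k_ n z|)%:E)%E = itg (fun t => `|h t - k_ n t|) 0 1 by [].
set k := k_ n => Hk; have {}Hk : itg (fun t => `|h t - k t|) 0 1 < e / 2 / (B + 1).
  by apply: le_lt_trans Hk; exact: ler_norm.
have e2 : 0 < e / 2 by rewrite divr_gt0.
have [d d0 Hd] := small_primitive_continuous (ck n) B0 e2.
exists d => // u mu uB ud.
have bu : bmon 0 1 u B by exact: bmonT.
have iM (v : R -> R) : lam.-integrable `[0, 1] (EFin \o (v : T -> R)) ->
    lam.-integrable `[0, 1] (EFin \o ((fun t => u t * v t) : T -> R)).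
  move=> iv; apply: (@le_integrable _ T R lam _ _ _ (fun t => (B * v t)%:E)) => //.
  - apply/measurable_EFinP; apply: measurable_funM; first exact: measurable_funTS.
    by apply/measurable_EFinP; exact: measurable_int iv.
  - by move=> t _ /=; rewrite lee_fin !normrM ler_pM// (le_trans (uB t))// ler_norm.
  - by apply: eq_integrable (integrableZl _ B iv) => // t _; rewrite /= EFinM.
have -> : \int[lam]_(t in `[0, 1]) (u t * h t) =
    itg (fun t => u t * k t) 0 1 + \int[lam]_(t in `[0, 1]) (u t * (h t - k t)).
  rewrite /itg -RintegralD//; [|exact: iM (ik n)|exact: iM (idiff n)].
  by apply: eq_Rintegral => t _; ring.
apply: (le_trans (ler_normD _ _)).
have -> : e = e / 2 + e / 2 by field.
apply: lerD; first exact: Hd.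
apply: (le_trans (le_normr_Rintegral _ (iM _ (idiff n)))) => //.
have inorm : lam.-integrable `[0, 1] (EFin \o ((fun t => `|h t - k t|) : T -> R)).
  by apply: eq_integrable (integrable_norm (idiff n)).
apply: (@le_trans _ _ (\int[lam]_(t in `[0, 1]) (B * `|h t - k t|))).
  apply: le_Rintegral => //.
  - by apply: eq_integrable (integrable_norm (iM _ (idiff n))).
  - by apply: eq_integrable (integrableZl _ B inorm) => // t _; rewrite /= EFinM.
  - by move=> t _; rewrite normrM ler_wpM2r.
rewrite RintegralZl//.
apply: (@le_trans _ _ (B * (e / 2 / (B + 1)))); first by rewrite ler_wpM2l// ltW.
by rewrite mulrA ler_pdivrMr ?ltr_wpDl// mulrC ler_wpM2l ?lerDl// ltW.
Qed.

End weak_null.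

Section bounded_variation.
Context {R : realType} {m : nat}.
Notation lam := (@lebesgue_measure R).
Notation T := (measurableTypeR R).
Variables (f : pwexp R m) (mu : {finite_measure set T -> \bar R}) (K : nat).
Hypotheses (K0 : (0 < K)%N) (mul : mu `<< lam) (mu01 : mu (~` `[0, 1]%classic) = 0%E)
  (muK : forall A : set T, measurable A -> mu (iter K f @^-1` A) = mu A).

Lemma mT_iterK (n : nat) : measurable_fun setT (iter n f : T -> T).
Proof. exact: iter_measurable. Qed.

Lemma iter_invariant N : (K %| N)%N -> forall A : set T, measurable A ->
  mu (iter N f @^-1` A) = mu A.
Proof.
move=> /dvdnP[q ->]; elim: q => [|q IH] A mA; first by rewrite mul0n.
rewrite mulSn -[RHS]IH// -[RHS]muK.
  by congr (mu _); apply/seteqP; split=> x /=; rewrite addnC iterD.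
by rewrite -[X in measurable X]setTI; exact: mT_iterK.
Qed.

Lemma Rintegral_invariant N (g : R -> R) B : (K %| N)%N ->
  measurable_fun setT (g : T -> R) -> (forall t, `|g t| <= B) ->
  \int[mu]_t (g : T -> R) t = \int[mu]_t ((g \o iter N f) : T -> R) t.
Proof.
move=> KN mg gB; rewrite /Rintegral; congr fine.
pose nu : {measure set T -> \bar R} :=
  measure_function_pushforward__canonical__measure_function_Measure mu (mT_iterK N).
transitivity (\int[nu]_t (g t)%:E)%E.
  by apply: eq_measure_integral => A mA _; exact: (esym (iter_invariant KN mA)).
rewrite /nu integral_pushforward//=; first exact: mT_iterK.
- exact/measurable_EFinP.
- apply: (@bounded_Rintegrable _ mu (g \o iter N f) B); last by move=> t; exact: gB.
  apply: (@measurableT_comp _ _ _ _ _ _ (g : T -> R)) => //; exact: iter_measurable.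
Qed.

(* This says that the density of [mu] has bounded variation. *)
Lemma dual_bounded_variation : exists2 C, 0 <= C &
  forall (g : R -> R) (B V : R), measurable_fun setT (g : T -> R) ->
    (forall t, `|g t| <= B) -> 0 <= V ->
    (forall b : R, 0 <= b <= 1 -> `|itg g 0 b| <= V) ->
    `|\int[mu]_t (g : T -> R) t| <= C * V.
Proof.
have [N [C [KN N0] [C0 HN]]] := lasota_yorke_step f K0.
pose M := fine (mu setT); have M0 : 0 <= M by rewrite fine_ge0.
exists (2 * C * M); first by rewrite !mulr_ge0.
move=> g B V mg gB V0 gV.
have B0 : 0 <= B by apply: le_trans (normr_ge0 _) (gB 0).
(* [u] arises from [g] by [n] replacements of a function by its composition with the [N]-th iterate
   minus a correction. Invariance makes the composition harmless to the integral, the k-th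
   correction is at most [C * V * 2^-1 ^+ k], and [2 - 2 * 2^-1 ^+ n] sums the first [n] powers. *)
have iter n : exists u : R -> R, [/\ measurable_fun setT (u : T -> R),
    forall t, `|u t| <= B + C * V * (2 - 2 * 2^-1 ^+ n),
    forall b : R, 0 <= b <= 1 -> `|itg u 0 b| <= V * 2^-1 ^+ n &
    `|\int[mu]_t (g : T -> R) t - \int[mu]_t (u : T -> R) t| <=
      C * V * (2 - 2 * 2^-1 ^+ n) * M].
  elim: n => [|n [u [mu_ uB uV uI]]].
    exists g; split => //.
    - by move=> t; rewrite expr0 mulr1 subrr mulr0 addr0.
    - by move=> b /gV; rewrite expr0 mulr1.
    - by rewrite subrr normr0 expr0 mulr1 subrr mulr0 mul0r.
  have Vn : 0 <= V * 2^-1 ^+ n by rewrite mulr_ge0.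
  have [h [mh hB hV]] := HN u _ _ mu_ uB Vn uV.
  have mF : measurable_fun setT ((u \o iter N f) : T -> R).
    by apply: (@measurableT_comp _ _ _ _ _ _ (u : T -> R)) => //; exact: iter_measurable.
  have E : B + C * V * (2 - 2 * 2^-1 ^+ n) + C * (V * 2^-1 ^+ n) = B + C * V * (2 - 2 * 2^-1 ^+ n.+1).
    by rewrite exprS; field.
  exists (fun t => u (iter N f t) - h t); split.
  - exact: measurable_funB.
  - by move=> t; rewrite -E; apply: (le_trans (ler_normB _ _)); rewrite lerD.
  - move=> b b01; apply: (le_trans (hV b b01)); rewrite exprS; lra.
  have Iu := bounded_Rintegrable mu mF (fun t => uB (iter N f t)).
  have Ih := bounded_Rintegrable mu mh hB.
  rewrite RintegralB// -(Rintegral_invariant KN mu_ uB).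
  have bh := bounded_Rintegral mu mh hB; rewrite -/M in bh.
  rewrite opprB addrA addrAC.
  apply: (le_trans (ler_normD _ _)).
  apply: (le_trans (lerD uI bh)).
  by rewrite exprS le_eqVlt; apply/orP; left; apply/eqP; field.
(* The functions [u] stay uniformly bounded while their primitives tend to 0, so their integrals
   against the density tend to 0 and only the corrections count. *)
have [h [_ ih _ _ hE]] := finite_density mul mu01.
apply/ler_addgt0Pr => e e0.
have BB0 : 0 <= B + C * V * 2 by rewrite addr_ge0// !mulr_ge0.
have [d d0 Hd] := small_primitive_density ih BB0 e0.
have [n Hn] : exists n, V * 2^-1 ^+ n <= d / 2.
  have h1 : `|2^-1 : R| < 1 by rewrite ger0_norm//; lra.
  have d1 : 0 < d / 2 / (V + 1) by rewrite !divr_gt0// ltr_wpDl.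
  have /(@cvgrPdist_le R R)/(_ _ d1) := @cvg_expr R 2^-1 h1.
  move=> [n _ Hn]; exists n; have := Hn n (leqnn n).
  rewrite sub0r normrN ger0_norm// ler_pdivlMr ?ltr_wpDl// => h2; apply: le_trans h2.
  by rewrite mulrC ler_wpM2l// lerDl.
have [u [mu_ uB uV uI]] := iter n.
have p0 : 0 <= 2^-1 ^+ n :> R by rewrite exprn_ge0.
have uBB t : `|u t| <= B + C * V * 2.
  apply: (le_trans (uB t)); rewrite lerD2l ler_wpM2l ?mulr_ge0//; lra.
have Hu : `|\int[mu]_t (u : T -> R) t| <= e.
  rewrite (hE u _ mu_ uB); apply: Hd => // x y x0 xy y1.
  have b := bmonT 0 y mu_ uB.
  have := itg_split x0 xy b => /eqP; rewrite addrC -subr_eq => /eqP <-.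
  apply: (le_trans (ler_normB _ _)).
  have h1 : `|itg u 0 y| <= V * 2^-1 ^+ n by apply: uV; rewrite y1 (le_trans x0).
  have h2 : `|itg u 0 x| <= V * 2^-1 ^+ n by apply: uV; rewrite x0 (le_trans xy).
  lra.
rewrite -[X in `|X|](subrK (\int[mu]_t (u : T -> R) t)).
apply: (le_trans (ler_normD _ _)); apply: lerD => //.
apply: (le_trans uI).
have -> : 2 * C * M * V = C * V * 2 * M by ring.
rewrite ler_wpM2r// ler_wpM2l ?mulr_ge0//; lra.
Qed.

End bounded_variation.

(** * The open core of an invariant measure *)

Section lebesgue_points.
Context {R : realType}.
Notation lam := (@lebesgue_measure R).
Notation T := (measurableTypeR R).
Variables (mu : {finite_measure set T -> \bar R}) (h : R -> R).
Hypotheses (h0 : forall t, 0 <= h t) (ih : lam.-integrable setT (EFin \o (h : T -> R)))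
  (muE : forall A : set T, measurable A -> mu A = (\int[lam]_(t in A) (h t)%:E)%E).

Let mh : measurable_fun setT (h : T -> R).
Proof. by apply/measurable_EFinP; exact: (measurable_int _ ih). Qed.

Lemma ae_lebesgue_pt : {ae lam, forall x, lebesgue_pt h x}.
Proof. by apply: lebesgue_differentiation; apply: open_integrable_locally ih; exact: openT. Qed.

(** For small [r], the mean of the deviation of [h] from [h x] over the ball is below [e], and the
    ball has length [2 * r]; a subset of the ball sees no more deviation than the whole ball. *)
Lemma lebesgue_pt_estimate x e : lebesgue_pt h x -> 0 < e -> exists2 r0, 0 < r0 &
  forall r (A : set T), 0 < r -> r < r0 -> measurable A -> A `<=` ball x r ->
  h x * fine (lam A) - 2 * r * e <= fine (mu A) <= h x * fine (lam A) + 2 * r * e.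
Proof.
move=> hx e0; have /fine_cvgP[F0 /(@cvgrPdist_lt R R)/(_ _ e0) C0] := hx.
have [d /= d0 Hd] : \forall r \near (0:R)^'+, davg h x r \is a fin_num /\ fine (davg h x r) < e.
  apply: filterS (filterI F0 C0) => r [/= H1]; rewrite sub0r normrN => H2; split => //.
  by apply: le_lt_trans H2; exact: ler_norm.
exists d => // r A r0 rd mA Ar.
have [fd ed] : davg h x r \is a fin_num /\ fine (davg h x r) < e.
  by apply: Hd => //; rewrite /ball /= sub0r normrN gtr0_norm.
have mB : measurable (ball x r : set T) by exact: measurable_ball.
have md : measurable_fun setT ((fun t => `|h t - h x|) : T -> R).
  by apply: measurableT_comp => //; exact: measurable_funB.
have dB : (\int[lam]_(y in ball x r) (`|h y - h x|)%:E <= (2 * r * e)%:E)%E.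
  have lB : lam (ball x r) = (2 * r)%:E by rewrite lebesgue_measure_ball ?ltW// mulr_natl.
  have r2 : 0 < 2 * r by rewrite mulr_gt0.
  have := ed; rewrite -lte_fin fineK// /davg /iavg /= lB inver gt_eqF// => H.
  have /ltW : (((2 * r)^-1)%:E * \int[lam]_(y in ball x r) (`|h y - h x|)%:E < e%:E)%E by exact: H.
  by rewrite lee_pdivrMl// EFinM.
have dA : (\int[lam]_(y in A) (`|h y - h x|)%:E <= (2 * r * e)%:E)%E.
  apply: le_trans dB; apply: ge0_subset_integral => //.
  - by apply/measurable_EFinP; exact: measurable_funTS.
have lAfin : (lam A \is a fin_num).
  rewrite ge0_fin_numE//; apply: (@le_lt_trans _ _ (lam (ball x r))).
    by apply: le_measure; rewrite ?inE.
  by rewrite lebesgue_measure_ball ?ltW// ltry.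
have muA : mu A \is a fin_num by exact: fin_num_measure.
have mhA : measurable_fun A ((fun t => (h t)%:E) : T -> \bar R).
  by apply/measurable_EFinP; exact: measurable_funTS.
have mdA : measurable_fun A ((fun t => `|h t - h x|%:E) : T -> \bar R).
  by apply/measurable_EFinP; exact: measurable_funTS.
have cA : (\int[lam]_(t in A) (h x)%:E = (h x)%:E * lam A)%E by rewrite integral_cst.
apply/andP; split.
  rewrite lerBlDr -lee_fin EFinM EFinD !fineK// -cA muE//.
  apply: (@le_trans _ _ (\int[lam]_(t in A) ((h t)%:E + `|h t - h x|%:E))%E).
    apply: ge0_le_integral => //.
    - by move=> t _; rewrite lee_fin.
    - exact: emeasurable_funD.
    - move=> t _; rewrite -EFinD lee_fin -lerBlDl -normrN opprB; exact: ler_norm.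
  by rewrite ge0_integralD//; [exact: leeD2l|move=> t _; rewrite lee_fin..].
rewrite -lee_fin EFinD EFinM !fineK// -cA muE//.
apply: (@le_trans _ _ (\int[lam]_(t in A) ((h x)%:E + `|h t - h x|%:E))%E).
  apply: ge0_le_integral => //.
  - by move=> t _; rewrite lee_fin.
  - exact: emeasurable_funD.
  - by move=> t _; rewrite -EFinD lee_fin -lerBlDl; exact: ler_norm.
by rewrite ge0_integralD//; [exact: leeD2l|move=> t _; rewrite lee_fin..].
Qed.

End lebesgue_points.

Section good_intervals.
Context {R : realType}.
Notation lam := (@lebesgue_measure R).
Notation T := (measurableTypeR R).

Definition good (mu : set T -> \bar R) (a b : R) : Prop :=
  a < b /\ forall A : set T, measurable A -> A `<=` `]a, b[%classic ->
    mu A = 0%E -> lam A = 0%E.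

(** When [mu] is dominated by Lebesgue measure, the two are equivalent on such an interval: the
    density is positive almost everywhere there. *)
Definition goodset (mu : set T -> \bar R) : set R :=
  [set z | exists a b, [/\ 0 <= a, b <= 1, a < z < b & good mu a b]].

Lemma bmon_indic a b (A : set T) : measurable A -> bmon a b (\1_A : R -> R) 1.
Proof.
move=> mA; apply: bmonT; first exact: measurable_indic.
by move=> t; rewrite indicE; case: (_ \in _); rewrite ?normr1 ?normr0.
Qed.

Lemma itg_indic (p q b : R) : 0 <= p -> p < q -> q <= 1 -> 0 <= b <= 1 ->
  [/\ 0 <= itg (\1_(`[p, q]%classic : set T) : R -> R) 0 b <= q - p,
    b <= p -> itg (\1_(`[p, q]%classic : set T) : R -> R) 0 b = 0 &
    q <= b -> itg (\1_(`[p, q]%classic : set T) : R -> R) 0 b = q - p].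
Proof.
move=> p0 pq q1 /andP[b0 b1].
have B x y := @bmon_indic x y _ (measurable_itv `[p, q]).
set F := (\1_ _ : R -> R) in B *.
have FE t : F t = (p <= t <= q)%R%:R by rewrite /F indicE mem_setE in_itv.
have C x y (c : R) : bmon x y (fun=> c) `|c| by exact: bmon_cst.
have z x y : x <= y -> (forall t, x < t < y -> ~~ (p <= t <= q)) -> itg F x y = 0.
  move=> xy H; rewrite (@eq_itg _ x y F (fun=> 0)) ?itg_cst ?mul0r//.
    by move=> t /H/negbTE; rewrite FE => ->.
  by have [] := B x y.
have o x y : x <= y -> p <= x -> y <= q -> itg F x y = y - x.
  move=> xy px yq; rewrite (@eq_itg _ x y F (fun=> 1)) ?itg_cst ?mul1r//.
    by move=> t /andP[xt ty]; rewrite FE (le_trans px (ltW xt)) (le_trans (ltW ty) yq).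
  by have [] := B x y.
have z1 x : 0 <= x -> x <= p -> itg F 0 x = 0.
  move=> x0 xp; apply: z => // t /andP[_ tx]; rewrite negb_and -ltNge.
  by rewrite (lt_le_trans tx).
have z2 : q <= b -> itg F 0 b = q - p.
  move=> qb; rewrite (itg_split p0 (le_trans (ltW pq) qb) (B _ _)) z1// add0r.
  rewrite (itg_split (ltW pq) qb (B _ _)) o ?(ltW pq)// (z q b)// ?addr0//.
  by move=> t /andP[qt _]; rewrite negb_and -!ltNge qt orbT.
split=> [|bp|//]; last exact: z1.
have [bp|pb] := leP b p; first by rewrite z1// lexx subr_ge0 ltW.
have [bq|qb] := leP b q.
  rewrite (itg_split p0 (ltW pb) (B _ _)) z1// add0r o ?(ltW pb)//.
  by rewrite subr_ge0 (ltW pb)/= lerD2r.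
by rewrite z2 ?(ltW qb)// lexx subr_ge0 ltW.
Qed.

Variables (mu : {finite_measure set T -> \bar R}) (h : R -> R).
Hypotheses (h0 : forall t, 0 <= h t) (ih : lam.-integrable setT (EFin \o (h : T -> R)))
  (hout : forall t, ~ (0 <= t <= 1) -> h t = 0)
  (muE : forall A : set T, measurable A -> mu A = (\int[lam]_(t in A) (h t)%:E)%E).

Let mh : measurable_fun setT (EFin \o (h : T -> R)).
Proof. exact: (measurable_int _ ih). Qed.

Let ae2 (P Q S : T -> Prop) : {ae lam, forall x, P x} -> {ae lam, forall x, Q x} ->
  (forall x, P x -> Q x -> S x) -> {ae lam, forall x, S x}.
Proof. by move=> HP HQ H; exact: (@filterS2 _ _ (ae_filter_ringOfSetsType lam) _ _ _ H HP HQ). Qed.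

(** Strictly below 1, to leave room on the right for the oscillations built next to [x]. *)
Lemma positive_lebesgue_pt : mu setT != 0%E -> exists2 x, 0 <= x < 1 &
  lebesgue_pt h x /\ 0 < h x.
Proof.
move=> mu0; apply: contrapT => N; move/eqP : mu0; apply.
rewrite muE//; apply: (etrans (_ : _ = \int[lam]_(t in setT) (cst 0 t))%E); last exact: integral0.
apply: ae_eq_integral => //.
have n1 : {ae lam, forall x, x <> 1 :> R}.
  exists [set 1 : R]; split; [exact: measurable_set1|exact: lebesgue_measure_set1|].
  by move=> x /= /contrapT ->.
apply: (ae2 (ae_lebesgue_pt ih) n1) => x hx x1 _ /=; congr EFin.
apply/eqP; rewrite eq_le h0 andbT leNgt; apply/negP => hx0; apply: N.
exists x => //; have [x01|/hout hx0'] := pselect (0 <= x <= 1); last by rewrite hx0' ltxx in hx0.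
by have /andP[-> x1'] := x01; rewrite lt_neqAle x1' andbT; apply/eqP.
Qed.

(** On a [mu]-null set of positive length the density vanishes almost everywhere, and almost all
    points are Lebesgue points. *)
Lemma null_lebesgue_pt a b : a < b -> ~ good mu a b -> exists2 x, a < x < b &
  lebesgue_pt h x /\ h x = 0.
Proof.
move=> ab ngood; apply: contrapT => N; apply: ngood; split => // A mA Aab muA0.
have hA : (\int[lam]_(t in A) `|(h t)%:E| = 0)%E.
  by rewrite -[RHS]muA0 muE//; apply: eq_integral => t _; rewrite gee0_abs ?lee_fin.
have mhA : measurable_fun A (EFin \o (h : T -> R)) by exact: measurable_funTS.
have /(ae_eq_integral_abs lam mA mhA) H := hA.
have lp := ae_lebesgue_pt ih.
have nA : {ae lam, forall x, ~ A x}.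
  apply: (ae2 lp H) => x hx Hx Ax; apply: N; exists x.
    by have := Aab _ Ax; rewrite /= in_itv.
  by split => //; have := Hx Ax => -[].
have : lam.-negligible A.
  by apply: negligibleS nA => x Ax /=; exact.
by move/(measure_negligible mA).
Qed.

Lemma norm_sub_le1 (u v : R) : 0 <= u <= 1 -> 0 <= v <= 1 -> `|u - v| <= 1.
Proof. by move=> /andP[? ?] /andP[? ?]; rewrite ler_norml; apply/andP; split; lra. Qed.

(** [g] is a bump of unit integral where the mean density is near [h x], minus another one around a
    Lebesgue point of density 0. Its primitive stays within 1 in absolute value, but [mu] sees the
    difference of the mean densities. Both bumps lie in [[y', y]], so a further pair fits between
    [x] and [y']. *)
Lemma oscillation_pair x y : 0 <= x -> x < y -> y <= 1 ->
  lebesgue_pt h x -> 0 < h x -> (forall a b, 0 <= a -> a < b -> b <= 1 -> ~ good mu a b) ->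
  exists2 y', x < y' < y & exists (g : R -> R) (B : R),
    [/\ measurable_fun setT (g : T -> R), forall t, `|g t| <= B,
      forall b, 0 <= b -> b <= y' -> itg g 0 b = 0,
      (forall b, 0 <= b <= 1 -> `|itg g 0 b| <= 1) /\ (forall b, y <= b -> b <= 1 -> itg g 0 b = 0) &
      h x / 2 <= \int[mu]_t (g : T -> R) t].
Proof.
move=> x0 xy y1 hx hx0 ngood.
(* With this error the mean density on [P], of length [r / 4] in a ball of radius [r], is at least
   [3 / 4 * h x]. *)
have c32 : 0 < h x / 32 by rewrite divr_gt0.
have [r0 r00 Hr] := lebesgue_pt_estimate h0 ih muE hx c32.
pose r := Num.min (r0 / 2) (y - x).
have r_gt0 : 0 < r by rewrite lt_min divr_gt0//= subr_gt0.
have rr0 : r < r0 by rewrite gt_min; apply/orP; left; lra.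
have ry : x + r <= y by rewrite -lerBrDl ge_min lexx orbT.
pose p1 := x + r / 2; pose p2 := x + 3 * r / 4.
have p12 : p1 < p2 by rewrite /p1 /p2; lra.
have [q /andP[q1 q2] [hq hq0]] : exists2 q, x + r / 4 < q < p1 & lebesgue_pt h q /\ h q = 0.
  apply: null_lebesgue_pt; first by rewrite /p1; lra.
  by apply: ngood; rewrite /p1; lra.
(* With this error the mean density on [Q], of length [s], is at most [h x / 4]; the two means then
   differ by at least [h x / 2]. *)
have c8 : 0 < h x / 8 by rewrite divr_gt0.
have [s0 s00 Hs] := lebesgue_pt_estimate h0 ih muE hq c8.
pose s := Num.min (s0 / 2) (Num.min (q - (x + r / 4)) (p1 - q)).
have s_gt0 : 0 < s by rewrite !lt_min divr_gt0//= !subr_gt0 q1.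
have ss0 : s < s0 by rewrite gt_min; apply/orP; left; lra.
have sq1 : s <= q - (x + r / 4) by rewrite !ge_min lexx orbT.
have sq2 : s <= x + r / 2 - q by rewrite !ge_min lexx !orbT.
clearbody r s.
pose k1 := q - s / 2; pose k2 := q + s / 2.
have k12 : k1 < k2 by rewrite /k1 /k2; lra.
have xp1 : x + r / 4 <= p1 by rewrite /p1; lra.
have xk1 : x + r / 4 <= k1 by rewrite /k1; lra.
have p2y : p2 <= y by rewrite /p2; lra.
have k2y : k2 <= y by rewrite /k2; lra.
have x0r : 0 <= x + r / 4 by lra.
have xy' : x < x + r / 4 < y by apply/andP; split; lra.
have p10 := le_trans x0r xp1; have k10 := le_trans x0r xk1.
have p21 := le_trans p2y y1; have k21 := le_trans k2y y1.
pose P : set T := `[p1, p2]%classic; pose Q : set T := `[k1, k2]%classic.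
have mP : measurable P by exact: measurable_itv.
have mQ : measurable Q by exact: measurable_itv.
have lP : lam P = (r / 4)%:E.
  by rewrite /P lebesgue_measure_itv/= lte_fin p12 -EFinB /p1 /p2; congr EFin; field.
have lQ : lam Q = s%:E.
  by rewrite /Q lebesgue_measure_itv/= lte_fin k12 -EFinB /k1 /k2; congr EFin; field.
have muP : 3 / 4 * h x <= 4 / r * fine (mu P).
  have := Hr r P r_gt0 rr0 mP; rewrite lP/= => /(_ _)/andP[|H _].
    move=> t; rewrite /P /= in_itv/= ball_itv /= in_itv/= /p1 /p2 => /andP[h1 h2].
    by apply/andP; split; lra.
  rewrite [leRHS]mulrAC ler_pdivlMr//.
  have E : h x * (r / 4) - 2 * r * (h x / 32) = 3 / 16 * (h x * r) by field.
  rewrite E in H; have : 3 / 4 * h x * r = 4 * (3 / 16 * (h x * r)) by field.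
  by move=> ->; rewrite ler_wpM2l.
have muQ : s^-1 * fine (mu Q) <= h x / 4.
  have := Hs s Q s_gt0 ss0 mQ; rewrite lQ hq0 mul0r add0r => /(_ _)/andP[|_ H].
    move=> t; rewrite /Q /= in_itv/= ball_itv /= in_itv/= /k1 /k2 => /andP[h1 h2].
    by apply/andP; split; lra.
  rewrite ler_pdivrMl//; apply: (le_trans H); rewrite le_eqVlt; apply/orP; left.
  by apply/eqP; field.
pose g t : R := 4 / r * \1_P t - s^-1 * \1_Q t.
have mg : measurable_fun setT (g : T -> R).
  by apply: measurable_funB; apply: measurable_funM => //; exact: measurable_indic.
have bP b : bmon 0 b (\1_P : R -> R) 1 by exact: bmon_indic.
have bQ b : bmon 0 b (\1_Q : R -> R) 1 by exact: bmon_indic.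
have gI b : itg g 0 b = 4 / r * itg (\1_P : R -> R) 0 b - s^-1 * itg (\1_Q : R -> R) 0 b.
  rewrite -(itgM _ (bP b)) -(itgM _ (bQ b)).
  by rewrite -(itgB (bmonM (bmon_cst 0 b (4 / r)) (bP b)) (bmonM (bmon_cst 0 b s^-1) (bQ b))).
have r4 : 0 < 4 / r by rewrite divr_gt0.
have si : 0 < s^-1 by rewrite invr_gt0.
have IP (b : R) (b01 : 0 <= b <= 1) := itg_indic p10 p12 p21 b01.
have IQ (b : R) (b01 : 0 <= b <= 1) := itg_indic k10 k12 k21 b01.
have p21E : 4 / r * (p2 - p1) = 1 by rewrite /p1 /p2; field; rewrite gt_eqF.
have k21E : s^-1 * (k2 - k1) = 1 by rewrite /k1 /k2; field; rewrite gt_eqF.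
exists (x + r / 4); first exact: xy'.
exists g, (4 / r + s^-1); split => //.
- have i1 (A : set T) t : `|\1_A t : R| <= 1.
    by rewrite indicE; case: (_ \in _); rewrite ?normr1 ?normr0.
  move=> t; apply: (le_trans (ler_normB _ _)).
  rewrite (normrM (4 / r)) (normrM s^-1) (gtr0_norm r4) (gtr0_norm si).
  by apply: lerD; rewrite ler_piMr// ltW.
- move=> b b0 br; have b01 : 0 <= b <= 1.
    by rewrite b0 (le_trans br)// (le_trans xp1)// ltW// (lt_le_trans p12).
  have [_ /(_ _) zP _] := IP b b01; have [_ /(_ _) zQ _] := IQ b b01.
  by rewrite gI zP ?zQ ?mulr0 ?subrr// (le_trans br).
- split=> [b b01|b yb b1].
    have [/andP[a1 a2] _ _] := IP b b01; have [/andP[a3 a4] _ _] := IQ b b01.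
    have u1 : 0 <= 4 / r * itg (\1_P : R -> R) 0 b <= 1.
      by rewrite mulr_ge0 ?(ltW r4)//=; have := ler_wpM2l (ltW r4) a2; rewrite p21E.
    have u2 : 0 <= s^-1 * itg (\1_Q : R -> R) 0 b <= 1.
      by rewrite mulr_ge0 ?(ltW si)//=; have := ler_wpM2l (ltW si) a4; rewrite k21E.
    by rewrite gI; exact: norm_sub_le1.
  have b01 : 0 <= b <= 1 by rewrite b1 andbT (le_trans _ yb)// (le_trans x0)// ltW.
  have [_ _ zP] := IP b b01; have [_ _ zQ] := IQ b b01.
  by rewrite gI zP ?zQ ?p21E ?k21E ?subrr// (le_trans _ yb).
have Iind (A : set T) : measurable A -> \int[mu]_t (\1_A t : R) = fine (mu A).
  by move=> mA; rewrite /Rintegral integral_indic// setIT.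
have Bind (A : set T) : measurable A -> forall c : R, mu.-integrable setT (EFin \o ((fun t => c * \1_A t) : T -> R)).
  move=> mA c; apply: (@bounded_Rintegrable _ _ _ `|c|).
    by apply: measurable_funM => //; exact: measurable_indic.
  by move=> t; rewrite normrM ler_piMr// indicE; case: (_ \in _); rewrite ?normr1 ?normr0.
have Bind1 (A : set T) : measurable A -> mu.-integrable setT (EFin \o (\1_A : T -> R)).
  move=> mA; apply: (@bounded_Rintegrable _ _ _ 1); first exact: measurable_indic.
  by move=> t; rewrite indicE; case: (_ \in _); rewrite ?normr1 ?normr0.
rewrite RintegralB//; [|exact: Bind..].
rewrite !RintegralZl//; [|exact: Bind1..].
by rewrite !Iind//; lra.
Qed.

End good_intervals.

Section good_interval_exists.
Context {R : realType} {m : nat}.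
Notation lam := (@lebesgue_measure R).
Notation T := (measurableTypeR R).
Variables (f : pwexp R m) (mu : {finite_measure set T -> \bar R}) (K : nat).
Hypotheses (K0 : (0 < K)%N) (mul : mu `<< lam) (mu01 : mu (~` `[0, 1]%classic) = 0%E)
  (muK : forall A : set T, measurable A -> mu (iter K f @^-1` A) = mu A).

(** Otherwise every interval contains Lebesgue points of density 0. Near a Lebesgue point [x] with
    [0 < h x], nest [n] oscillation pairs: their primitives live on disjoint segments, so the sum
    has primitive at most 1, while its integral is at least [n * h x / 2]. This contradicts
    [dual_bounded_variation] for large [n]. *)
Lemma good_interval_exists : mu setT != 0%E ->
  exists a b, [/\ 0 <= a, b <= 1 & good mu a b].
Proof.
move=> mu0; apply: contrapT => N.
have ngood (a b : R) : 0 <= a -> a < b -> b <= 1 -> ~ good mu a b.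
  by move=> a0 ab b1 gab; apply: N; exists a, b.
have [h [h0 ih hout hE _]] := finite_density mul mu01.
have [x /andP[x0 x1] [hx hx0]] := positive_lebesgue_pt h0 ih hout hE mu0.
have [C C0 HC] := dual_bounded_variation K0 mul mu01 muK.
have osc n : forall y, x < y -> y <= 1 -> exists (g : R -> R) (B : R),
    [/\ measurable_fun setT (g : T -> R), forall t, `|g t| <= B,
      (forall b, 0 <= b <= 1 -> `|itg g 0 b| <= 1),
      (forall b, y <= b -> b <= 1 -> itg g 0 b = 0) &
      n%:R * (h x / 2) <= \int[mu]_t (g : T -> R) t].
  elim: n => [|n IH] y xy y1.
    have z b : 0 <= b -> itg (fun=> 0 : R) 0 b = 0 by move=> b0; rewrite itg_cst// mul0r.
    exists (fun=> 0), 0; split => //.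
    - by move=> t; rewrite normr0.
    - by move=> b /andP[b0 _]; rewrite z// normr0.
    - by move=> b yb _; rewrite z//; lra.
    - by rewrite mul0r Rintegral_cst// mul0r.
  have [y' /andP[xy' yy'] [g1 [B1 [m1 b1 z1 [v1 w1] i1]]]] :=
    oscillation_pair h0 ih hE x0 xy y1 hx hx0 ngood.
  have [g2 [B2 [m2 b2 v2 z2 i2]]] := IH y' xy' (le_trans (ltW yy') y1).
  have gI b : itg (fun t => g1 t + g2 t) 0 b = itg g1 0 b + itg g2 0 b.
    by apply: itgD; [exact: bmonT m1 b1|exact: bmonT m2 b2].
  exists (fun t => g1 t + g2 t), (B1 + B2); split.
  - exact: measurable_funD.
  - by move=> t; apply: (le_trans (ler_normD _ _)); rewrite lerD.
  - move=> b b01; have /andP[b0 b1'] := b01; rewrite gI; have [by'|y'b] := leP b y'.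
      by rewrite z1// add0r v2.
    by rewrite z2 ?addr0 ?v1// ltW.
  - by move=> b yb b1'; rewrite gI w1// z2 ?addr0//; lra.
  - rewrite RintegralD//; [|exact: bounded_Rintegrable m1 b1|exact: bounded_Rintegrable m2 b2].
    rewrite -natr1 mulrDl mul1r addrC; exact: lerD.
pose n := (Num.truncn (C / (h x / 2))).+1.
have hx2 : 0 < h x / 2 by rewrite divr_gt0.
have [g [B [mg gB v _ i]]] := osc n 1 x1 (lexx 1).
have := HC g B 1 mg gB ler01 v; rewrite mulr1 => /(le_trans (ler_norm _))/(le_trans i).
by rewrite leNgt -ltr_pdivrMr// truncnS_gt.
Qed.

End good_interval_exists.

Section goodsets.
Context {R : realType}.
Notation lam := (@lebesgue_measure R).
Notation T := (measurableTypeR R).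
Implicit Types (mu nu : set T -> \bar R).

Lemma goodset_ext mu nu : (forall A : set T, measurable A -> mu A = nu A) ->
  goodset mu = goodset nu.
Proof.
move=> E; have H mu' nu' : (forall A : set T, measurable A -> mu' A = nu' A) ->
    goodset mu' `<=` goodset nu'.
  move=> {}E z [a [b [a0 b1 zab [ab G]]]]; exists a, b; split => //; split => // A mA Aab.
  by rewrite -E//; exact: G.
by apply/seteqP; split; apply: H => // A mA; rewrite E.
Qed.

Lemma goodset01 mu z : goodset mu z -> 0 < z < 1.
Proof.
by move=> [a [b [a0 b1 /andP[az zb] _]]]; rewrite (le_lt_trans a0)//= (lt_le_trans zb).
Qed.

Lemma goodS mu a b a' b' : a <= a' -> a' < b' -> b' <= b -> good mu a b -> good mu a' b'.
Proof.
move=> aa ab bb [_ G]; split => // A mA Aab; apply: G => // t /Aab.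
by rewrite /= !in_itv/= => /andP[h1 h2]; rewrite (le_lt_trans aa)//= (lt_le_trans h2).
Qed.

Lemma good_goodset mu a b : 0 <= a -> b <= 1 -> good mu a b -> `]a, b[ `<=` goodset mu.
Proof. by move=> a0 b1 G z /=; rewrite in_itv/= => zab; exists a, b. Qed.

Lemma open_goodset mu : open (goodset mu).
Proof.
rewrite openE => z [a [b [a0 b1 zab G]]]; rewrite /interior.
have : nbhs z `]a, b[%classic.
  by apply: open_nbhs_nbhs; split; [exact: itv_open|rewrite /= in_itv].
by apply: filterS; exact: good_goodset.
Qed.

Lemma measurable_goodset mu : measurable (goodset mu : set T).
Proof. by apply: open_measurable; exact: open_goodset. Qed.

Lemma good_null mu x y : good mu x y -> mu `]x, y[%classic = 0%E -> False.
Proof.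
move=> [xy G] /G; move=> /(_ (measurable_itv _) (fun=> id)).
by rewrite lebesgue_measure_itv/= lte_fin xy -EFinB => /eqP; rewrite eqe subr_eq0 gt_eqF.
Qed.

End goodsets.

Section goodset_dynamics.
Context {R : realType} {m : nat}.
Notation lam := (@lebesgue_measure R).
Notation T := (measurableTypeR R).
Variable (f : pwexp R m).

Lemma mT_pw : measurable_fun setT (f : T -> T).
Proof. exact: pw_measurable. Qed.

Lemma measurable_preimage_pw (A : set T) : measurable A -> measurable (f @^-1` A : set T).
Proof. by move=> mA; rewrite -[X in measurable X]setTI; exact: mT_pw. Qed.

Lemma measurable_preimage_iter n (A : set T) : measurable A ->
  measurable (iter n f @^-1` A : set T).
Proof. by move=> mA; rewrite -[X in measurable X]setTI; exact: mT_iterK. Qed.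

(** By substitution the length of [A] is the integral of the bounded function [|f'|] over a null
    preimage. *)
Lemma null_image i x y (A : set T) : x < y -> pw_open f i x -> pw_open f i y ->
  measurable A -> A `<=` `[Num.min (f x) (f y), Num.max (f x) (f y)]%classic ->
  lam (`[x, y]%classic `&` f @^-1` A) = 0%E -> lam A = 0%E.
Proof.
move=> xy Ox Oy mA AK l0.
have mi : measurable_fun setT (\1_A : T -> R) by exact: measurable_indic.
have iB (C : set T) t : `|\1_C t : R| <= 1.
  by rewrite indicE; case: (_ \in _); rewrite ?normr1 ?normr0.
have := pw_substitution (ltW xy) Ox Oy mi (iB A).
have [s [M [L HC]]] := pw_consts f.
have [mD DM] := pw_der_bmon HC Ox Oy.
have bD : bmon x y (fun t => `|pw_der f i t|) M.
  split; first exact: measurableT_comp.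
  by move=> t /DM; rewrite normr_id.
have mfA := measurable_preimage_pw mA.
have M0 := pw_const_M0 i HC.
have bf : bmon x y (\1_(f @^-1` A) : R -> R) 1 by exact: bmon_indic.
have E0 : itg (\1_(f @^-1` A) : R -> R) x y = 0.
  rewrite /itg /Rintegral (_ : (\int[lam]_(_ in _) _)%E = 0%E)//.
  by rewrite integral_indic// setIC; exact: l0.
have h1 : itg (fun t => \1_A (f t) * `|pw_der f i t|) x y <= 0.
  rewrite -[leRHS](mulr0 M) -E0 -(itgM _ bf); apply: itg_le.
  - exact: bmonM bf bD.
  - exact: bmonM (bmon_cst x y M) bf.
  - by move=> t txy; rewrite mulrC ler_wpM2r// DM.
have h2 : 0 <= itg (fun t => \1_A (f t) * `|pw_der f i t|) x y.
  by apply: Rintegral_ge0 => t _; rewrite mulr_ge0.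
have -> : itg (fun t => \1_A (f t) * `|pw_der f i t|) x y = 0.
  by apply/eqP; rewrite eq_le h1.
move=> /esym; rewrite /itg /Rintegral integral_indic// setIidl//.
have lA : lam A \is a fin_num.
  rewrite ge0_fin_numE//.
  apply: (@le_lt_trans _ _ (lam `[Num.min (f x) (f y), Num.max (f x) (f y)]%classic)).
    by apply: le_measure; rewrite ?inE.
  by rewrite lebesgue_measure_itv/=; case: ifP => _; rewrite -?EFinB ltry.
by move=> H; rewrite -(fineK lA); congr EFin; exact: H.
Qed.

Lemma pw_open_room i z a b : pw_open f i z -> a < z < b -> exists x y,
  [/\ a < x, x < z, z < y, y < b & pw_open f i x /\ pw_open f i y].
Proof.
rewrite /pw_open /= !in_itv/= => /andP[h1 h2] /andP[h3 h4].
exists ((Num.max a (pw_left f i) + z) / 2), ((Num.min b (pw_right f i) + z) / 2).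
have : Num.max a (pw_left f i) < z by rewrite gt_max h3.
have : z < Num.min b (pw_right f i) by rewrite lt_min h4.
have : a <= Num.max a (pw_left f i) by rewrite le_max lexx.
have : pw_left f i <= Num.max a (pw_left f i) by rewrite le_max lexx orbT.
have : Num.min b (pw_right f i) <= b by rewrite ge_min lexx.
have : Num.min b (pw_right f i) <= pw_right f i by rewrite ge_min lexx orbT.
rewrite !in_itv/= => *; split; [lra|lra|lra|lra|split; apply/andP; split; lra].
Qed.

(** A [nu]-null set near [f z] has a [mu]-null preimage, which is Lebesgue null near [z], and
    [null_image] brings this back. [mu] is a bare set function with monotone null sets, so that the
    lemma can be iterated on pushforwards. *)
Lemma goodset_image (mu nu : set T -> \bar R) i z :
  (forall A B : set T, measurable A -> measurable B -> A `<=` B -> mu B = 0%E -> mu A = 0%E) ->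
  (forall A : set T, measurable A -> nu A = mu (f @^-1` A)) ->
  goodset mu z -> pw_open f i z -> goodset nu (f z).
Proof.
move=> mumon nuE [a [b [a0 b1 zab G]]] Oz.
have [x [y [ax xz zy yb [Ox Oy]]]] := pw_open_room Oz zab.
have xy := lt_trans xz zy.
have fx : 0 <= f x <= 1 by apply: pw_fun01; have /andP[? ?] := pw_open01 Ox; rewrite !ltW.
have fy : 0 <= f y <= 1 by apply: pw_fun01; have /andP[? ?] := pw_open01 Oy; rewrite !ltW.
have /andP[fx0 fx1] := fx; have /andP[fy0 fy1] := fy.
have mm : Num.min (f x) (f y) < f z < Num.max (f x) (f y).
  rewrite gt_min lt_max.
  have [H|H] := pw_monotone f i; have h1 := H _ _ Ox Oz xz; have h2 := H _ _ Oz Oy zy.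
    by rewrite h1 h2 orbT.
  by rewrite h1 h2 !orbT.
exists (Num.min (f x) (f y)), (Num.max (f x) (f y)); split => //.
- by rewrite le_min fx0.
- by rewrite ge_max fx1.
have /andP[mm1 mm2] := mm.
split; first exact: lt_trans mm2.
move=> A mA Amm; rewrite nuE// => muA.
apply: (null_image xy Ox Oy mA).
  by move=> t /Amm; rewrite /= !in_itv/= => /andP[/ltW-> /ltW->].
have mB : measurable (`[x, y]%classic `&` f @^-1` A : set T).
  by apply: measurableI => //; exact: measurable_preimage_pw.
apply: G.2 => //.
  by move=> t [] /=; rewrite !in_itv/= => /andP[h1 h2] _; rewrite (lt_le_trans ax)//= (le_lt_trans h2).
apply: (mumon _ (f @^-1` A)) => //; first exact: measurable_preimage_pw.
Qed.

Lemma finite_lam0 (S : set T) : finite_set S -> measurable S /\ lam S = 0%E.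
Proof.
move=> fS; have cS := finite_set_countable fS; split.
  by apply: countable_measurable => // t; exact: measurable_set1.
exact: countable_lebesgue_measure0.
Qed.

Variables (mu : {finite_measure set T -> \bar R}) (K : nat).
Hypotheses (K0 : (0 < K)%N) (mul : mu `<< lam) (mu01 : mu (~` `[0, 1]%classic) = 0%E)
  (muK : forall A : set T, measurable A -> mu (iter K f @^-1` A) = mu A).

Lemma null_mon (A B : set T) : measurable A -> measurable B -> A `<=` B ->
  mu B = 0%E -> mu A = 0%E.
Proof. by move=> mA mB AB B0; apply: subset_measure0 B0. Qed.

Lemma lam0_mu0 (A : set T) : measurable A -> lam A = 0%E -> mu A = 0%E.
Proof. by move: mul => /null_content_dominatesP; exact. Qed.

Lemma goodset_iter n z : goodset mu z -> ~ hit f (all_cuts f) n z ->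
  goodset (fun A => mu (iter n f @^-1` A)) (iter n f z).
Proof.
move=> Uz; have z01 : 0 <= z <= 1 by have /andP[? ?] := goodset01 Uz; rewrite !ltW.
elim: n => [|n IH] nh //.
have nh' : ~ hit f (all_cuts f) n z.
  by move=> /(@hit_iter _ _ f _ _ _ z01)[k kn Ck]; apply: nh; apply/(@hit_iter _ _ f _ _ _ z01); exists k => //; exact: ltnW.
have nc : ~ all_cuts f (iter n f z).
  by move=> Cn; apply: nh; apply/(@hit_iter _ _ f _ _ _ z01); exists n.
have [i Oi] := noncut_open (iter01 f n z01) nc.
apply: (goodset_image _ _ (IH nh') Oi).
  move=> A B mA mB AB; apply: null_mon; [exact: measurable_preimage_iter..|].
  by move=> t; exact: AB.
by move=> A mA; congr (mu _); apply/seteqP; split => t /=; rewrite iterS.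
Qed.

(** The core is invariant under the [K]-th iterate up to [mu]-null sets: it is mapped into itself
    off finitely many points, and its preimage has the same mass. So the restriction of [mu] to the
    complement is invariant; were it nonzero, it would have a good interval, which is also good for
    [mu], hence lies in the core, where the restriction vanishes. *)
Lemma goodset_full : mu (~` goodset mu) = 0%E.
Proof.
have mU := measurable_goodset mu; set U := goodset mu in mU *.
pose V : set T := iter K f @^-1` U.
have mV : measurable V by exact: measurable_preimage_iter.
have [mH lH] := finite_lam0 (finite_hit f K (finite_all_cuts f)).
have UV : mu (U `\` V) = 0%E.
  apply: (@null_mon _ (hit f (all_cuts f) K)) => //; [exact: measurableD| |exact: lam0_mu0].
  move=> z [Uz nVz]; apply: contrapT => nh; apply: nVz.
  rewrite /V /= /U -(goodset_ext muK); exact: goodset_iter.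
have muVU : mu V = mu U by exact: muK.
have mufin (A : set T) : measurable A -> mu A \is a fin_num by move=> mA; exact: fin_num_measure.
have dec (A B : set T) : measurable A -> measurable B -> mu A = (mu (A `&` B) + mu (A `\` B))%E.
  move=> mA mB; rewrite -measureU; first by rewrite setUIDK.
  - exact: measurableI.
  - exact: measurableD.
  - by rewrite setDE setIACA setICr setI0.
have VU : mu (V `\` U) = 0%E.
  have f1 := mufin _ (measurableI _ _ mV mU).
  have f2 := mufin _ (measurableD mV mU).
  have := muVU; rewrite (dec V U)// (dec U V)// UV adde0 (setIC U V).
  rewrite -(fineK f1) -(fineK f2) -EFinD => -[] /eqP.
  by rewrite -subr_eq0 addrAC subrr add0r => /eqP ->.
have swap (X : set T) : measurable X -> mu (X `\` U) = mu (X `\` V).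
  move=> mX.
  have h (A B : set T) : measurable A -> measurable B -> mu (B `\` A) = 0%E ->
      (mu (X `\` A) <= mu (X `\` B))%E.
    move=> mA mB BA; rewrite -[leRHS]adde0 -BA.
    apply: (@le_trans _ _ (mu ((X `\` B) `|` (B `\` A)))).
      apply: le_measure; rewrite ?inE.
      - exact: measurableD.
      - by apply: measurableU; exact: measurableD.
      - by move=> t [Xt nA]; have [Bt|nB] := pselect (B t); [right|left].
    by apply: measureU2; exact: measurableD.
  by apply/eqP; rewrite eq_le !h.
have mCU : measurable (~` U : set T) by exact: measurableC.
have CUoo : (mu (~` U) < +oo)%E by rewrite -ge0_fin_numE// mufin.
pose nu : {finite_measure set T -> \bar R} := mfrestr mCU CUoo.
have nuE A : nu A = mu (A `\` U) by rewrite setDE.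
apply: contrapT => /eqP n0.
have [||||a [b [a0 b1 G]]] := @good_interval_exists R m f nu K K0.
- apply/null_content_dominatesP => A mA A0; rewrite nuE.
  apply: (null_mon _ mA) => //; [exact: measurableD|exact: lam0_mu0].
- rewrite nuE; apply: (null_mon _ _ _ mu01).
  + by apply: measurableD => //; exact: measurableC.
  + exact: measurableC.
  + by move=> t [].
- move=> A mA; rewrite !nuE swap; last exact: measurable_preimage_iter.
  rewrite -[RHS]muK; last exact: measurableD.
  by [].
- by rewrite nuE setTD.
have Gm : good mu a b.
  have [ab HG] := G; split => // A mA Aab muA; apply: HG => //; rewrite nuE.
  by apply: (null_mon _ mA) => //; exact: measurableD.
have abU := good_goodset a0 b1 Gm.
apply: (good_null G).
by rewrite nuE (_ : _ `\` _ = set0) ?measure0// setD_eq0.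
Qed.

End goodset_dynamics.

(** * Boundary points of the cores *)

Section real_sets.
Context {R : realType}.
Implicit Types (U : set R) (x y z w : R).

Lemma fin_pos_lb (I : finType) (r : I -> R) : (forall i, 0 < r i) ->
  exists2 d : R, 0 < d & forall i, d <= r i.
Proof.
(* A formula in place of a minimum: it is below each [r i], and positive even if [I] is empty. *)
move=> r0; exists ((1 + \sum_i (r i)^-1)^-1).
  by rewrite invr_gt0 ltr_pwDl// sumr_ge0// => i _; rewrite invr_ge0 ltW.
move=> i; rewrite -[leRHS]invrK lef_pV2 ?posrE ?invr_gt0//; last first.
  by rewrite ltr_pwDl// sumr_ge0// => j _; rewrite invr_ge0 ltW.
rewrite (bigD1 i)//= addrCA lerDl addr_ge0// sumr_ge0// => j _.
by rewrite invr_ge0 ltW.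
Qed.

Lemma finite_set_gap (Z : set R) : finite_set Z ->
  exists2 e : R, 0 < e & forall x y, Z x -> Z y -> `|x - y| < e -> x = y.
Proof.
move=> /finite_seqP[s ->].
pose r (ij : 'I_(size s) * 'I_(size s)) : R :=
  if s`_ij.1 == s`_ij.2 then 1 else `|s`_ij.1 - s`_ij.2|.
have [|d d0 Hd] := @fin_pos_lb _ r.
  by move=> [i j]; rewrite /r /=; case: eqVneq => // ne; rewrite normr_gt0 subr_eq0.
exists d => // x y /= xs ys xy; apply/eqP; apply: contraTT xy => ne.
have xi : (index x s < size s)%N by rewrite index_mem.
have yi : (index y s < size s)%N by rewrite index_mem.
have := Hd (Ordinal xi, Ordinal yi); rewrite /r /= !nth_index// (negbTE ne).
by rewrite leNgt.
Qed.

Definition opn U := forall x, U x -> exists2 e : R, 0 < e & forall y, `|y - x| < e -> U y.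

Lemma open_opn U : open U <-> opn U.
Proof.
rewrite openE; split=> [H x /H/nbhs_ballP[e /= e0 He]|H x /H[e e0 He]].
  by exists e => // y yx; apply: He; rewrite /ball /= distrC.
by apply/nbhs_ballP; exists e => //= y; rewrite /ball /= distrC => /He.
Qed.

(** The boundary of [U] when [U] is open, in the metric form that is pulled back along branches. *)
Definition bd U x := ~ U x /\ forall e : R, 0 < e -> exists2 y, U y & `|y - x| < e.

(** Insensitive to orientation, so that increasing and decreasing branches can be treated alike. *)
Definition btw x w z := (x < w < z) || (z < w < x).

Lemma btw_norm x w z : btw x w z -> [/\ `|w - x| < `|z - x|, `|w - z| < `|z - x| & w != x].
Proof.
move=> /orP[/andP[h1 h2]|/andP[h1 h2]].
  have xz := lt_trans h1 h2.
  rewrite (@gtr0_norm _ (w - x)) ?subr_gt0// (@ltr0_norm _ (w - z)) ?subr_lt0//.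
  by rewrite (@gtr0_norm _ (z - x)) ?subr_gt0// gt_eqF//; split => //; lra.
have zx := lt_trans h1 h2.
rewrite (@ltr0_norm _ (w - x)) ?subr_lt0// (@gtr0_norm _ (w - z)) ?subr_gt0//.
by rewrite (@ltr0_norm _ (z - x)) ?subr_lt0// lt_eqF//; split => //; lra.
Qed.

(** [y] is the last point outside [U] on the way from [w] to [w0]; one orientation is the reflection
    of the other. *)
Lemma bd_between U w w0 : opn U -> U w0 -> ~ U w ->
  exists2 y, bd U y & y = w \/ btw w y w0.
Proof.
have H U' v v0 : opn U' -> U' v0 -> ~ U' v -> v < v0 -> exists2 y, bd U' y & v <= y < v0.
  move=> oU Uv0 nUv vv0; pose S := [set t | v <= t <= v0 /\ ~ U' t].
  have S0 : S v by split => //; rewrite lexx ltW.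
  have sS : has_sup S by split; [exists v|exists v0 => t [/andP[]]].
  have vs : v <= sup S by apply: ub_le_sup => //; exact: sS.2.
  have sv0 : sup S <= v0 by apply: ge_sup; [exact: sS.1|move=> t [/andP[]]].
  have nUs : ~ U' (sup S).
    move=> /oU[e e0 He]; have [t [tt nt] ts] := @sup_adherent _ S e e0 sS.
    have /ub_le_sup tS : S t by [].
    have {}tS : t <= sup S by apply: ub_le_sup; [exact: sS.2|].
    by apply: nt; apply: He; rewrite ler0_norm ?subr_le0//; lra.
  have sv0' : sup S < v0.
    by rewrite lt_neqAle sv0 andbT; apply: contra_notN nUs => /eqP ->.
  exists (sup S); last by rewrite vs.
  split => // e e0; pose t := sup S + Num.min (e / 2) ((v0 - sup S) / 2).
  have m0 : 0 < Num.min (e / 2) ((v0 - sup S) / 2).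
    by rewrite lt_min !divr_gt0 ?subr_gt0.
  have m1 : Num.min (e / 2) ((v0 - sup S) / 2) <= e / 2 by rewrite ge_min lexx.
  have m2 : Num.min (e / 2) ((v0 - sup S) / 2) <= (v0 - sup S) / 2 by rewrite ge_min lexx orbT.
  exists t; last by rewrite /t addrAC subrr add0r gtr0_norm//; lra.
  apply: contrapT => nt; have : S t by split => //; rewrite /t; apply/andP; split; lra.
  move=> St; have : t <= sup S by apply: ub_le_sup; [exact: sS.2|].
  by rewrite /t; lra.
move=> oU U0 nU; have [ww0|w0w|E] := ltgtP w w0.
- have [y by_ /andP[+ yw0]] := H U w w0 oU U0 nU ww0.
  rewrite le_eqVlt => /predU1P[wy|wy]; exists y => //; first by left.
  by right; rewrite /btw wy yw0.
- have oU' : opn [set v | U (- v)].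
    move=> v /oU[e e0 He]; exists e => // u uv; apply: He.
    by rewrite opprK addrC distrC.
  have [|||y [nUy By] /andP[+ yw0]] := H [set v | U (- v)] (- w) (- w0) oU'.
  + by rewrite /= opprK.
  + by rewrite /= opprK.
  + by rewrite ltrN2.
  have bdy : bd U (- y).
    split => // e /By[t Ut te]; exists (- t) => //.
    by rewrite opprK addrC distrC.
  rewrite le_eqVlt => /predU1P[wy|wy]; exists (- y) => //; first by left; rewrite -wy opprK.
  by right; apply/orP; right; rewrite ltrNr yw0 ltrNl wy.
- by rewrite E in nU.
Qed.

End real_sets.

Section branch_extension.
Context {R : realType} {m : nat}.
Variable f : pwexp R m.
Implicit Types (i : 'I_m) (x y : R).

Definition pw_closed i x := pw_left f i <= x <= pw_right f i.

Lemma pw_open_closed i x : pw_open f i x -> pw_closed i x.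
Proof. by rewrite /pw_open /= in_itv/= /pw_closed => /andP[/ltW-> /ltW->]. Qed.

Lemma bext_approx i x e : pw_closed i x -> 0 < e ->
  exists2 x', pw_open f i x' & `|x' - x| < e /\ `|bext f i x' - bext f i x| < e.
Proof.
move=> cx e0; have /subspace_continuousP/(_ x) := @bext_continuous _ _ f i.
rewrite /= in_itv/= => /(_ cx)/(@cvgrPdist_lt R R)/(_ e e0)/nbhs_ballP[d /= d0 Hd].
have ab := pw_left_lt_right f i.
have de : 0 < Num.min d e by rewrite lt_min d0.
have lp : limit_pt (pw_open f i) x.
  have /andP[ax xb] := cx.
  move=> {}d {d0 Hd de} d0.
  pose r := Num.min (d / 2) ((pw_right f i - pw_left f i) / 4).
  have r0 : 0 < r by rewrite lt_min !divr_gt0 ?subr_gt0.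
  have r1 : r <= d / 2 by rewrite ge_min lexx.
  have r2 : r <= (pw_right f i - pw_left f i) / 4 by rewrite ge_min lexx orbT.
  have [h|h] := leP x ((pw_left f i + pw_right f i) / 2).
    exists (x + r); first by rewrite /pw_open /= in_itv/=; apply/andP; split; lra.
    by rewrite addrAC subrr add0r gtr0_norm//; split; [rewrite gt_eqF// ltrDl|lra].
  exists (x - r); first by rewrite /pw_open /= in_itv/=; apply/andP; split; lra.
  rewrite addrAC subrr add0r normrN gtr0_norm//.
  by split; [rewrite lt_eqF// gtrDl oppr_lt0|lra].
have [y Oy [yx]] := lp _ de; rewrite lt_min => /andP[yd ye].
exists y => //; split => //; rewrite distrC; apply: Hd; first by rewrite /ball /= distrC.
by rewrite /= in_itv/=; exact: pw_open_closed.
Qed.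

Lemma bext_lip s M L : pw_const f s M L -> forall i x y, pw_closed i x -> pw_closed i y ->
  s * `|x - y| <= `|bext f i x - bext f i y| <= M * `|x - y|.
Proof.
move=> HC i x y cx cy; have M0 := pw_const_M0 i HC.
have s0 : 0 < s by have := pwc_gt1 HC; lra.
have apx e : 0 < e -> exists x' y', [/\ pw_open f i x', pw_open f i y',
    `| `|x' - y'| - `|x - y| | <= 2 * e &
    `| `|bext f i x' - bext f i y'| - `|bext f i x - bext f i y| | <= 2 * e].
  move=> e0; have [x' Ox [x1 x2]] := bext_approx cx e0.
  have [y' Oy [y1 y2]] := bext_approx cy e0.
  exists x', y'; split => //.
    apply: (le_trans (ler_dist_dist _ _)).
    have -> : x' - y' - (x - y) = (x' - x) - (y' - y) by ring.
    by apply: (le_trans (ler_normB _ _)); lra.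
  apply: (le_trans (ler_dist_dist _ _)).
  set a := bext f i x'; set b := bext f i y'.
  have -> : a - b - (bext f i x - bext f i y) = (a - bext f i x) - (b - bext f i y) by ring.
  by apply: (le_trans (ler_normB _ _)); rewrite -/a in x2; rewrite -/b in y2; lra.
apply/andP; split; apply/ler_addgt0Pr => e e0.
  have e1 : 0 < e / (2 + 2 * s) by rewrite divr_gt0// addr_gt0// mulr_gt0.
  have [x' [y' [Ox Oy]]] := apx _ e1.
  rewrite !ler_norml => /andP[h1 h2] /andP[h3 h4].
  have /andP[h5 _] := pw_lipP HC Ox Oy.
  have E : e = 2 * (e / (2 + 2 * s)) + s * (2 * (e / (2 + 2 * s))).
    by field; rewrite gt_eqF// addr_gt0// mulr_gt0.
  have h6 : s * `|x - y| <= s * `|x' - y'| + s * (2 * (e / (2 + 2 * s))).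
    by rewrite -mulrDr ler_wpM2l ?(ltW s0)//; lra.
  by rewrite (bext_open Ox) (bext_open Oy) in h3 h4; lra.
have e1 : 0 < e / (2 + 2 * M) by rewrite divr_gt0// addr_gt0// mulr_gt0.
have [x' [y' [Ox Oy]]] := apx _ e1.
rewrite 2!ler_norml => /andP[h1 h2] /andP[h3 h4].
have /andP[_ h5] := pw_lipP HC Ox Oy.
have E : e = 2 * (e / (2 + 2 * M)) + M * (2 * (e / (2 + 2 * M))).
  by field; rewrite gt_eqF// addr_gt0// mulr_gt0.
have h6 : M * `|x' - y'| <= M * `|x - y| + M * (2 * (e / (2 + 2 * M))).
  by rewrite -mulrDr ler_wpM2l ?(ltW M0)//; lra.
by rewrite (bext_open Ox) (bext_open Oy) in h3 h4; lra.
Qed.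

Lemma bext_monotone i :
  (forall x y, pw_closed i x -> pw_closed i y -> x < y -> bext f i x < bext f i y) \/
  (forall x y, pw_closed i x -> pw_closed i y -> x < y -> bext f i y < bext f i x).
Proof.
have [s [M [L HC]]] := pw_consts f; have s0 : 0 < s by have := pwc_gt1 HC; lra.
have ne x y : pw_closed i x -> pw_closed i y -> x < y -> bext f i x != bext f i y.
  move=> cx cy xy; have /andP[+ _] := bext_lip HC cx cy.
  rewrite -subr_eq0 -normr_gt0; apply: lt_le_trans.
  by rewrite mulr_gt0// normr_gt0 subr_eq0 lt_eqF.
have apx x y e : pw_closed i x -> pw_closed i y -> x < y -> 0 < e -> exists x' y',
    [/\ pw_open f i x', pw_open f i y', x' < y', `|f x' - bext f i x| < e & `|f y' - bext f i y| < e].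
  move=> cx cy xy e0; have e1 : 0 < Num.min e ((y - x) / 2) by rewrite lt_min e0 divr_gt0 ?subr_gt0.
  have [x' Ox []] := bext_approx cx e1; have [y' Oy []] := bext_approx cy e1.
  rewrite !lt_min (bext_open Ox) (bext_open Oy) => /andP[_ y1] /andP[y2 _] /andP[_ x1] /andP[x2 _].
  exists x', y'; split => //.
  by move: x1 y1; rewrite !ltr_norml => /andP[h1 h2] /andP[h3 h4]; lra.
have [H|H] := pw_monotone f i; [left|right] => x y cx cy xy; rewrite lt_neqAle.
  rewrite ne//=; apply/ler_addgt0Pr => e e0; have e2 : 0 < e / 2 by rewrite divr_gt0.
  have [x' [y' [Ox Oy xy']]] := apx x y _ cx cy xy e2.
  by have := H _ _ Ox Oy xy'; rewrite !ltr_norml => h /andP[h1 h2] /andP[h3 h4]; lra.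
rewrite eq_sym ne//=; apply/ler_addgt0Pr => e e0; have e2 : 0 < e / 2 by rewrite divr_gt0.
have [x' [y' [Ox Oy xy']]] := apx x y _ cx cy xy e2.
by have := H _ _ Ox Oy xy'; rewrite !ltr_norml => h /andP[h1 h2] /andP[h3 h4]; lra.
Qed.

Lemma bext_btw i x w z : pw_closed i x -> pw_closed i z -> btw x w z ->
  btw (bext f i x) (bext f i w) (bext f i z).
Proof.
move=> cx cz b; have cw : pw_closed i w.
  move: cx cz; rewrite /pw_closed => /andP[h1 h2] /andP[h3 h4].
  by move: b => /orP[/andP[h5 h6]|/andP[h5 h6]]; apply/andP; split; lra.
have [H|H] := bext_monotone i; move: b => /orP[/andP[h5 h6]|/andP[h5 h6]]; rewrite /btw.
- by rewrite (H x w)// (H w z).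
- by rewrite (H z w)// (H w x)// orbT.
- by rewrite (H x w)// (H w z)// orbT.
- by rewrite (H z w)// (H w x).
Qed.

Lemma bext_IVT i x z v : pw_closed i x -> pw_closed i z -> btw (bext f i x) v (bext f i z) ->
  exists2 w, btw x w z & bext f i w = v.
Proof.
have main a b : pw_closed i a -> pw_closed i b -> a < b ->
    btw (bext f i a) v (bext f i b) -> exists2 w, a < w < b & bext f i w = v.
  move=> ca cb ab Hv; have [||w] := @IVT R (bext f i) a b v (ltW ab).
  - apply: continuous_subspaceW (@bext_continuous _ _ f i) => t /=; rewrite !in_itv/=.
    by move: ca cb => /andP[h1 _] /andP[_ h2] /andP[h3 h4]; rewrite (le_trans h1)//= (le_trans h4).
  - move: Hv => /orP[/andP[h1 h2]|/andP[h1 h2]]; rewrite ge_min le_max.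
      by rewrite (ltW h1) (ltW h2) orbT.
    by rewrite (ltW h1) (ltW h2) orbT.
  rewrite in_itv/= => /andP[]; rewrite !le_eqVlt => /predU1P[<-|aw].
    by move=> _ E; move: Hv; rewrite -E /btw !ltxx andbF.
  move=> /predU1P[->|wb] E; last by exists w => //; rewrite aw.
  by move: Hv; rewrite -E /btw !ltxx !andbF.
move=> cx cz Hv; have [xz|zx|E] := ltgtP x z.
- by have [w h <-] := main x z cx cz xz Hv; exists w => //; rewrite /btw h.
- have [|w h <-] := main z x cz cx zx; first by rewrite /btw orbC.
  by exists w => //; rewrite /btw h orbT.
- by move: Hv; rewrite E /btw orbb => /andP[h1 h2]; have := lt_trans h1 h2; rewrite ltxx.
Qed.

Lemma bext01 i x : pw_closed i x -> 0 <= bext f i x <= 1.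
Proof.
move=> cx; have H e : 0 < e -> -e <= bext f i x <= 1 + e.
  move=> /(bext_approx cx)[x' Ox [_]]; rewrite (bext_open Ox) ltr_norml => /andP[h1 h2].
  have /andP[p1 p2] := pw_open01 Ox.
  have /andP[h3 h4] : 0 <= f x' <= 1 by apply: pw_fun01; rewrite !ltW.
  by apply/andP; split; lra.
apply/andP; split.
  by apply/ler_addgt0Pr => e /H/andP[h _]; lra.
by apply/ler_addgt0Pr => e /H/andP[_ h]; lra.
Qed.

(** ['I_m * bool] indexes the one-sided limits at branch ends, [true] standing for the right end of
    the branch. *)
Definition send (s : 'I_m * bool) : R := if s.2 then pw_right f s.1 else pw_left f s.1.

Definition side_value s : R := bext f s.1 (send s).

Definition side_orbit s n : R := iter n f (side_value s).

Definition side_germ s (U : set R) := exists2 e : R, 0 < e &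
  forall w, (if s.2 then send s - e < w < send s else send s < w < send s + e) -> U w.

Lemma send_closed s : pw_closed s.1 (send s).
Proof.
rewrite /send /pw_closed; have h := ltW (pw_left_lt_right f s.1).
by case: s.2; rewrite lexx h.
Qed.

Definition generic := forall s n, ~ all_cuts f (side_orbit s n) /\
  forall s' n', side_orbit s n = side_orbit s' n' -> s = s' /\ n = n'.

End branch_extension.

(** Points at mutual distance at least [d] have different integer parts of [x / d], and these are
    bounded by that of [d^-1]. *)
Lemma separated_finite {R : realType} (d : R) (S : set R) : 0 < d ->
  (forall x, S x -> 0 <= x <= 1) -> (forall x y, S x -> S y -> x < y -> d <= y - x) ->
  finite_set S.
Proof.
move=> d0 S01 sep; pose h x := Num.truncn (x / d).
have hx x : S x -> (h x)%:R * d <= x < ((h x).+1)%:R * d.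
  move=> /S01/andP[x0 _].
  by rewrite -ler_pdivlMr// -ltr_pdivrMr//; apply: truncn_itv; rewrite divr_ge0// ltW.
have lt_h x y : S x -> S y -> x < y -> (h x < h y)%N.
  move=> Sx Sy xy; have := sep x y Sx Sy xy; have /andP[h1 h2] := hx x Sx.
  have /andP[h3 h4] := hx y Sy => dxy; rewrite ltnNge; apply/negP => hyx.
  have : ((h y).+1%:R : R) * d <= (h x).+1%:R * d by rewrite ler_wpM2r ?(ltW d0)// ler_nat.
  have E (n : nat) : (n.+1%:R : R) * d = n%:R * d + d by rewrite -natr1 mulrDl mul1r.
  by rewrite !E in h2 h4 *; lra.
apply: (@sub_finite_set _ _
  ((fun k => xget 0 [set x | S x /\ h x = k]) @` `I_(Num.truncn d^-1).+1)).
  move=> x Sx; exists (h x).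
    rewrite /= ltnS /h le_truncn// -[leRHS]mul1r ler_wpM2r ?invr_ge0 ?(ltW d0)//.
    by have /andP[] := S01 _ Sx.
  case: xgetP => [y _ [Sy E]|/(_ x)]; last by case.
  by have [/lt_h-/(_ Sy Sx)|/lt_h-/(_ Sx Sy)|//] := ltgtP y x; rewrite E ltnn.
exact/finite_image/finite_II.
Qed.

(** * Boundary points for families of measures permuted by the map *)

Section invariant_families.
Context {R : realType} {m : nat}.
Notation lam := (@lebesgue_measure R).
Notation T := (measurableTypeR R).
Variables (f : pwexp R m) (J : finType) (kappa : J -> J)
  (nu : J -> {finite_measure set T -> \bar R}).
Hypotheses (kappa_inj : injective kappa)
  (nul : forall t, nu t `<< lam)
  (nuK : forall t (A : set T), measurable A -> nu (kappa t) A = nu t (f @^-1` A))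
  (nu_full : forall t, nu t (~` goodset (nu t)) = 0%E).

Let U t : set R := goodset (nu t).

Let mU t : measurable (U t : set T). Proof. exact: measurable_goodset. Qed.

Let U_opn t : opn (U t). Proof. exact/open_opn/open_goodset. Qed.

Let U_image t i z : U t z -> pw_open f i z -> U (kappa t) (f z).
Proof.
move=> Uz Oz; apply: (goodset_image _ _ Uz Oz); last exact: nuK.
by move=> A B mA mB AB B0; apply: subset_measure0 B0.
Qed.

Let finite_nu0 t (S : set T) : finite_set S -> measurable S /\ nu t S = 0%E.
Proof.
move=> /finite_lam0[mS S0]; split => //.
by have /null_content_dominatesP := nul t; exact.
Qed.

Let fin_nu t (A : set T) : measurable A -> nu t A \is a fin_num.
Proof. by move=> mA; exact: fin_num_measure. Qed.

(* The sets [X n] decrease to the empty set, while by invariance their total mass does not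
   decrease. *)
Lemma shrinking_null (X : nat -> J -> set T) :
  (forall n t, measurable (X n t)) -> (forall n t, X n.+1 t `<=` X n t) ->
  (forall t z, (forall n, X n t z) -> False) ->
  (forall n t z, U t z -> ~ all_cuts f z -> X n (kappa t) (f z) -> X n.+1 t z) ->
  forall t, nu t (X 0%N t) = 0%E.
Proof.
move=> mX dX X0 pX t.
pose S n := \sum_t fine (nu t (X n t)).
have Sle n : S n <= S n.+1.
  (* After reindexing, the term of [t] is the mass of the preimage of [X n (kappa t)], which lies in
     [X n.+1 t] up to the null sets formed by the cuts and the complement of the core. *)
  rewrite /S (reindex_inj kappa_inj)/=; apply: ler_sum => {}t _.
  have mf : measurable (f @^-1` X n (kappa t) : set T) by exact: measurable_preimage_pw.
  apply: fine_le; [exact: fin_nu|exact: fin_nu|].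
  rewrite nuK//.
  have [mC C0] := finite_nu0 t (finite_all_cuts f).
  have -> : nu t (X n.+1 t) = (nu t (X n.+1 t) + (nu t (~` U t) + nu t (all_cuts f)))%E.
    by rewrite C0 nu_full !adde0.
  have mCU : measurable (~` U t : set T) by exact: measurableC.
  apply: (@le_trans _ _ (nu t (X n.+1 t `|` (~` U t `|` all_cuts f)))).
    apply: le_measure; rewrite ?inE//.
      by apply: measurableU => //; exact: measurableU.
    move=> z fz; have [Uz|] := pselect (U t z); last by right; left.
    have [cz|cz] := pselect (all_cuts f z); first by right; right.
    by left; exact: pX.
  apply: le_trans (measureU2 _ (mX _ _) (measurableU _ _ mCU mC)) _.
  by rewrite leeD2l// measureU2.
have S0n n : S 0%N <= S n by elim: n => // n IH; exact: le_trans (Sle n).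
have dXn t' n k : (n <= k)%N -> X k t' `<=` X n t'.
  move=> /subnK <-; elim: (k - n)%N => // j IH; rewrite addSn.
  exact: subset_trans (dX _ _) IH.
have cv t' : fine (nu t' (X n t')) @[n --> \oo] --> (0 : R).
  have h : nu t' (X n t') @[n --> \oo] --> nu t' (\bigcap_n X n t').
    apply: nonincreasing_cvg_mu => //.
    - by rewrite -ge0_fin_numE// fin_nu.
    - exact: bigcapT_measurable.
    - by move=> n k nk; apply/subsetPset; exact: dXn.
  rewrite (_ : \bigcap_n X n t' = set0) ?measure0 in h; last first.
    by apply/seteqP; split=> z // Hz; apply: (X0 t' z) => n; exact: Hz.
  exact: (fine_cvg h).
have : S n @[n --> \oo] --> (0 : R).
  rewrite (_ : 0 = \sum_(t : J) (0 : R)); last by rewrite big1.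
  by apply: cvg_big => [|t' _]; [exact: add_continuous|exact: cv].
move=> cS; have : S 0%N <= 0.
  rewrite -(cvg_lim _ cS)//; apply: limr_ge; first by apply/cvg_ex; exists 0.
  by near=> n; exact: S0n.
rewrite /S => H; have {}H : fine (nu t (X 0%N t)) <= 0.
  apply: le_trans H; rewrite (bigD1 t)//= lerDl sumr_ge0// => j _.
  by rewrite fine_ge0.
rewrite -(fineK (fin_nu _ (mX 0%N t))); congr EFin.
by apply/eqP; rewrite eq_le H fine_ge0.
Unshelve. all: by end_near. Qed.

Let long t (l : R) : set T := [set z | exists p q,
  [/\ p < z < q, (forall w, p < w < q -> U t w) & l <= q - p]].

Lemma measurable_long t l : measurable (long t l).
Proof.
apply: open_measurable; apply/open_opn => z [p [q [/andP[pz zq] H lpq]]].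
exists (Num.min (z - p) (q - z)); first by rewrite lt_min !subr_gt0 pz.
move=> y; rewrite lt_min !ltr_norml => /andP[/andP[h1 h2] /andP[h3 h4]].
by exists p, q; split => //; apply/andP; split; lra.
Qed.

Lemma goodset_pos t p q : p < q -> (forall w, p < w < q -> U t w) ->
  forall A : set T, measurable A -> (forall w, p < w < q -> A w) -> nu t A <> 0%E.
Proof.
move=> pq H A mA HA A0; pose z := (p + q) / 2.
have zpq : p < z < q by rewrite /z; apply/andP; split; lra.
have [a [b [a0 b1 /andP[az zb] G]]] := H z zpq; have /andP[pz zq] := zpq.
pose a' := Num.max a p; pose b' := Num.min b q.
have a'z : a' < z by rewrite gt_max az.
have zb' : z < b' by rewrite lt_min zb.
have G' : good (nu t) a' b'.
  by apply: goodS G; [rewrite le_max lexx|exact: lt_trans zb'|rewrite ge_min lexx].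
apply: (good_null G'); apply: subset_measure0 A0 => //.
move=> w /=; rewrite in_itv/= => /andP[h1 h2]; apply: HA.
move: h1 h2; rewrite gt_max lt_min => /andP[_ ->] /andP[_ ->]//.
Qed.

(** If the interval leaves the branch through an end, that cut lies in the core together with its
    [d]-neighbourhood; the interval can be stopped there and prolonged inside the branch to length
    at least [d], hence at least [l]. An interval within one branch is stretched by at least [s]. *)
Lemma expanding_step (s M L d l : R) t i z : pw_const f s M L ->
  (forall t' (k : 'I_m.+1), U t' (pw_cut f k) -> forall w, `|w - pw_cut f k| < d -> U t' w) ->
  (forall i', d <= pw_right f i' - pw_left f i') -> 0 < l -> l <= d ->
  long t l z -> pw_open f i z -> long (kappa t) (s * l) (f z).
Proof.
move=> HC cutd gapd l0 ld [p [q [/andP[pz zq] H lpq]]] Oz.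
have s0 : 0 < s by have := pwc_gt1 HC; lra.
have /andP[az zb] : pw_left f i < z < pw_right f i by move: Oz; rewrite /pw_open /= in_itv.
have gi := gapd i.
have [k1 [k2 [k1z zk2 [c1 c2] Hk lk]]] : exists k1 k2, [/\ k1 < z, z < k2,
    pw_closed f i k1 /\ pw_closed f i k2, (forall w, k1 < w < k2 -> U t w) & l <= k2 - k1].
  rewrite /pw_closed; have [pa|ap] := ltP p (pw_left f i).
    have Ua w : `|w - pw_left f i| < d -> U t w.
      by apply: cutd; apply: H; rewrite pa (lt_trans az).
    exists (pw_left f i), (Num.min (pw_right f i) (Num.max q (pw_left f i + d))).
    have e1 : z < Num.min (pw_right f i) (Num.max q (pw_left f i + d)).
      by rewrite lt_min zb lt_max zq.
    have e2 : pw_left f i + d <= Num.min (pw_right f i) (Num.max q (pw_left f i + d)).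
      by rewrite le_min le_max lexx orbT andbT; lra.
    split => //; last by lra.
    - split; first by rewrite lexx ltW// (lt_trans az).
      apply/andP; split; last by rewrite ge_min lexx.
      by apply: le_trans e2; rewrite lerDl; apply: le_trans ld; exact: ltW.
    - move=> w /andP[aw]; rewrite lt_min lt_max => /andP[_ /orP[wq|wd]].
        by apply: H; rewrite (lt_trans pa aw).
      by apply: Ua; rewrite gtr0_norm ?subr_gt0//; lra.
  have [bq|qb] := ltP (pw_right f i) q.
    have Ub w : `|w - pw_right f i| < d -> U t w.
      by apply: cutd; apply: H; rewrite bq (lt_trans pz).
    exists (Num.min p (pw_right f i - d)), (pw_right f i).
    have e1 : Num.min p (pw_right f i - d) < z by rewrite gt_min pz.
    have e2 : Num.min p (pw_right f i - d) <= pw_right f i - d by rewrite ge_min lexx orbT.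
    split => //; last by lra.
    - split; apply/andP; split; [by rewrite le_min ap; lra|lra|lra|exact: lexx].
    - move=> w /andP[]; rewrite gt_min => /orP[pw|wd] wb.
        by apply: H; rewrite pw (lt_trans wb).
      by apply: Ub; rewrite ltr0_norm ?subr_lt0//; lra.
  by exists p, q; split => //; split; apply/andP; split => //; lra.
have bz := bext_open Oz.
have imgU v : btw (bext f i k1) v (bext f i k2) -> U (kappa t) v.
  move=> /(bext_IVT c1 c2)[w wk Ew].
  have wk' : k1 < w < k2.
    by move: wk => /orP[//|/andP[h1 h2]]; have := lt_trans h1 h2; lra.
  have Ow : pw_open f i w.
    move: c1 c2 wk'; rewrite /pw_open /pw_closed /= in_itv/=.
    by move=> /andP[h1 _] /andP[_ h2] /andP[h3 h4]; apply/andP; split; lra.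
  by rewrite -Ew (bext_open Ow); apply: (U_image _ Ow); exact: Hk.
have zk : btw k1 z k2 by rewrite /btw k1z zk2.
have := bext_btw c1 c2 zk; rewrite bz => zk'.
have /andP[ex _] := bext_lip HC c1 c2.
have k12 : k1 < k2 by exact: lt_trans zk2.
have sl : s * l <= `|bext f i k1 - bext f i k2|.
  apply: le_trans ex; rewrite ler_wpM2l ?(ltW s0)// distrC gtr0_norm ?subr_gt0//.
move: zk' => /orP[/andP[h1 h2]|/andP[h1 h2]].
  exists (bext f i k1), (bext f i k2); split; [by rewrite h1|by move=> w hw; apply: imgU; rewrite /btw hw|].
  by apply: (le_trans sl); rewrite distrC gtr0_norm ?subr_gt0//; exact: lt_trans h2.
exists (bext f i k2), (bext f i k1); split; [by rewrite h1|by move=> w hw; apply: imgU; rewrite /btw hw orbT|].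
by apply: (le_trans sl); rewrite gtr0_norm ?subr_gt0//; exact: lt_trans h2.
Qed.

(** [d] is at most the branch lengths and a radius valid at every cut in a core. Core points outside
    [long t (d * s ^- n)] disappear as [n] grows, since the core is open, and [expanding_step] shows
    that they pull back as [shrinking_null] requires. So components shorter than [d] have mass 0,
    impossible for a nonempty open part of the core. *)
Lemma goodset_long : exists2 d : R, 0 < d & forall t, U t `<=` long t d.
Proof.
have [s [M [L HC]]] := pw_consts f; have s1 := pwc_gt1 HC; have s0 : 0 < s by lra.
have rex (tk : J * 'I_m.+1) : exists r : R, 0 < r /\ (U tk.1 (pw_cut f tk.2) ->
    forall w, `|w - pw_cut f tk.2| < r -> U tk.1 w).
  case: tk => t k /=; have [Uk|nUk] := pselect (U t (pw_cut f k)); last by exists 1.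
  by have [e e0 He] := U_opn Uk; exists e.
have [r Hr] := choice rex.
have [d1 d10 Hd1] := @fin_pos_lb _ _ r (fun tk => (Hr tk).1).
have [d2 d20 Hd2] := @fin_pos_lb R _ (fun i : 'I_m => pw_right f i - pw_left f i)
  (fun i => etrans (subr_gt0 _ _) (pw_left_lt_right f i)).
pose d := Num.min d1 d2; have d0 : 0 < d by rewrite lt_min d10.
have dd1 : d <= d1 by rewrite ge_min lexx.
have dd2 : d <= d2 by rewrite ge_min lexx orbT.
have step l t i z := @expanding_step s M L d l t i z HC.
have cutd t' (k : 'I_m.+1) : U t' (pw_cut f k) -> forall w, `|w - pw_cut f k| < d -> U t' w.
  move=> Uk w wd; have [_ /(_ Uk w)] := Hr (t', k); apply.
  by apply: (lt_le_trans wd); apply: le_trans (Hd1 (t', k)).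
have gapd i : d <= pw_right f i - pw_left f i by exact: le_trans (Hd2 i).
have sn n : 0 < s ^- n by rewrite invr_gt0 exprn_gt0.
have sn1 n : s ^- n <= 1 by rewrite invf_le1 ?exprn_gt0// exprn_ege1// ltW.
have z01 t z : U t z -> 0 <= z <= 1 by move=> /goodset01/andP[? ?]; rewrite !ltW.
have N0 : forall t, nu t (U t `\` long t (d * s ^- 0)) = 0%E.
  apply: (shrinking_null (X := fun n t => U t `\` long t (d * s ^- n))).
  - by move=> n t; apply: measurableD => //; exact: measurable_long.
  - move=> n t z [Uz nl]; split => // -[p [q [pzq H lpq]]]; apply: nl.
    exists p, q; split => //; apply: le_trans lpq; rewrite ler_wpM2l ?(ltW d0)//.
    by rewrite lef_pV2 ?posrE ?exprn_gt0// exprS ler_peMl// ltW// exprn_gt0.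
  - move=> t z Hz; have [Uz _] := Hz 0%N.
    have [e e0 He] := U_opn Uz.
    have th1 : `|s^-1| < 1 by rewrite ger0_norm ?invr_ge0 ?(ltW s0)// invf_lt1.
    have ed : 0 < e / d by rewrite divr_gt0.
    have /(@cvgrPdist_le R R)/(_ _ ed)[n _ Hn] := @cvg_expr R s^-1 th1.
    have [_] := Hz n; apply; exists (z - e), (z + e); split.
    + by apply/andP; split; lra.
    + by move=> w /andP[h1 h2]; apply: He; rewrite ltr_norml; apply/andP; split; lra.
    have := Hn n (leqnn n); rewrite /= sub0r normrN ger0_norm ?exprn_ge0 ?invr_ge0 ?(ltW s0)//.
    by rewrite exprVn ler_pdivlMr// mulrC => h; apply: (le_trans h); lra.
  - move=> n t z Uz nc [Uf nl]; split => // lz; apply: nl.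
    have [i Oz] := noncut_open (z01 _ _ Uz) nc.
    have := step _ _ i _ cutd gapd (mulr_gt0 d0 (sn n.+1)) _ lz Oz.
    have -> : s * (d * s ^- n.+1) = d * s ^- n.
      by rewrite exprS; field; rewrite !gt_eqF// exprn_gt0.
    by apply; rewrite ler_piMr// ltW.
exists d => // t z Uz; apply: contrapT => nl.
have [p [q [a0 b1 /andP[pz zq] G]]] := Uz.
have pq := lt_trans pz zq.
have Upq w : p < w < q -> U t w by move=> h; apply: (good_goodset a0 b1 G); rewrite /= in_itv.
have := N0 t; rewrite expr0 invr1 mulr1; apply: (goodset_pos pq Upq).
  by apply: measurableD => //; exact: measurable_long.
move=> w wpq; split; first exact: Upq.
move=> [p' [q' [/andP[pw wq] H lpq]]]; apply: nl.
have /andP[pw' wq'] := wpq.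
exists (Num.min p p'), (Num.max q q'); split.
- by rewrite gt_min pz lt_max zq.
- move=> v /andP[]; rewrite gt_min lt_max.
  have [vw|wv] := ltP v w.
    move=> /orP[pv|pv] _; [apply: Upq|apply: H]; rewrite pv; lra.
  move=> _ /orP[vq|vq]; [apply: Upq|apply: H]; rewrite vq andbT; lra.
- have : Num.min p p' <= p' by rewrite ge_min lexx orbT.
  have : q' <= Num.max q q' by rewrite le_max lexx orbT.
  lra.
Qed.

(** Core points near [x] lie in intervals of length at least [d] within the core, and these cannot
    contain [x]. *)
Lemma bd_side (d : R) t x : U t `<=` long t d -> bd (U t) x ->
  (forall w, x < w < x + d -> U t w) \/ (forall w, x - d < w < x -> U t w).
Proof.
move=> Ud [nUx bx]; apply: contrapT => /not_orP[/existsNP[w1 /not_implyP[/andP[xw1 w1d] n1]]].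
move=> /existsNP[w2 /not_implyP[/andP[w2d xw2] n2]].
have [|y Uy] := bx (Num.min (w1 - x) (x - w2)); first by rewrite lt_min !subr_gt0 xw1.
rewrite lt_min !ltr_norml => /andP[/andP[_ yw1] /andP[yw2 _]].
have [p [q [/andP[py yq] H dpq]]] := Ud _ Uy.
have [yx|xy|E] := ltgtP y x; last by rewrite -E in nUx.
- apply: n2; apply: (H); apply/andP; split; last by lra.
  have [qx|xq] := leP q x; first by lra.
  by exfalso; apply: nUx; apply: H; rewrite xq (lt_trans py).
- apply: n1; apply: (H); apply/andP; split; first by lra.
  have [xp|px] := leP x p; first by lra.
  by exfalso; apply: nUx; apply: H; rewrite px (lt_trans xy).
Qed.

(** Two boundary points whose right neighbourhoods of length [d] fill the core are at least [d]
    apart; the same holds on the left. *)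
Lemma finite_bd t : finite_set (bd (U t)).
Proof.
have [d d0 Ud] := goodset_long.
have bd01 x : bd (U t) x -> 0 <= x <= 1.
  move=> [_ bx]; apply/andP; split; apply/ler_addgt0Pr => e /bx[y /goodset01/andP[y0 y1]];
    by rewrite ltr_norml => /andP[h1 h2]; lra.
apply: (@sub_finite_set _ _ ((bd (U t) `&` [set x | forall w, x < w < x + d -> U t w]) `|`
  (bd (U t) `&` [set x | forall w, x - d < w < x -> U t w]))).
  by move=> x bx; have [h|h] := bd_side (Ud t) bx; [left|right].
rewrite finite_setU; split; apply: (separated_finite d0).
- by move=> x [/bd01].
- move=> x y [_ Hx] [[nUy _] _] xy; apply: contra_notP nUy => /negP; rewrite -ltNge => yx.
  by apply: Hx; apply/andP; split; lra.
- by move=> x [/bd01].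
- move=> x y [[nUx _] _] [_ Hy] xy; apply: contra_notP nUx => /negP; rewrite -ltNge => yx.
  by apply: Hy; apply/andP; split; lra.
Qed.

(** The exponent is [n.+1] because [side_value] is already one step away from the end, where the
    germ lives. *)
Definition arises_at_end t x := exists s n t',
  [/\ iter n.+1 kappa t' = t, side_germ f s (U t') & x = side_orbit f s n].

Lemma arises_at_end_image t x : arises_at_end t x -> arises_at_end (kappa t) (f x).
Proof.
move=> [s [n [t' [E G ->]]]]; exists s, n.+1, t'; split => //=.
by rewrite -E.
Qed.

(** The closed branch covers the segment between its two end values, so going from [f w] to a missed
    point [x] crosses one of them. *)
Lemma outside_image i w x : pw_open f i w ->
  (forall y, pw_closed f i y -> bext f i y <> x) -> x != f w ->
  exists b, btw x (side_value f (i, b)) (f w).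
Proof.
move=> Ow nx xw; have cw := pw_open_closed Ow.
have bw := bext_open Ow.
have cs b : pw_closed f i (send f (i, b)) by exact: (send_closed f (i, b)).
have ends : exists b, (x < f w -> side_value f (i, b) < f w) /\ (f w < x -> f w < side_value f (i, b)).
  have /andP[aw wb] : pw_left f i < w < pw_right f i by move: Ow; rewrite /pw_open /= in_itv.
  have [xw'|xw'] := boolP (x < f w).
    have [H|H] := bext_monotone f i.
      exists false; split; last by move=> h; have := lt_trans h xw'; rewrite ltxx.
      by move=> _; rewrite -bw; exact: (H _ _ (cs false) cw aw).
    exists true; split; last by move=> h; have := lt_trans h xw'; rewrite ltxx.
    by move=> _; rewrite -bw; exact: (H _ _ cw (cs true) wb).
  have [H|H] := bext_monotone f i.
    exists true; split => // _.
    by rewrite -bw; exact: (H _ _ cw (cs true) wb).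
  exists false; split => // _.
  by rewrite -bw; exact: (H _ _ (cs false) cw aw).
have [b [H1 H2]] := ends; exists b; rewrite /btw.
have nv : side_value f (i, b) <> x := nx _ (cs b).
have IVT' : ~ btw (bext f i (send f (i, b))) x (bext f i w).
  move=> /(bext_IVT (cs b) cw)[v /orP[|] /andP[h1 h2]]; apply: nx; move: cw (cs b);
    by rewrite /pw_closed => /andP[h3 h4] /andP[h5 h6]; apply/andP; split; lra.
have [xw'|wx|E] := ltgtP x (f w); last by rewrite E eqxx in xw.
- rewrite (H1 xw') /= andbT; apply/orP; left.
  have [//|vx|//] := ltgtP x (side_value f (i, b)).
    by exfalso; apply: IVT'; rewrite bw /btw xw' [bext _ _ _ < _]vx.
  by move=> E; case: nv.
- rewrite (H2 wx) /=; apply/orP; right.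
  have [//|xv|//] := ltgtP (side_value f (i, b)) x.
    by exfalso; apply: IVT'; rewrite bw /btw wx [_ < bext _ _ _]xv orbT.
Qed.

(** Neighbourhoods of counterexamples are pulled back. [N n t] collects the core points joined
    within the core to a counterexample at distance below [e0 * s ^- n]. Preimages of [N n] lie in
    [N n.+1] up to cuts and non-core points, and these sets shrink to nothing, so [N 0] is null; yet
    [bd_side] puts an interval into it. *)
Lemma bd_arises t x : bd (U t) x -> arises_at_end t x.
Proof.
have [s [M [L HC]]] := pw_consts f; have s1 := pwc_gt1 HC; have s0 : 0 < s by lra.
have [d d0 Ud] := goodset_long.
(* All points that could disturb the pull-back: boundary points, their images, and the branch end
   values. The gap [e0] keeps distinct ones apart. *)
pose Z := (\bigcup_(t in [set: J]) bd (U t)) `|` (f @` (\bigcup_(t in [set: J]) bd (U t)))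
  `|` range (side_value f).
have fbd : finite_set (\bigcup_(t in [set: J]) bd (U t)).
  by apply: bigcup_finite => // t' _; exact: finite_bd.
have /finite_set_gap[e0 e00 gap] : finite_set Z.
  rewrite /Z !finite_setU; split; last exact: finite_image.
  by split => //; exact: finite_image.
pose B t x := bd (U t) x /\ ~ arises_at_end t x.
pose N n t : set T := [set z | U t z /\ exists x,
  [/\ B t x, `|z - x| < e0 * s ^- n & forall w, btw x w z -> U t w]].
have sn n : 0 < s ^- n by rewrite invr_gt0 exprn_gt0.
have sn1 n : s ^- n <= 1 by rewrite invf_le1 ?exprn_gt0// exprn_ege1// ltW.
have mN n t' : measurable (N n t').
  apply: open_measurable; apply/open_opn => z [Uz [y [By zy H]]].
  have [e e_0 He] := U_opn Uz.
  have zny : z != y by apply/eqP => E; case: By => -[+ _] _; rewrite -E.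
  have zy0 : 0 < `|z - y| by rewrite normr_gt0 subr_eq0.
  exists (Num.min e (Num.min (e0 * s ^- n - `|z - y|) `|z - y|)).
    by rewrite !lt_min e_0 subr_gt0 zy zy0.
  move=> v; rewrite !lt_min => /andP[ve /andP[v1 v2]]; split; first exact: He.
  exists y; split => //.
    have -> : v - y = (v - z) + (z - y) by ring.
    by apply: le_lt_trans (ler_normD _ _) _; lra.
  move=> w bw; have [bz|nbz] := boolP (btw y w z); first exact: H.
  apply: He; apply: le_lt_trans ve.
  move: nbz bw v2; rewrite /btw; have [yz|yz|E] := ltgtP y z; last by rewrite E eqxx in zny.
    rewrite (@gtr0_norm _ (z - y)) ?subr_gt0// => nb bw; rewrite ltr_norml => /andP[h1 h2].
    move: bw => /orP[|] /andP[h3 h4]; last by lra.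
    move: nb; rewrite h3 /= negb_or -leNgt => /andP[zw _].
    by rewrite !ger0_norm ?subr_ge0//; lra.
  rewrite (@ltr0_norm _ (z - y)) ?subr_lt0// => nb bw; rewrite ltr_norml => /andP[h1 h2].
  move: bw => /orP[|] /andP[h3 h4]; first by lra.
  move: nb; rewrite h4 andbT negb_or -!leNgt => /andP[_ zw].
  by rewrite !ler0_norm ?subr_le0//; lra.
have N0 : forall t, nu t (N 0%N t) = 0%E.
  apply: shrinking_null => //.
  - move=> n t' z [Uz [y [By zy H]]]; split => //; exists y; split => //.
    apply: lt_le_trans zy _; rewrite ler_wpM2l ?(ltW e00)//.
    by rewrite lef_pV2 ?posrE ?exprn_gt0// exprS ler_peMl// ltW// exprn_gt0.
  - move=> t' z Hz; have [Uz _] := Hz 0%N.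
    have [e e_0 He] := U_opn Uz.
    have th1 : `|s^-1| < 1 by rewrite ger0_norm ?invr_ge0 ?(ltW s0)// invf_lt1.
    have ed : 0 < e / e0 by rewrite divr_gt0.
    have /(@cvgrPdist_le R R)/(_ _ ed)[n _ Hn] := @cvg_expr R s^-1 th1.
    have [_ [y [[[nUy _] _] zy _]]] := Hz n; apply: nUy; apply: He.
    rewrite distrC; apply: (lt_le_trans zy).
    have := Hn n (leqnn n); rewrite /= sub0r normrN ger0_norm ?exprn_ge0 ?invr_ge0 ?(ltW s0)//.
    by rewrite exprVn ler_pdivlMr// mulrC.
  - move=> n t' w0 Uw nc [Uz [y0 [[by0 na] zx H]]].
    have w01 : 0 <= w0 <= 1 by have /andP[h1 h2] := goodset01 Uw; rewrite !ltW.
    have [i Ow] := noncut_open w01 nc; have cw := pw_open_closed Ow; have bw := bext_open Ow.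
    have zx0 : `|f w0 - y0| < e0.
      by apply: (lt_le_trans zx); rewrite ler_piMr ?(ltW e00).
    have Zy0 : Z y0 by left; left; exists (kappa t').
    (* If the closed branch misses [y0], an end value lies strictly between [y0] and [f w0], too
       close to [y0] to differ from it. *)
    have [[y [cy Ey]]|nx] := pselect (exists y, pw_closed f i y /\ bext f i y = y0); last first.
      have [||b Hb] := outside_image (x := y0) Ow.
      + by move=> y cy E; apply: nx; exists y.
      + by apply/eqP => E; case: by0 => + _; rewrite E.
      have [b1 b2 b3] := btw_norm Hb.
      have E := gap (side_value f (i, b)) y0 _ Zy0 (lt_trans b1 zx0).
      by move: b3; rewrite E ?eqxx//; right; exists (i, b).
    (* A hole in the core between [y] and [w0] would contain a boundary point whose image is too
       close to [y0]. *)
    have Hy w : btw y w w0 -> U t' w.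
      move=> bww; apply: contrapT => nUw.
      have [y' bdy' Hy'] := bd_between (U_opn (t := t')) Uw nUw.
      have by' : btw y y' w0.
        case: Hy' => [->//|]; rewrite /btw => /orP[|] /andP[h1 h2];
        by move: bww => /orP[|] /andP[h3 h4]; apply/orP; ((by left; apply/andP; split; lra) || (by right; apply/andP; split; lra)).
      have Oy' : pw_open f i y'.
        move: cy Ow; rewrite /pw_open /= in_itv/= => /andP[h1 h2] /andP[h3 h4].
        move: by' => /orP[|] /andP[h5 h6].
          by apply/andP; split; [exact: le_lt_trans h1 h5|exact: lt_trans h6 h4].
        by apply/andP; split; [exact: lt_trans h3 h5|exact: lt_le_trans h6 h2].
      have := bext_btw cy cw by'; rewrite Ey bw (bext_open Oy') => /btw_norm[b1 b2 b3].
      have E := gap (f y') y0 _ Zy0 (lt_trans b1 zx0).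
      by move: b3; rewrite E ?eqxx//; left; right; exists y' => //; exists t'.
    have wy : w0 != y.
      by apply/eqP => E; case: by0 => + _; rewrite -Ey -E bw.
    (* If [y] is inside the branch, it is again a counterexample, at a distance smaller by the
       factor [s]. If [y] is an end, the core fills the branch side of [y], so [y0] arises there at
       time 0. *)
    have [Oy|nOy] := pselect (pw_open f i y).
      split => //; have fy : f y = y0 by rewrite -(bext_open Oy).
      exists y; split => //; last first.
        have /andP[+ _] := bext_lip HC cw cy; rewrite Ey bw => h.
        rewrite exprS invfM mulrCA ltr_pdivlMl//.
        exact: (le_lt_trans h).
      split; last by move=> /arises_at_end_image; rewrite fy.
      split; first by move=> /U_image/(_ Oy); rewrite fy; case: by0.
      move=> e e_0; have [yw|yw|E] := ltgtP y w0; last by rewrite E eqxx in wy.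
        exists (y + Num.min (e / 2) ((w0 - y) / 2)).
          apply: Hy; apply/orP; left; rewrite ltrDl lt_min !divr_gt0 ?subr_gt0//=.
          have : Num.min (e / 2) ((w0 - y) / 2) <= (w0 - y) / 2 by rewrite ge_min lexx orbT.
          by lra.
        rewrite addrAC subrr add0r gtr0_norm; last by rewrite lt_min !divr_gt0 ?subr_gt0.
        by rewrite gt_min; apply/orP; left; lra.
      exists (y - Num.min (e / 2) ((y - w0) / 2)).
        apply: Hy; apply/orP; right; rewrite gtrDl oppr_lt0 lt_min !divr_gt0 ?subr_gt0//= andbT.
        have : Num.min (e / 2) ((y - w0) / 2) <= (y - w0) / 2 by rewrite ge_min lexx orbT.
        by lra.
      rewrite addrAC subrr add0r normrN gtr0_norm; last by rewrite lt_min !divr_gt0 ?subr_gt0.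
      by rewrite gt_min; apply/orP; left; lra.
    exfalso; apply: na.
    have [b Eb] : exists b, y = send f (i, b).
      move: cy nOy; rewrite /pw_closed /pw_open /= in_itv/= !le_eqVlt.
      move=> /andP[/predU1P[E _ _|h1]]; first by exists false; rewrite /send /= E.
      by move=> /predU1P[E _|h2]; [exists true|rewrite h1 h2].
    exists (i, b), 0%N, t'; split => //; last by rewrite /side_orbit /= /side_value /= -Eb Ey.
    have /andP[aw wb] : pw_left f i < w0 < pw_right f i by move: Ow; rewrite /pw_open /= in_itv.
    exists `|w0 - y|; first by rewrite normr_gt0 subr_eq0.
    move=> w; rewrite -Eb; move: Eb; rewrite /send /=; case: (b) => E.
      rewrite ltr0_norm ?subr_lt0 ?E// => /andP[h1 h2].
      by apply: Hy; apply/orP; right; rewrite E h2 andbT; lra.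
    rewrite gtr0_norm ?subr_gt0 ?E// => /andP[h1 h2].
    by apply: Hy; apply/orP; left; rewrite E h1 /=; lra.
move=> bx; apply: contrapT => na; have Bx : B t x by [].
have de : 0 < Num.min d e0 by rewrite lt_min d0.
have [Hd|Hd] := bd_side (Ud t) bx.
  have HU w : x < w < x + Num.min d e0 -> U t w.
    move=> /andP[h1 h2]; apply: Hd; rewrite h1 (lt_le_trans h2)// lerD2l.
    by rewrite ge_min lexx.
  apply: (goodset_pos _ HU (mN 0%N t)); [by rewrite ltrDl|move=> w /[dup] h /andP[h1 h2]|exact: N0].
  split; first exact: HU.
  exists x; split => //.
    rewrite gtr0_norm ?subr_gt0// expr0 invr1 mulr1 ltrBlDl (lt_le_trans h2)// lerD2l.
    by rewrite ge_min lexx orbT.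
  by move=> v /orP[|] /andP[h3 h4]; apply: HU; apply/andP; split; lra.
have HU w : x - Num.min d e0 < w < x -> U t w.
  move=> /andP[h1 h2]; apply: Hd; rewrite h2 andbT (le_lt_trans _ h1)// lerD2l lerN2.
  by rewrite ge_min lexx.
apply: (goodset_pos _ HU (mN 0%N t)); [by rewrite gtrDl oppr_lt0|move=> w /[dup] h /andP[h1 h2]|exact: N0].
split; first exact: HU.
exists x; split => //.
  rewrite ltr0_norm ?subr_lt0// expr0 invr1 mulr1.
  have : Num.min d e0 <= e0 by rewrite ge_min lexx orbT.
  by lra.
by move=> v /orP[|] /andP[h3 h4]; apply: HU; apply/andP; split; lra.
Qed.

End invariant_families.

(** * Generic maps satisfy the separation condition *)

Section mutually_singular.
Context d (T : measurableType d) (R : realType).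
Variables (mu nu : probability T R) (g : T -> T).
Hypotheses (mg : measurable_fun setT g)
  (mug : forall A, measurable A -> mu (g @^-1` A) = mu A)
  (nug : forall A, measurable A -> nu (g @^-1` A) = nu A)
  (mu01 : forall A, measurable A -> g @^-1` A = A -> mu A = 0%E \/ mu A = 1%E)
  (nu01 : forall A, measurable A -> g @^-1` A = A -> nu A = 0%E \/ nu A = 1%E).

Let a (A : set T) : R := fine (mu A) - fine (nu A).

Let fin (P : probability T R) A : measurable A -> P A \is a fin_num.
Proof. by move=> mA; exact: fin_num_measure. Qed.

Let mgA A : measurable A -> measurable (g @^-1` A).
Proof. by move=> mA; rewrite -[X in measurable X]setTI; exact: mg. Qed.

Let fineU (P : probability T R) A B : measurable A -> measurable B ->
  fine (P (A `|` B)) + fine (P (A `&` B)) = fine (P A) + fine (P B).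
Proof.
move=> mA mB; have mI := measurableI _ _ mA mB.
rewrite measureUfinl//; last by rewrite ltey_eq fin.
have fA := fin P mA; have fB := fin P mB; have fI := fin P mI.
by rewrite fineB ?fin_numD ?fA ?fB// fineD// subrK.
Qed.

Let aU A B : measurable A -> measurable B -> a (A `|` B) + a (A `&` B) = a A + a B.
Proof.
move=> mA mB; have := fineU mu mA mB; have := fineU nu mA mB; rewrite /a; lra.
Qed.

Let hahn : exists2 P, measurable P & forall A, measurable A -> a A <= a P.
Proof.
have [P [N [[mP posP] [mN negN] PN PN0]]] :=
  Hahn_decomposition (cadd (charge_of_finite_measure mu) (copp (charge_of_finite_measure nu))).
have aE A : measurable A -> cadd (charge_of_finite_measure mu)
    (copp (charge_of_finite_measure nu)) A = (a A)%:E.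
  move=> mA; rewrite /cadd/= /copp/= /charge_of_finite_measure/=.
  by rewrite -(fineK (fin mu mA)) -(fineK (fin nu mA)).
have aD0 A B : measurable A -> measurable B -> a A = a (A `&` B) + a (A `\` B).
  move=> mA mB; have mI := measurableI _ _ mA mB; have mD := measurableD mA mB.
  have := aU mI mD; rewrite setUIDK (_ : _ `&` _ = set0).
    by rewrite {2}/a !measure0 /= subrr addr0.
  by apply/seteqP; split => x // [[_ Bx] [_ /(_ Bx)]].
exists P => // A mA; rewrite (aD0 A P)// (aD0 P A)// (setIC A).
have mD := measurableD mA mP; have mD' := measurableD mP mA.
have h1 : a (A `\` P) <= 0.
  rewrite -lee_fin -aE//; apply: negN => // x [_ nPx].
  by have [//|//] : (P `|` N) x by rewrite PN.
have h2 : 0 <= a (P `\` A) by rewrite -lee_fin -aE//; apply: posP => // x [].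
lra.
Qed.

Let fine_cvg_up (P : probability T R) (F : (set T)^nat) : (forall n, measurable (F n)) ->
  nondecreasing_seq F -> fine (P (F n)) @[n --> \oo] --> fine (P (\bigcup_n F n)).
Proof.
move=> mF nF; apply: fine_cvg; rewrite fineK; last by apply: fin; exact: bigcupT_measurable.
by apply: nondecreasing_cvg_mu => //; exact: bigcupT_measurable.
Qed.

Let fine_cvg_down (P : probability T R) (F : (set T)^nat) : (forall n, measurable (F n)) ->
  nonincreasing_seq F -> fine (P (F n)) @[n --> \oo] --> fine (P (\bigcap_n F n)).
Proof.
move=> mF nF; apply: fine_cvg; rewrite fineK; last by apply: fin; exact: bigcapT_measurable.
apply: nonincreasing_cvg_mu => //; last exact: bigcapT_measurable.
by rewrite ltey_eq fin.
Qed.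

(* The sets maximizing [mu - nu] form a lattice closed under preimages and monotone limits,
   so the limsup of the preimages of a Hahn set is an invariant maximizer. *)
Lemma mutually_singular : (exists2 A, measurable A & mu A <> nu A) ->
  exists A, [/\ measurable A, mu A = 1%E & nu A = 0%E].
Proof.
move=> [A0 mA0 A0ne]; have [P mP maxP] := hahn.
have aP0 : 0 < a P.
  rewrite lt_neqAle; apply/andP; split; last first.
    by have := maxP _ measurable0; rewrite {1}/a !measure0 subrr.
  apply/eqP => E; apply: A0ne.
  (* The values of [a] on [A0] and on its complement are opposite, so a maximum 0 would force
     [mu A0 = nu A0]. *)
  have h1 := maxP _ mA0; have h2 := maxP _ (measurableC mA0).
  have fC (Q : probability T R) : fine (Q (~` A0)) = 1 - fine (Q A0).
    by rewrite probability_setC// -(fineK (fin Q mA0)).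
  rewrite -(fineK (fin mu mA0)) -(fineK (fin nu mA0)); congr EFin.
  by move: h1 h2; rewrite -E /a !fC; lra.
pose mx A := measurable A /\ a A = a P.
have mxU A B : mx A -> mx B -> mx (A `|` B).
  move=> [mA EA] [mB EB]; have mI := measurableI _ _ mA mB; have mU := measurableU _ _ mA mB.
  by split => //; have := aU mA mB; have := maxP _ mI; have := maxP _ mU; lra.
have mxg A : mx A -> mx (g @^-1` A).
  by move=> [mA EA]; split; [exact: mgA|rewrite /a mug// nug].
(* [H n], built from the finite unions [G n k], is the union of the preimages of order at least [n];
   the intersection of all [H n] is their limsup, which equals its own preimage. *)
pose F n := iter n (fun A => g @^-1` A) P.
have Fmx n : mx (F n) by elim: n => [|n IH]; [|exact: mxg].
pose G n k := [set x | exists2 j, (j < k.+1)%N & F (n + j)%N x].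
have Gmx n k : mx (G n k).
  elim: k => [|k IH].
    rewrite (_ : G n 0%N = F n)//; apply/seteqP; split=> x.
      by move=> [[|//] _]; rewrite addn0.
    by exists 0%N => //; rewrite addn0.
  rewrite (_ : G n k.+1 = G n k `|` F (n + k.+1)%N); first exact: mxU.
  apply/seteqP; split=> x.
    move=> [j]; rewrite ltnS leq_eqVlt => /predU1P[->|jk] Fx; first by right.
    by left; exists j.
  by move=> [[j jk Fx]|Fx]; [exists j => //; exact: ltnW|exists k.+1].
have GS n k x : G n k x <-> exists2 j, (j < k.+1)%N & F (n + j)%N x by [].
pose H n := \bigcup_k G n k.
have Hmx n : mx (H n).
  have mH : measurable (H n) by apply: bigcupT_measurable => k; case: (Gmx n k).
  split => //.
  have nd : nondecreasing_seq (G n).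
    move=> k l kl; apply/subsetPset => x /GS[j jk Fx]; apply/GS; exists j => //.
    exact: (leq_trans jk).
  have mG k : measurable (G n k) by case: (Gmx n k).
  have c : a (G n k) @[k --> \oo] --> a (H n).
    by apply: cvgB; exact: fine_cvg_up.
  have E : a (G n k) @[k --> \oo] --> a P.
    rewrite (_ : (fun k => a (G n k)) = fun=> a P); first exact: cvg_cst.
    by apply/funext => k; case: (Gmx n k).
  exact: (cvg_unique _ c E).
have HS n x : H n x <-> exists2 j, (n <= j)%N & F j x.
  split=> [[k _ /GS[j _ Fx]]|[j nj Fx]]; first by exists (n + j)%N => //; exact: leq_addr.
  by exists (j - n)%N => //; apply/GS; exists (j - n)%N => //; rewrite subnKC.
pose A := \bigcap_n H n.
have mH n : measurable (H n) by case: (Hmx n).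
have mA : measurable A by exact: bigcapT_measurable.
have aA : a A = a P.
  have ni : nonincreasing_seq H.
    move=> k l kl; apply/subsetPset => x /HS[j lj Fx]; apply/HS; exists j => //.
    exact: leq_trans lj.
  have c : a (H n) @[n --> \oo] --> a A by apply: cvgB; exact: fine_cvg_down.
  have E : a (H n) @[n --> \oo] --> a P.
    rewrite (_ : (fun k => a (H k)) = fun=> a P); first exact: cvg_cst.
    by apply/funext => k; case: (Hmx k).
  exact: (cvg_unique _ c E).
have gA : g @^-1` A = A.
  apply/seteqP; split => x Ax n _; apply/HS.
    have /HS[j nj Fx] := Ax n Logic.I.
    by exists j.+1 => //; exact: (leq_trans nj).
  have /HS[[//|j] nj Fx] := Ax n.+1 Logic.I.
  by exists j.
exists A; split => //.
  have [E|//] := mu01 mA gA; have := aA; rewrite /a -/(a P) E sub0r => h.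
  have : 0 <= fine (nu A) by rewrite fine_ge0.
  by rewrite -oppr_le0 h leNgt aP0.
have [//|E] := nu01 mA gA; have := aA; rewrite /a -/(a P) E /= => h.
have : fine (mu A) <= 1 by rewrite -lee_fin fineK ?fin// probability_le1.
by rewrite -subr_le0 h leNgt aP0.
Qed.

End mutually_singular.

Section generic_families.
Context {R : realType} {m : nat}.
Notation lam := (@lebesgue_measure R).
Notation T := (measurableTypeR R).
Variables (f : pwexp R m) (J : finType) (kappa : J -> J)
  (nu : J -> {finite_measure set T -> \bar R}).
Hypotheses (gen : generic f) (kappa_inj : injective kappa)
  (nul : forall t, nu t `<< lam)
  (nuK : forall t (A : set T), measurable A -> nu (kappa t) A = nu t (f @^-1` A))
  (nu_full : forall t, nu t (~` goodset (nu t)) = 0%E).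

Lemma generic_bd t x : bd (goodset (nu t)) x -> exists s n, x = side_orbit f s n.
Proof.
by move=> /(bd_arises kappa_inj nul nuK nu_full)[s [n [t' [_ _ ->]]]]; exists s, n.
Qed.

(** Genericity makes the branch end and the time from which the point arises unique. So two cores of
    the family contain points on the same side of that end; being disjoint for distinct indices,
    they have the same index, and [n.+1] applications of [kappa] give [t = t']. *)
Lemma generic_disjoint t t' x :
  (forall t t', t != t' -> goodset (nu t) `&` goodset (nu t') = set0) ->
  bd (goodset (nu t)) x -> bd (goodset (nu t')) x -> t = t'.
Proof.
move=> dis /(bd_arises kappa_inj nul nuK nu_full)[s [n [t0 [E G ->]]]].
move=> /(bd_arises kappa_inj nul nuK nu_full)[s' [n' [t0' [E' G' Ex]]]].
have [_ /(_ _ _ Ex)[Es En]] := gen s n; subst s' n'.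
rewrite -E -E'; congr iter; apply/eqP; apply: contraT => /dis dis0.
have [e e0 He] := G; have [e' e0' He'] := G'.
pose r := Num.min e e' / 2; have r0 : 0 < r by rewrite divr_gt0// lt_min e0.
have re : r < e by have : Num.min e e' <= e by [rewrite ge_min lexx]; rewrite /r; lra.
have re' : r < e' by have : Num.min e e' <= e' by [rewrite ge_min lexx orbT]; rewrite /r; lra.
pose w := if s.2 then send f s - r else send f s + r.
suff : (goodset (nu t0) `&` goodset (nu t0')) w by rewrite dis0.
by split; [apply: He|apply: He']; rewrite /w; case: (s.2); apply/andP; split; lra.
Qed.

End generic_families.

Section supports.
Context {R : realType}.
Notation T := (measurableTypeR R).
Implicit Types P Q : probability T R.

Lemma goodset_msupport P : goodset P `<=` msupport P.
Proof.
move=> z [a [b [_ _ zab G]]] C [cC C0]; apply: contrapT => nC.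
have /open_opn oC : open (~` C) by rewrite openC.
have [e e0 He] := oC z nC; have /andP[az zb] := zab.
pose a' := Num.max a (z - e); pose b' := Num.min b (z + e).
have az' : a' < z by rewrite gt_max az gtrDl oppr_lt0.
have zb' : z < b' by rewrite lt_min zb ltrDl.
have G' : good P a' b'.
  by apply: goodS G; [rewrite le_max lexx|exact: lt_trans zb'|rewrite ge_min lexx].
apply: (good_null G'); apply: subset_measure0 C0 => //.
  by apply: measurableC; exact: closed_measurable.
move=> w /=; rewrite in_itv/= gt_max lt_min => /andP[/andP[_ h1] /andP[_ h2]]; apply: He.
by rewrite ltr_norml; apply/andP; split; lra.
Qed.

Lemma msupport_closure P : P (~` goodset P) = 0%E -> msupport P `<=` closure (goodset P).
Proof.
move=> P0 z; apply; split; first exact: closed_closure.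
apply: subset_measure0 P0 => //.
- by apply: measurableC; exact: closed_measurable (@closed_closure _ _).
- by apply: measurableC; exact: measurable_goodset.
- by apply: subsetC; exact: subset_closure.
Qed.

Lemma closure_bd (V : set R) x : closure V x -> ~ V x -> bd V x.
Proof.
move=> cV nV; split => // e e0.
have [y [Vy]] : V `&` ball x e !=set0 by apply: cV; exact: nbhsx_ballx.
by rewrite /ball /= distrC => ?; exists y.
Qed.

Lemma boundary_bd P x : P (~` goodset P) = 0%E -> boundary (msupport P) x ->
  bd (goodset P) x.
Proof.
move=> P0 [cx nx]; apply: closure_bd.
  rewrite (closure_id (closure (goodset P))).1; last exact: closed_closure.
  by apply: closureS cx => //; exact: msupport_closure.
by move=> gx; apply: nx; apply: (interiorS (@goodset_msupport P)); rewrite (interior_id _).1//; exact: open_goodset.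
Qed.

(** An open set disjoint from another set misses its closure, so a common point of the two supports
    lies in neither core. *)
Lemma meet_bd P Q x : P (~` goodset P) = 0%E -> Q (~` goodset Q) = 0%E ->
  goodset P `&` goodset Q = set0 -> msupport P x -> msupport Q x ->
  bd (goodset P) x /\ bd (goodset Q) x.
Proof.
move=> P0 Q0 PQ Px Qx.
have dis (V W : set R) : open V -> V `&` W = set0 -> closure W x -> ~ V x.
  move=> oV VW cW Vx; have [y [Wy Vy]] : W `&` V !=set0.
    by apply: cW; exact: open_nbhs_nbhs.
  by have : (V `&` W) y by []; rewrite VW.
have cP := msupport_closure P0 Px; have cQ := msupport_closure Q0 Qx.
split; apply: closure_bd => //; first exact: (dis _ _ (@open_goodset _ P) PQ).
by apply: (dis _ _ (@open_goodset _ Q) _ cP); rewrite setIC.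
Qed.

End supports.

Section iterated_pushforward.
Context {R : realType} {m : nat}.
Notation T := (measurableTypeR R).
Variables (f : pwexp R m) (P : probability T R) (n : nat).

(** [push] under a name of its own, to which the structure of a probability measure is attached. *)
Definition pushn : set T -> \bar R := push P (iter n f).

Let M := measure_function_pushforward__canonical__measure_function_Measure P (mT_iterK f n).

Let pushn0 : pushn set0 = 0%E. Proof. exact: (measure0 M). Qed.

Let pushn_ge0 A : (0 <= pushn A)%E. Proof. exact: (measure_ge0 M). Qed.

Let pushn_sigma_additive : semi_sigma_additive pushn.
Proof. exact: (@measure_semi_sigma_additive _ _ _ M). Qed.

HB.instance Definition _ := isMeasure.Build _ _ _ pushn pushn0 pushn_ge0 pushn_sigma_additive.

Let pushn_setT : pushn setT = 1%E. Proof. exact: probability_setT. Qed.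

HB.instance Definition _ := Measure_isProbability.Build _ _ _ pushn pushn_setT.

End iterated_pushforward.

Section separation_of_generic.
Context {R : realType} {m : nat}.
Notation lam := (@lebesgue_measure R).
Notation T := (measurableTypeR R).
Variable f : pwexp R m.
Implicit Types P Q mu nu : probability T R.

Lemma iter_iter (X : Type) (g : X -> X) n k x : iter n (iter k g) x = iter (n * k)%N g x.
Proof. by elim: n => //= n ->; rewrite mulSn iterD. Qed.

Lemma iterC (X : Type) (g : X -> X) n k x : iter n g (iter k g x) = iter k g (iter n g x).
Proof. by rewrite -!iterD addnC. Qed.

Let measurable01 : measurable (`[0, 1]%classic : set T).
Proof. exact: measurable_itv. Qed.

Lemma acip_full P (k : nat) : (0 < k)%N -> acip (iter k f) P -> P (~` goodset P) = 0%E.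
Proof.
move=> k0 [P1 PK Pl]; apply: (@goodset_full _ _ f P k k0 Pl) => //.
have := probability_setC P measurable01; rewrite P1 subee//; exact.
Qed.

Lemma acip_dominated (g : R -> R) P : acip g P -> P `<< lam.
Proof. by case. Qed.

Lemma iter_maps k x : `[0, 1]%classic x -> `[0, 1]%classic (iter k f x).
Proof. by move=> x01; elim: k => // k; exact: pw_maps. Qed.

(** [ergodic] tests subsets of [[0, 1]]; the trace on [[0, 1]] of an invariant subset of the line is
    one of these and has the same mass. *)
Lemma ergodic01 P k : acip (iter k f) P -> ergodic (iter k f) P ->
  forall A : set T, measurable A -> iter k f @^-1` A = A -> P A = 0%E \/ P A = 1%E.
Proof.
move=> [P1 _ _] erg A mA EA; have mI := measurableI _ _ measurable01 mA.
have -> : P A = P (`[0, 1]%classic `&` A).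
  apply/eqP; rewrite eq_le; apply/andP; split; last first.
    by apply: le_measure; rewrite ?inE//; exact: subIsetr.
  have := probability_setC P measurable01; rewrite P1 subee// => h.
  have mC := measurableC measurable01.
  rewrite -[leRHS]adde0 -h; apply: le_trans (measureU2 _ mI mC).
  apply: le_measure; rewrite ?inE//; first exact: measurableU.
  by move=> x Ax; have [x01|x01] := pselect (`[0, 1]%classic x); [left|right].
apply: erg => //; apply/seteqP; split=> x [x01].
  by move=> -[_ Ax]; split => //; rewrite -EA.
by move=> Ax; split=> //; split; [exact: iter_maps|rewrite -EA in Ax].
Qed.

(** A set of full measure for [P] and null for [Q] would be Lebesgue null, together with its
    complement, on an interval good for both. *)
Lemma ergodic_disjoint P Q k : (0 < k)%N -> acip (iter k f) P -> acip (iter k f) Q ->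
  ergodic (iter k f) P -> ergodic (iter k f) Q -> ~ same_measure P Q ->
  goodset P `&` goodset Q = set0.
Proof.
move=> k0 aP aQ eP eQ nPQ; apply/seteqP; split => // z [].
have [_ iP _] := aP; have [_ iQ _] := aQ.
have [A0 /not_implyP[mA0 A0ne]] : exists A0 : set T, ~ (measurable A0 -> P A0 = Q A0).
  exact/existsNP.
have [A [mA PA QA]] : exists A : set T, [/\ measurable A, P A = 1%E & Q A = 0%E].
  apply: (@mutually_singular _ _ _ P Q (iter k f : T -> T)) => //.
  - exact: mT_iterK.
  - exact: ergodic01.
  - exact: ergodic01.
  - by exists A0.
move=> [a [b [_ _ /andP[az zb] G]]] [a' [b' [_ _ /andP[az' zb'] G']]].
pose c := Num.max a a'; pose e := Num.min b b'.
have cz : c < z by rewrite gt_max az.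
have ze : z < e by rewrite lt_min zb.
have [_ {}G] : good P c e.
  by apply: goodS G; [rewrite le_max lexx|exact: lt_trans ze|rewrite ge_min lexx].
have [_ {}G'] : good Q c e.
  by apply: goodS G'; [rewrite le_max lexx orbT|exact: lt_trans ze|rewrite ge_min lexx orbT].
have mI : measurable (`]c, e[%classic : set T) by exact: measurable_itv.
have h1 : lam (`]c, e[%classic `&` A) = 0%E.
  apply: G'; [exact: measurableI|exact: subIsetl|].
  by apply: subset_measure0 QA => //; exact: measurableI.
have h2 : lam (`]c, e[%classic `\` A) = 0%E.
  apply: G; [exact: measurableD|by move=> x []|].
  have PC : P (~` A) = 0%E by rewrite probability_setC// PA subee.
  apply: subset_measure0 PC; [exact: measurableD|exact: measurableC|by move=> x []].
have : lam `]c, e[%classic = 0%E.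
  apply/eqP; rewrite eq_le measure_ge0 andbT.
  apply: (@le_trans _ _ (lam (`]c, e[%classic `&` A) + lam (`]c, e[%classic `\` A))%E).
    have := measureU2 lam (measurableI _ _ mI mA) (measurableD mI mA).
    by rewrite setUIDK.
  by rewrite h1 h2 adde0.
rewrite lebesgue_measure_itv /= lte_fin (lt_trans cz ze) => -[/eqP].
by rewrite subr_eq0 gt_eqF// (lt_trans cz ze).
Qed.

(** An invariant set is its own preimage under every iterate, so it belongs to the tail. *)
Lemma exact_ergodic (g : R -> R) P : (forall x : R, `[0, 1]%classic x -> `[0, 1]%classic (g x)) ->
  is_exact g P -> ergodic g P.
Proof.
move=> g01 [[P1 _ _] tail] A mA EA.
have A01 : A `<=` `[0, 1]%classic by rewrite -EA; exact: subIsetl.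
have gA (x : R) : `[0, 1]%classic x -> A (g x) <-> A x.
  by move=> x01; split=> [Ax|]; [rewrite -EA|rewrite -{1}EA => -[]].
have inA n : A = `[0, 1]%classic `&` iter n g @^-1` A.
  elim: n => [|n IH]; first by apply/seteqP; split=> x; [move=> Ax; split => //; exact: A01|case].
  apply/seteqP; split=> x.
    move=> Ax; have x01 := A01 _ Ax; split => //=.
    have : A (g x) by apply/gA.
    by rewrite {1}IH -iterS iterSr => -[].
  move=> [x01] /=; rewrite -iterS iterSr => Ax.
  by apply/gA => //; rewrite IH; split => //; exact: g01.
have [h|h] := tail A (fun n => ex_intro2 _ _ A mA (inA n)); [by left|right].
have h' : P (A `|` `[0, 1]%classic `\` A) = 1%E by rewrite setDUK.
apply/eqP; rewrite eq_le probability_le1//= -h'.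
have : (P (A `|` `[0%R, 1%R]%classic `\` A) <= P A + P (`[0%R, 1%R]%classic `\` A))%E.
  exact: (measureU2 P mA (measurableD measurable01 mA)).
by rewrite h adde0.
Qed.

Lemma sum_periodic (p : nat -> R) k n : (forall j, p (j + k)%N = p j) ->
  \sum_(j < n * k) p j = n%:R * \sum_(j < k) p j.
Proof.
move=> pk; rewrite -!(big_mkord xpredT p); elim: n => [|n IH].
  by rewrite mul0n mul0r big_geq.
rewrite mulSn (big_cat_nat _ (leq_addr _ _))//=.
have -> : \sum_(k <= j < k + n * k) p j = \sum_(0 <= j < n * k) p j.
  by rewrite -{1}[k]add0n big_addn addKn; apply: eq_bigr => j _; exact: pk.
by rewrite IH -natr1 mulrDl mul1r addrC.
Qed.

Let mpre n (A : set T) : measurable A -> measurable (iter n f @^-1` A : set T).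
Proof. exact: measurable_preimage_iter. Qed.

Lemma pushnK P k j : acip (iter k f) P -> forall A : set T, measurable A ->
  push P (iter (j + k) f) A = push P (iter j f) A.
Proof.
move=> [_ iP _] A mA; rewrite -[RHS](iP _ (mpre j mA)); congr (P _).
by apply/seteqP; split => x /=; rewrite iterD.
Qed.

(** A coincidence at times [i < j] would make [P] invariant under the iterate of order [d = j - i],
    and [P] would give a decomposition of length [d < k], against minimality. *)
Lemma mixing_distinct mu P k : mixing_cycle f mu k P ->
  forall i j, (i < j)%N -> (j < k)%N -> ~ same_measure (push P (iter i f)) (push P (iter j f)).
Proof.
move=> [[k0 aP muE exP] minK] i j ij jk same; pose d := (j - i)%N.
have d0 : (0 < d)%N by rewrite subn_gt0.
have ik := ltn_trans ij jk.
have Pd (A : set T) : measurable A -> P (iter d f @^-1` A) = P A.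
  (* Pushing the coincidence forward by [k - i] more steps turns time [i] into [k], equivalent to 0,
     and time [j] into [d + k], equivalent to [d]. *)
  move=> mA; have := same _ (mpre (k - i) mA).
  rewrite (_ : push P (iter i f) _ = push P (iter (0 + k) f) A); last first.
    congr (P _); apply/seteqP; split=> x /=; rewrite -iterD add0n subnK//; exact: ltnW.
  rewrite (pushnK _ aP mA) (_ : push P (iter j f) _ = push P (iter (d + k) f) A); last first.
    congr (P _); apply/seteqP; split=> x /=; rewrite -iterD.
      by rewrite (_ : (k - i + j = d + k)%N)// /d; lia.
    by rewrite (_ : (k - i + j = d + k)%N)// /d; lia.
  by rewrite (pushnK _ aP mA) => /esym; exact.
have aPd : acip (iter d f) P by case: aP => ? _ ?; split.
have : mixing_decomposition f mu d P.
  split => //.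
  - move=> A mA; rewrite muE//.
    pose p n := fine (push P (iter n f) A).
    have pE n : push P (iter n f) A = (p n)%:E by rewrite fineK// fin_num_measure//; exact: mpre.
    have sumE n : (\sum_(j < n) push P (iter j f) A = (\sum_(j < n) p j)%:E)%E.
      by rewrite -sumEFin; apply: eq_bigr => l _.
    rewrite !sumE -!EFinM; congr EFin.
    have pk n : p (n + k)%N = p n by rewrite /p pushnK.
    have pd n : p (n + d)%N = p n by rewrite /p pushnK.
    (* The masses have both periods [k] and [d]; summing [d * k] of them in two ways identifies the
       two means. *)
    have := sum_periodic d pk; rewrite mulnC (sum_periodic k pd) => E.
    have k00 : k%:R != 0 :> R by rewrite pnatr_eq0 -lt0n.
    have d00 : d%:R != 0 :> R by rewrite pnatr_eq0 -lt0n.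
    apply: (mulfI k00); apply: (mulfI d00); rewrite mulVKf// -E mulrCA; congr (_ * _).
    by rewrite mulVKf.
  - move=> l; have [[l1 l2 l3] tail] := exP l; split; first split => //.
      move=> A mA; rewrite -[RHS](Pd _ (mpre l mA)).
      by congr (P _); apply/seteqP; split => x /=; rewrite iterC.
    (* A preimage of order [n * k] under [iter d f] is one of order [n] under [iter k f], once the
       surplus of [n * k * d.-1] steps is moved into the Borel set. *)
    move=> A tA; apply: tail => n; have [B mB ->] := tA (n * k)%N.
    exists (iter (n * k * d.-1) f @^-1` B); first exact: mpre.
    by apply/seteqP; split=> x /= -[x01 H]; split => //; move: H; rewrite /= !iter_iter;
      rewrite -iterD -mulnSr prednK.
by move=> /minK; rewrite leqNgt (leq_ltn_trans (leq_subr _ _) jk).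
Qed.

Lemma push_component_null mu P k i (A : set T) : mixing_cycle f mu k P -> (i < k)%N ->
  measurable A -> mu A = 0%E -> push P (iter i f) A = 0%E.
Proof.
move=> [[k0 aP muE exP] _] ik mA; rewrite muE// => /eqP.
rewrite mule_eq0 => /orP[|].
  by rewrite eqe invr_eq0 pnatr_eq0 -leqn0 leqNgt k0.
rewrite (bigD1 (Ordinal ik))//= => /eqP.
have p0 j : (0 <= push P (iter j f) A)%E by exact: (measure_ge0 P).
by move=> /eqP; rewrite padde_eq0// ?sume_ge0// => /andP[/eqP].
Qed.

Lemma component_msupport mu P k i : mixing_cycle f mu k P -> (i < k)%N ->
  mixing_component f P i `<=` msupport mu.
Proof.
move=> cyc ik x xi C [cC C0]; apply: xi; split => //.
apply: (push_component_null cyc ik _ C0).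
by apply: measurableC; exact: closed_measurable.
Qed.

Lemma acip1 (g : R -> R) mu : acip g mu -> acip (iter 1 g) mu.
Proof. by []. Qed.

Lemma supports_disjoint mu nu : generic f -> ergodic_acip f mu -> ergodic_acip f nu ->
  ~ same_measure mu nu -> msupport mu `&` msupport nu = set0.
Proof.
move=> gen [amu emu] [anu enu] ne.
have dis : goodset mu `&` goodset nu = set0 by exact: (@ergodic_disjoint _ _ 1).
have fmu := acip_full (ltn0Sn 0) (acip1 amu); have fnu := acip_full (ltn0Sn 0) (acip1 anu).
apply/seteqP; split => // x [xmu xnu].
have [b1 b2] := meet_bd fmu fnu dis xmu xnu.
pose fam (b : bool) : {finite_measure set T -> \bar R} := if b then mu else nu.
suff : true = false by [].
apply: (@generic_disjoint _ _ f _ id fam gen _ _ _ _ true false x) => //.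
- by move=> [] /=; [exact: acip_dominated amu|exact: acip_dominated anu].
- by move=> [] A mA /=; [case: amu => _ /(_ A mA)|case: anu => _ /(_ A mA)] => <-.
- by move=> [].
- by move=> [] [] //= _; rewrite setIC.
Qed.

Lemma components_disjoint mu P k i j : generic f -> mixing_cycle f mu k P ->
  (i < k)%N -> (j < k)%N -> i != j -> mixing_component f P i `&` mixing_component f P j = set0.
Proof.
case: k => // k gen cyc ik jk ij; have [[_ aP _ exP] _] := cyc.
pose Q (t : 'I_k.+1) : probability T R := pushn f P t.
have aQ t : acip (iter k.+1 f) (Q t) by case: (exP t).
have fQ t : Q t (~` goodset (Q t)) = 0%E by exact: (@acip_full _ k.+1).
have eQ t : ergodic (iter k.+1 f) (Q t).
  by apply: exact_ergodic; [exact: iter_maps|exact: exP].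
have dis t t' : t != t' -> goodset (Q t) `&` goodset (Q t') = set0.
  move=> tt'; apply: (@ergodic_disjoint _ _ k.+1) => //.
  have [l|l|/val_inj E] := ltngtP t t'; last by rewrite E eqxx in tt'.
    exact: (mixing_distinct cyc l).
  by move=> h; apply: (mixing_distinct cyc l) => // A mA; have /esym := h A mA; exact.
apply/seteqP; split => // x [xi xj].
have [b1 b2] := @meet_bd _ (Q (Ordinal ik)) (Q (Ordinal jk)) _ (fQ _) (fQ _)
  (dis (Ordinal ik) (Ordinal jk) ij) xi xj.
suff /(congr1 val)/= E : Ordinal ik = Ordinal jk by rewrite E eqxx in ij.
(* The components form one family permuted by the cyclic successor: pushing the last one forward
   gives back [P], by invariance under the full cycle. *)
apply: (@generic_disjoint _ _ f _ (@ordS k.+1) (fun t => Q t) gen _ _ _ _ _ _ x) => //.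
- exact: ordS_inj.
- by move=> t; exact: acip_dominated (aQ t).
- move=> t A mA /=; rewrite /Q /pushn /=.
  have [tk|tk] := ltnP t k; first by rewrite modn_small// ltnS.
  have -> : t = k :> nat by apply/eqP; rewrite eqn_leq tk -ltnS ltn_ord.
  rewrite modnn; have /esym := pushnK 0 aP mA; exact.
Qed.

Lemma boundary_orbit mu x : ergodic_acip f mu -> boundary (msupport mu) x ->
  exists s n, x = side_orbit f s n.
Proof.
move=> [amu _] bx; have fmu := acip_full (ltn0Sn 0) (acip1 amu).
have := boundary_bd fmu bx.
apply: (@generic_bd _ _ f _ id (fun _ : unit => (mu : {finite_measure set T -> \bar R})) _ _ _ _ tt) => //.
- by move=> _; exact: acip_dominated amu.
- by move=> _ A mA; case: amu => _ h _; have /esym := h A mA; exact.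
Qed.

Lemma generic_separation : generic f -> separation_condition f.
Proof.
move=> gen; split.
- by move=> mu nu emu enu; exact: supports_disjoint.
- by move=> mu P k _ cyc i j ik jk; exact: components_disjoint cyc ik jk.
- move=> mu nu P Q k l emu enu ne cP cQ i j ik jl.
  rewrite -subset0 -(supports_disjoint gen emu enu ne).
  by apply: setISS; [exact: component_msupport ik|exact: component_msupport jl].
(* A boundary point lies on the orbit of a branch end, and so do its images; a generic orbit never
   meets a cut. *)
- move=> mu k emu _; rewrite -subset0 => x [[_ [n _ cn]] /(boundary_orbit emu)[s [n' E]]].
  have [+ _] := gen s (n + n')%N; apply; rewrite /side_orbit iterD.
  by move: cn; rewrite E => -[c _ <-]; exists c.
(* A return after [p] steps equates the orbit points of one branch end at times [n] and [p + n]. *)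
- move=> mu emu x [_ /(boundary_orbit emu)[s [n ->]]] p p0; apply/eqP => E.
  have [_ /(_ s n)] := gen s (p + n)%N; rewrite {1}/side_orbit iterD E => /(_ erefl)[_ /eqP].
  by rewrite -{2}[n]add0n eqn_add2r => /eqP p00; rewrite p00 in p0.
Qed.

End separation_of_generic.

(** * Generic maps are residual *)

Section perturbation.
Context {R : realType} {m : nat}.
Variables (f : pwexp R m) (h h' : 'I_m -> R -> R) (t K s M L : R).
Hypotheses (HC : pw_const f s M L) (t0 : 0 <= t) (K0 : 0 <= K) (ts : t * K < s - 1)
  (hh' : forall i x, pw_int f i x -> has_slope (pw_int f i) (h i) x (h' i x))
  (hK : forall i x, pw_int f i x -> `|h i x| <= K)
  (h'K : forall i x, pw_int f i x -> `|h' i x| <= K)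
  (h'L : forall i x y, pw_int f i x -> pw_int f i y -> `|h' i x - h' i y| <= K * `|x - y|)
  (h01 : forall i x, pw_int f i x -> 0 <= f x + t * h i x <= 1).

(* Neighbouring branches may both contain their common end, where the perturbed map
   must follow one of them only. *)
Let idx (x : R) : option 'I_m := [pick i | `[< pw_int f i x >]].

Let pert x := if idx x is Some i then f x + t * h i x else 0.

Let pint i : set R := [set x | idx x = Some i].

Let idx_int x i : idx x = Some i -> pw_int f i x.
Proof. by rewrite /idx; case: pickP => // j /asboolP Ij [<-]. Qed.

Let pint_sub i : pint i `<=` pw_int f i.
Proof. by move=> x /idx_int. Qed.

Let open_int_eq i j x : pw_open f i x -> pw_int f j x -> j = i.
Proof.
rewrite /pw_open /= in_itv/= => /andP[ax xb] /pw_int_closed/andP[ax' xb'].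
apply: val_inj; have [ij|ij|//] := ltngtP j i.
  have : pw_right f j <= pw_left f i by rewrite /pw_right /pw_left pw_cut_mono.
  by move=> ji; have := le_lt_trans (le_trans xb' ji) ax; rewrite ltxx.
have : pw_right f i <= pw_left f j by rewrite /pw_right /pw_left pw_cut_mono.
by move=> ji; have := lt_le_trans xb (le_trans ji ax'); rewrite ltxx.
Qed.

Let open_pint i : pw_open f i `<=` pint i.
Proof.
move=> x Ox; rewrite /pint /= /idx; case: pickP => [j /asboolP Ij|/(_ i)/asboolP[]].
  by rewrite (open_int_eq Ox Ij).
exact: pw_open_int.
Qed.

Let pertE i x : pint i x -> pert x = f x + t * h i x.
Proof. by rewrite /pert /pint /= => ->. Qed.

Let idx_none x : ~ `[0, 1]%classic x -> idx x = None.
Proof.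
move=> nx; rewrite /idx; case: pickP => // i /asboolP Ii; exfalso; apply: nx.
by rewrite /= in_itv/=; exact: pw_int01 Ii.
Qed.

Let pert_out x : ~ `[0, 1]%classic x -> pert x = 0.
Proof. by move=> /idx_none; rewrite /pert => ->. Qed.

Let pert_maps x : `[0, 1]%classic x -> `[0, 1]%classic (pert x).
Proof.
move=> x01; rewrite /pert /= in_itv/=; case E: (idx x) => [i|]; last by rewrite lexx ler01.
exact/h01/idx_int.
Qed.

Let pint_int i : `]pw_left f i, pw_right f i[%classic `<=` pint i /\
  pint i `<=` `[pw_left f i, pw_right f i]%classic.
Proof.
split; first exact: open_pint.
by move=> x /pint_sub/pw_int_closed; rewrite /= in_itv.
Qed.

Let pint_cover : \bigcup_(i in [set: 'I_m]) pint i = `[0, 1]%classic.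
Proof.
apply/seteqP; split=> x.
  by move=> [i _ /pint_sub/pw_int01]; rewrite /= in_itv.
rewrite -(pw_cover f) => -[i _ Ii]; rewrite /pint /idx.
case E: (idx x) => [j|]; first by exists j.
by move: E; rewrite /idx; case: pickP => // /(_ i)/asboolP[].
Qed.

Let pint_lim i x : pint i x -> limit_pt (pint i) x.
Proof. by move=> /pint_sub/pw_int_limit_pt; apply: limit_ptS; exact: open_pint. Qed.

Let pert_slope i x : pint i x -> has_slope (pint i) pert x (pw_der f i x + t * h' i x).
Proof.
move=> Ix; have Ix' := pint_sub Ix.
have := has_slopeD (pw_der_slope Ix') (has_slopeM t (hh' Ix')).
move=> /(has_slopeS (@pint_sub i)); apply: eq_has_slope => // y Iy.
by rewrite (pertE Iy).
Qed.

Let pert_der i x : pint i x -> derive_on (pint i) pert x = pw_der f i x + t * h' i x.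
Proof. by move=> Ix; apply: has_slope_derive; [exact: pint_lim|exact: pert_slope]. Qed.

Let pert_der_lip i x y : pint i x -> pint i y ->
  `|derive_on (pint i) pert x - derive_on (pint i) pert y| <= (L + t * K) * `|x - y|.
Proof.
move=> Ix Iy; rewrite !pert_der//; have Ix' := pint_sub Ix; have Iy' := pint_sub Iy.
have -> : pw_der f i x + t * h' i x - (pw_der f i y + t * h' i y) =
  (pw_der f i x - pw_der f i y) + t * (h' i x - h' i y) by ring.
rewrite mulrDl; apply: (le_trans (ler_normD _ _)); apply: lerD; first exact: (pwc_lip HC Ix' Iy').
by rewrite normrM ger0_norm// -mulrA ler_wpM2l// h'L.
Qed.

Let pert_C1 i : C1_on (pint i) pert.
Proof.
split; first by move=> x Ix; exact: has_slope_derivable (pert_slope Ix).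
apply/subspace_continuousP => x Ix; apply/(@cvgrPdist_lt R R) => e e0.
have L0 := pwc_L HC.
have LK : 0 < L + t * K by rewrite ltr_wpDr// mulr_ge0.
apply/nbhs_ballP; exists (e / (L + t * K)) => /=; first exact: divr_gt0.
move=> y; rewrite /ball /= => xy Iy; apply: le_lt_trans (pert_der_lip Ix Iy) _.
by rewrite mulrC -ltr_pdivlMr.
Qed.

Let pert_expanding : exists2 sigma : R, 1 < sigma &
  forall i x, pint i x -> sigma <= `|derive_on (pint i) pert x|.
Proof.
exists (s - t * K); first by rewrite ltrBrDr -ltrBrDl.
move=> i x Ix; rewrite pert_der//; have Ix' := pint_sub Ix.
apply: le_trans (lerB_normD _ _); apply: lerB; first exact: (pwc_lb HC Ix').
by rewrite normrM ger0_norm// ler_wpM2l// h'K.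
Qed.

Let pert_lip i : [lipschitz derive_on (pint i) pert x | x in pint i].
Proof.
exists (L + t * K); split; first exact: num_real.
move=> C lC -[x y] [/= Ix Iy]; apply: (le_trans (pert_der_lip Ix Iy)).
by rewrite ler_wpM2r// ltW.
Qed.

Let g := PWExp pert_out pert_maps (pw_cut0 f) (pw_cut1 f) (@pw_cut_lt _ _ f) pint_int pint_cover
  pert_C1 pert_expanding pert_lip.

Let etaE i x : eta f g i x = x.
Proof.
rewrite /eta -[pw_left g i]/(pw_left f i) -[pw_right g i]/(pw_right f i).
by rewrite divff ?mulr1 ?subrKC// subr_eq0 gt_eqF// pw_left_lt_right.
Qed.

Let etaE' i x : eta g f i x = x.
Proof.
rewrite /eta -[pw_left g i]/(pw_left f i) -[pw_right g i]/(pw_right f i).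
by rewrite divff ?mulr1 ?subrKC// subr_eq0 gt_eqF// pw_left_lt_right.
Qed.

Let two_pts i : exists x y, [/\ pw_open f i x, pw_open f i y & x != y].
Proof.
have ab := pw_left_lt_right f i.
exists ((pw_left f i + pw_right f i) / 2), ((pw_left f i + 2 * pw_right f i) / 3).
rewrite /pw_open /= !in_itv/=; split; [by apply/andP; split; lra..|].
by apply/eqP => E; lra.
Qed.

(** The cuts are kept, so [eta] is the identity and [rho_cut] vanishes; [rho_0] costs [t * K] and
    [rho_Lip] four times as much, so the factor 7 is generous. Expansion survives with rate
    [s - t * K]. *)
Lemma perturbation : exists g : pwexp R m, [/\ pw_cut g = pw_cut f,
  forall i x, pw_open f i x -> g x = f x + t * h i x & pw_dist f g <= 7 * (t * K)].
Proof.
exists g; split => //; first by move=> i x /open_pint; exact: pertE.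
have tK : 0 <= t * K by exact: mulr_ge0.
have derg i x : pw_open f i x -> pw_der g i x = pw_der f i x + t * h' i x.
  by move=> /open_pint; exact: pert_der.
have h1 : rho_cut f g <= 0.
  by apply: bigmax_le => // k _; rewrite [pw_cut g k]/(pw_cut f k) subrr normr0.
have h2 : rho_0 f g <= t * K.
  apply: bigmax_le => // i _; apply: ge_sup.
    have [x [_ [Ox _ _]]] := two_pts i.
    by eexists; exists x; first exact: pw_open_int.
  move=> _ [x Ix <-]; rewrite etaE.
  have : `[0, 1]%classic x by rewrite /= in_itv/=; exact: pw_int01 Ix.
  rewrite -pint_cover => -[j _ Ij]; rewrite [g x](pertE Ij).
  rewrite opprD addNKr normrN normrM ger0_norm// ler_wpM2l//.
  by apply: hK; exact: pint_sub.
have lipn (w : R -> R) i : (forall x, pw_open f i x -> `|w x| <= t * K) ->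
    (forall x y, pw_open f i x -> pw_open f i y -> `|w x - w y| <= t * K * `|x - y|) ->
    Lip_norm (pw_open f i) w <= 2 * (t * K).
  move=> w1 w2; have [x0 [y0 [Ox0 Oy0 xy0]]] := two_pts i.
  rewrite mulr2n mulrDl mul1r; apply: lerD; apply: ge_sup.
  - by eexists; exists x0; first exact: Ox0.
  - by move=> _ [x Ox <-]; exact: w1.
  - by exists (`|w x0 - w y0| / `|x0 - y0|), x0, y0.
  - move=> _ [x [y [Ox Oy xy ->]]]; rewrite ler_pdivrMr ?w2//.
    by rewrite normr_gt0 subr_eq0.
have h3 : rho_Lip f g <= 4 * (t * K).
  apply: bigmax_le; first by rewrite mulr_ge0.
  move=> i _; rewrite (_ : 4 = 2 + 2 :> R); last by ring.
  rewrite mulrDl; apply: lerD; apply: lipn.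
  - move=> x Ox; rewrite etaE derg// opprD addNKr normrN normrM ger0_norm// ler_wpM2l//.
    by apply: h'K; exact: pw_open_int.
  - move=> x y Ox Oy; rewrite !etaE !derg//.
    rewrite (_ : _ - _ = - (t * (h' i x - h' i y))); last by ring.
    rewrite normrN normrM ger0_norm// -mulrA ler_wpM2l//.
    by apply: h'L; exact: pw_open_int.
  - move=> x Ox; rewrite etaE' derg// addrAC subrr add0r normrM ger0_norm// ler_wpM2l//.
    by apply: h'K; exact: pw_open_int.
  - move=> x y Ox Oy; rewrite !etaE' !derg//.
    rewrite (_ : _ - _ = t * (h' i x - h' i y)); last by ring.
    rewrite normrM ger0_norm// -mulrA ler_wpM2l//.
    by apply: h'L; exact: pw_open_int.
rewrite /pw_dist; lra.
Qed.

End perturbation.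

(** * Continuous dependence of the orbits of branch ends on the map *)

Section closeness.
Context {R : realType} {m : nat}.
Implicit Types f g : pwexp R m.

Definition near_map f (P : pwexp R m -> Prop) :=
  exists2 e : R, 0 < e & forall g, pw_dist f g < e -> P g.

Lemma near_mapI f P Q : near_map f P -> near_map f Q -> near_map f (fun g => P g /\ Q g).
Proof.
move=> [a a0 Pa] [b b0 Qb]; exists (Num.min a b); first by rewrite lt_min a0.
by move=> g; rewrite lt_min => /andP[/Pa + /Qb].
Qed.

Lemma near_map_impl f P Q : (forall g, P g -> Q g) -> near_map f P -> near_map f Q.
Proof. by move=> PQ [e e0 H]; exists e => // g /H/PQ. Qed.

Lemma near_map_forall f (I : finType) (P : I -> pwexp R m -> Prop) :
  (forall i, near_map f (P i)) -> near_map f (fun g => forall i, P i g).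
Proof.
move=> H; have /choice[e He] : forall i, exists e : R, 0 < e /\ forall g, pw_dist f g < e -> P i g.
  by move=> i; have [e e0 h] := H i; exists e.
have [d d0 Hd] := @fin_pos_lb R I e (fun i => (He i).1).
by exists d => // g fg i; apply: (He i).2; exact: lt_le_trans (Hd i).
Qed.

Let rho_ge0 f g : [/\ 0 <= rho_cut f g, 0 <= rho_0 f g & 0 <= rho_Lip f g].
Proof. by split; exact: bigmax_ge_id. Qed.

Lemma pw_dist_cut f g e k : pw_dist f g < e -> `|pw_cut f k - pw_cut g k| < e.
Proof.
have [h1 h2 h3] := rho_ge0 f g; rewrite /pw_dist => h.
have e0 : 0 < e by lra.
have [km|km] := boolP (0 < k < m)%N.
  have : `|pw_cut f k - pw_cut g k| <= rho_cut f g.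
    by rewrite /rho_cut (le_bigmax_cond _ (fun k => `|pw_cut f k - pw_cut g k|) km).
  lra.
suff -> : pw_cut f k = pw_cut g k by rewrite subrr normr0.
move: km; rewrite negb_and -!leqNgt leqn0 => /orP[/eqP k0|mk].
  by rewrite (_ : k = ord0) ?pw_cut0//; exact: val_inj.
rewrite (_ : k = ord_max) ?pw_cut1//; apply: val_inj => /=; apply/eqP.
by rewrite eqn_leq mk -ltnS ltn_ord.
Qed.

(** [u] is the barycentric coordinate of [x] in its branch, which [eta] preserves. *)
Lemma eta_param f g i x : exists u : R, [/\ x = pw_left f i + u * (pw_right f i - pw_left f i),
  eta f g i x = pw_left g i + u * (pw_right g i - pw_left g i),
  pw_closed f i x -> 0 <= u <= 1 & pw_open f i x -> 0 < u < 1].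
Proof.
have ab := pw_left_lt_right f i; have ab0 : 0 < pw_right f i - pw_left f i by rewrite subr_gt0.
have ne : pw_right f i - pw_left f i != 0 by rewrite gt_eqF.
exists ((x - pw_left f i) / (pw_right f i - pw_left f i)); split.
- by rewrite divfK// subrKC.
- by rewrite /eta mulrA mulrAC.
- move=> /andP[h1 h2]; apply/andP; split; first by rewrite divr_ge0 ?subr_ge0 ?(ltW ab).
  by rewrite ler_pdivrMr// mul1r lerD2r.
- rewrite /pw_open /= in_itv/= => /andP[h1 h2].
  apply/andP; split; first by rewrite divr_gt0 ?subr_gt0.
  by rewrite ltr_pdivrMr// mul1r ltrD2r.
Qed.

Lemma eta_open f g i x : pw_open f i x -> pw_open g i (eta f g i x).
Proof.
have [u [_ -> _ H]] := eta_param f g i x; move=> /H/andP[u0 u1].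
have ab : 0 < pw_right g i - pw_left g i by rewrite subr_gt0 pw_left_lt_right.
rewrite /pw_open /= in_itv/= ltrDl mulr_gt0//= -ltrBrDl.
by rewrite gtr_pMl.
Qed.

Lemma eta_closed f g i x : pw_closed f i x -> pw_closed g i (eta f g i x).
Proof.
have [u [_ -> H _]] := eta_param f g i x; move=> /H/andP[u0 u1].
have ab : 0 < pw_right g i - pw_left g i by rewrite subr_gt0 pw_left_lt_right.
rewrite /pw_closed lerDl mulr_ge0 ?(ltW ab)//= -lerBrDl.
by rewrite ger_pMl.
Qed.

Lemma etaK f g i x : eta g f i (eta f g i x) = x.
Proof.
have h1 : pw_right f i - pw_left f i != 0 by rewrite gt_eqF// subr_gt0 pw_left_lt_right.
have h2 : pw_right g i - pw_left g i != 0 by rewrite gt_eqF// subr_gt0 pw_left_lt_right.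
by rewrite /eta; field; rewrite h1 h2.
Qed.

Lemma eta_send f g s : eta f g s.1 (send f s) = send g s.
Proof.
have h1 : pw_right f s.1 - pw_left f s.1 != 0.
  by rewrite gt_eqF// subr_gt0 pw_left_lt_right.
by rewrite /eta /send; case: s.2; [rewrite mulrC divfK// subrKC|rewrite subrr mul0r addr0].
Qed.

Lemma eta_move f g i x e : pw_dist f g < e -> pw_closed f i x -> `|eta f g i x - x| <= e.
Proof.
move=> fg; have := pw_dist_cut (widen_ord (leqnSn m) i) fg; rewrite -/(pw_left f i) -/(pw_left g i).
have := pw_dist_cut (lift ord0 i) fg; rewrite -/(pw_right f i) -/(pw_right g i).
have [u [-> -> H _]] := eta_param f g i x => h1 h2 /H/andP[u0 u1].
set a := pw_left f i in h2 *; set b := pw_right f i in h1 *.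
set a' := pw_left g i in h2 *; set b' := pw_right g i in h1 *.
rewrite (_ : _ - _ = (1 - u) * (a' - a) + u * (b' - b)); last by ring.
apply: (le_trans (ler_normD _ _)).
rewrite !normrM (ger0_norm u0) (@ger0_norm _ (1 - u)) ?subr_ge0//.
rewrite (distrC a' a) (distrC b' b).
have h3 : (1 - u) * `|a - a'| <= (1 - u) * e by rewrite ler_wpM2l ?subr_ge0// ltW.
have h4 : u * `|b - b'| <= u * e by rewrite ler_wpM2l// ltW.
lra.
Qed.

Lemma pw_dist_fun f g i x e : pw_dist f g < e -> pw_int f i x ->
  `|f x - g (eta f g i x)| < e.
Proof.
have [h1 h2 h3] := rho_ge0 f g; rewrite /pw_dist => h Ix.
suff : `|f x - g (eta f g i x)| <= rho_0 f g by lra.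
apply: le_trans (le_bigmax_cond _ (fun i => C0_norm (pw_int f i) (fun x => f x - g (eta f g i x)))
  (isT : xpredT i)).
apply: ub_le_sup; last by exists x.
exists 1 => _ [y Iy <-].
have /andP[f0 f1] := pw_fun01 f (pw_int01 Iy).
have /andP[g0 g1] : 0 <= g (eta f g i y) <= 1.
  apply: pw_fun01; have /andP[k1 k2] := eta_closed g (pw_int_closed Iy).
  have /andP[k3 _] := pw_cut01 g (widen_ord (leqnSn m) i).
  have /andP[_ k4] := pw_cut01 g (lift ord0 i).
  by rewrite (le_trans k3 k1) (le_trans k2 k4).
by rewrite ler_norml; apply/andP; split; lra.
Qed.

(** The bound on the open branch passes to the ends because both extensions are continuous; it only
    loses strictness. *)
Lemma pw_dist_bext f g i x e : pw_dist f g < e -> pw_closed f i x ->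
  `|bext f i x - bext g i (eta f g i x)| <= e.
Proof.
move=> fg cx; have [s [M [L HC]]] := pw_consts g; have M0 := pw_const_M0 i HC.
have ab : 0 < pw_right f i - pw_left f i by rewrite subr_gt0 pw_left_lt_right.
have ab' : 0 < pw_right g i - pw_left g i by rewrite subr_gt0 pw_left_lt_right.
pose r := (pw_right g i - pw_left g i) / (pw_right f i - pw_left f i).
have r0 : 0 < r by exact: divr_gt0.
have D0 : 0 < 1 + M * r by rewrite addr_gt0// mulr_gt0.
apply/ler_addgt0Pr => d d0; have dd : 0 < d / (1 + M * r) by exact: divr_gt0.
have [x' Ox [xx' bx']] := bext_approx cx dd.
have k1 := pw_dist_fun fg (pw_open_int Ox).
have /andP[_ k2] := bext_lip HC (eta_closed g (pw_open_closed Ox)) (eta_closed g cx).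
have k3 : `|eta f g i x' - eta f g i x| = `|x' - x| * r.
  rewrite /eta (_ : _ - _ = (x' - x) * r); last by rewrite /r; ring.
  by rewrite normrM (gtr0_norm r0).
have k4 : M * (`|x' - x| * r) <= M * r * (d / (1 + M * r)).
  by rewrite -mulrA ler_wpM2l ?(ltW M0)// mulrC ler_wpM2l ?(ltW r0)// ltW.
have E : d / (1 + M * r) + M * r * (d / (1 + M * r)) = d.
  by field; rewrite gt_eqF.
rewrite (bext_open Ox) in bx'.
rewrite (bext_open (eta_open g Ox)) k3 in k2.
rewrite (_ : _ - _ = - (f x' - bext f i x) + (f x' - g (eta f g i x')) +
  (g (eta f g i x') - bext g i (eta f g i x))); last by ring.
apply: (le_trans (ler_normD _ _)); have := ler_normD (- (f x' - bext f i x)) (f x' - g (eta f g i x')).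
rewrite normrN; lra.
Qed.

Lemma near_side_value f s (e : R) : 0 < e -> near_map f (fun g => `|side_value g s - side_value f s| < e).
Proof.
move=> e0; exists (e / 2); first exact: divr_gt0.
move=> g fg; have := pw_dist_bext fg (send_closed f s); rewrite eta_send distrC => h.
by rewrite /side_value; lra.
Qed.

(** [g y] is compared with [f y'], where [y'] corresponds to [y] under [eta]: [rho_0] bounds this
    difference, and [y'] is close to the orbit point [x] of [f], where [f] is continuous because [x]
    is not a cut. *)
Lemma near_side_orbit f s n : (forall k, (k < n)%N -> ~ all_cuts f (side_orbit f s k)) ->
  forall e : R, 0 < e -> near_map f (fun g => `|side_orbit g s n - side_orbit f s n| < e).
Proof.
elim: n => [|n IH] nc e e0; first exact: near_side_value.
have x01 : 0 <= side_orbit f s n <= 1 by apply: iter01; exact: bext01 (send_closed f s).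
have [i Ox] := noncut_open x01 (nc n (ltnSn n)).
set x := side_orbit f s n in Ox x01.
have := pw_open_continuous Ox; rewrite /continuous_at => /(@cvgrPdist_lt R R)/(_ (e / 2)).
rewrite divr_gt0// => /(_ isT)/nbhs_ballP[d /= d0 Hd].
have /andP[ax xb] : pw_left f i < x < pw_right f i by move: Ox; rewrite /pw_open /= in_itv.
pose r := Num.min d (Num.min (x - pw_left f i) (pw_right f i - x)).
have r0 : 0 < r by rewrite !lt_min d0 !subr_gt0 ax xb.
have r1 : r <= d by rewrite ge_min lexx.
have r2 : r <= x - pw_left f i by rewrite !ge_min lexx orbT.
have r3 : r <= pw_right f i - x by rewrite !ge_min lexx !orbT.
clearbody r; have r4 : 0 < r / 4 by rewrite divr_gt0.
have [e1 e10 H1] := IH (fun k kn => nc k (ltnW kn)) (r / 4) r4.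
rewrite -/x in H1.
exists (Num.min e1 (Num.min (r / 4) (e / 2))); first by rewrite !lt_min e10 !divr_gt0.
move=> g; rewrite !lt_min => /andP[/H1 yx /andP[fgr fge]].
set y := side_orbit g s n in yx.
have c1 := pw_dist_cut (widen_ord (leqnSn m) i) fgr.
have c2 := pw_dist_cut (lift ord0 i) fgr.
rewrite -/(pw_left f i) -/(pw_left g i) in c1; rewrite -/(pw_right f i) -/(pw_right g i) in c2.
have Oy : pw_open g i y.
  rewrite /pw_open /= in_itv/=; move: c1 c2 yx; rewrite !ltr_norml.
  by move=> /andP[q1 q2] /andP[q3 q4] /andP[q5 q6]; apply/andP; split; lra.
have Oy' := eta_open f Oy; set y' := eta g f i y in Oy'.
have k1 := eta_move fgr (pw_open_closed Oy'); have k2 := pw_dist_fun fge (pw_open_int Oy').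
rewrite etaK in k1 k2.
have : `|f x - f y'| < e / 2.
  apply: Hd; rewrite /ball /=; apply: (@lt_le_trans _ _ r) => //.
  rewrite (_ : x - y' = - (y - x) + (y - y')); last by ring.
  by apply: (le_lt_trans (ler_normD _ _)); rewrite normrN; lra.
move=> k3; suff : `|g y - f x| < e by [].
rewrite (_ : _ - _ = - (f y' - g y) - (f x - f y')); last by ring.
by apply: (le_lt_trans (ler_normB _ _)); rewrite normrN; lra.
Qed.

End closeness.

Section generic_up_to.
Context {R : realType} {m : nat}.
Implicit Types f g : pwexp R m.

(** [gen_side] is no part of [generic]: it keeps the values of the map away from 0 and 1
    ([interior_range]), which leaves room for perturbations. *)
Record generic_upto (N : nat) f : Prop := GenericUpto {
  gen_side : forall s, 0 < side_value f s < 1 ;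
  gen_cut : forall s n, (n < N)%N -> ~ all_cuts f (side_orbit f s n) ;
  gen_inj : forall s n s' n', (n < N)%N -> (n' < N)%N ->
    side_orbit f s n = side_orbit f s' n' -> s = s' /\ n = n' }.

Lemma generic_uptoP f : (forall N, generic_upto N f) -> generic f.
Proof.
move=> H s n; split; first exact: (gen_cut (H n.+1)).
move=> s' n'; apply: (gen_inj (H (maxn n n').+1)); rewrite ltnS.
  exact: leq_maxl.
exact: leq_maxr.
Qed.

(** Finitely many strict conditions are involved, each on cuts, side values or orbit points that
    vary continuously with the map. *)
Lemma near_generic N f : generic_upto N f -> near_map f (generic_upto N).
Proof.
move=> H.
have orb s (n : 'I_N) (e : R) : 0 < e ->
    near_map f (fun g => `|side_orbit g s n - side_orbit f s n| < e).
  move=> e0; apply: near_side_orbit => // k kn; apply: gen_cut H _ _ _.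
  exact: ltn_trans (ltn_ord n).
have N1 : near_map f (fun g => forall s, 0 < side_value g s < 1).
  apply: near_map_forall => s; have /andP[v0 v1] := gen_side H s.
  have e0 : 0 < Num.min (side_value f s) (1 - side_value f s) by rewrite lt_min v0 subr_gt0.
  apply: (near_map_impl _ (@near_side_value _ _ f s _ e0)) => g.
  rewrite lt_min !ltr_norml => /andP[/andP[h1 h2] /andP[h3 h4]].
  by apply/andP; split; lra.
have N2 : near_map f (fun g => forall p : ('I_m * bool) * 'I_N * 'I_m.+1,
    pw_cut g p.2 != side_orbit g p.1.1 p.1.2).
  apply: near_map_forall => -[[s n] k] /=.
  have ne : pw_cut f k - side_orbit f s n != 0.
    rewrite subr_eq0; apply/eqP => E; apply: (gen_cut H (s := s) (ltn_ord n)).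
    by rewrite -E; exists k.
  have e0 : 0 < `|pw_cut f k - side_orbit f s n| / 2 by rewrite divr_gt0// normr_gt0.
  have near_cut : near_map f (fun g => `|pw_cut f k - pw_cut g k| < `|pw_cut f k - side_orbit f s n| / 2).
    by exists (`|pw_cut f k - side_orbit f s n| / 2) => // g; exact: pw_dist_cut.
  apply: (near_map_impl _ (near_mapI near_cut (orb s n _ e0))) => g [h1 h2].
  apply/eqP => E; have : `|pw_cut f k - side_orbit f s n| < `|pw_cut f k - side_orbit f s n|.
    rewrite {1}(_ : _ - _ = (pw_cut f k - pw_cut g k) + (side_orbit g s n - side_orbit f s n)).
      by apply: (le_lt_trans (ler_normD _ _)); lra.
    by rewrite E; ring.
  by rewrite ltxx.
have N3 : near_map f (fun g => forall p : (('I_m * bool) * 'I_N) * (('I_m * bool) * 'I_N),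
    p.1 = p.2 \/ side_orbit g p.1.1 p.1.2 != side_orbit g p.2.1 p.2.2).
  apply: near_map_forall => -[[s n] [s' n']] /=.
  have [E|nE] := eqVneq (s, n) (s', n'); first by exists 1 => // g _; left.
  have ne : side_orbit f s n - side_orbit f s' n' != 0.
    rewrite subr_eq0; apply: contra_neq nE.
    by move=> /(gen_inj H (ltn_ord n) (ltn_ord n'))[-> /val_inj ->].
  have e0 : 0 < `|side_orbit f s n - side_orbit f s' n'| / 2 by rewrite divr_gt0// normr_gt0.
  apply: (near_map_impl _ (near_mapI (orb s n _ e0) (orb s' n' _ e0))) => g [h1 h2]; right.
  apply/eqP => E.
  have : `|side_orbit f s n - side_orbit f s' n'| < `|side_orbit f s n - side_orbit f s' n'|.
    rewrite {1}(_ : _ - _ = - (side_orbit g s n - side_orbit f s n) +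
      (side_orbit g s' n' - side_orbit f s' n')); last by rewrite E; ring.
    by apply: (le_lt_trans (ler_normD _ _)); rewrite normrN; lra.
  by rewrite ltxx.
apply: (near_map_impl _ (near_mapI N1 (near_mapI N2 N3))) => g [g1 [g2 g3]]; split => //.
- move=> s n nN [k _ E]; have := g2 ((s, Ordinal nN), k); rewrite /= E eqxx.
  by [].
- move=> s n s' n' nN nN' E.
  have /= [[-> ->]//|] := g3 ((s, Ordinal nN), (s', Ordinal nN')).
  by rewrite E eqxx.
Qed.

End generic_up_to.

Section polynomials.
Context {R : realType}.
Implicit Types (p : {poly R}) (x y : R).

Lemma poly_C1 p : exists2 K : R, 0 <= K & forall x, 0 <= x <= 1 ->
  [/\ `|p.[x]| <= K, `|p^`().[x]| <= K &
      forall y, 0 <= y <= 1 -> `|p^`().[x] - p^`().[y]| <= K * `|x - y|].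
Proof.
have [K1 H1] := poly_itv_bound p 0 1; have [K2 H2] := poly_itv_bound p^`() 0 1.
have [K3 H3] := poly_itv_bound p^`()^`() 0 1.
have i0 : 0 <= (0 : R) <= 1 by rewrite lexx ler01.
have k1 := le_trans (normr_ge0 _) (H1 0 i0); have k2 := le_trans (normr_ge0 _) (H2 0 i0).
have k3 := le_trans (normr_ge0 _) (H3 0 i0).
have lip x y : 0 <= x <= 1 -> 0 <= y <= 1 -> x < y ->
    `|p^`().[x] - p^`().[y]| <= (K1 + K2 + K3) * `|x - y|.
  move=> /andP[x0 x1] /andP[y0 y1] xy.
  have [|c] := @MVT R (horner p^`()) (horner p^`()^`()) x y xy.
    by apply: continuous_subspaceT => z; exact: continuous_horner.
  rewrite in_itv/= => /andP[xc cy] E; rewrite distrC E normrM (distrC y).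
  rewrite ler_wpM2r//; apply: (le_trans (H3 c _)); last by lra.
  by apply/andP; split; lra.
exists (K1 + K2 + K3); first by lra.
move=> x x01; have h1 := H1 x x01; have h2 := H2 x x01; split; [by lra|by lra|].
move=> y y01; have [xy|yx|->] := ltgtP x y; first exact: lip.
  by rewrite distrC (distrC x); exact: lip.
by rewrite !subrr !normr0 mulr0.
Qed.

(** Newton's scheme: a multiple of [q], which vanishes at the earlier nodes, corrects the value at
    the new one. *)
Lemma interpolation (E : seq R) (v : R -> R) : exists p, forall x, x \in E -> p.[x] = v x.
Proof.
elim: E => [|y E [p Hp]]; first by exists 0.
have [yE|yE] := boolP (y \in E).
  by exists p => x; rewrite inE => /predU1P[->|]; exact: Hp.
pose q := \prod_(e <- E) ('X - e%:P).
have qy : q.[y] != 0 by rewrite -/(root q y) root_prod_XsubC.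
exists (p + ((v y - p.[y]) / q.[y]) *: q) => x.
rewrite inE hornerD hornerZ => /predU1P[->|xE]; first by rewrite divfK// subrKC.
have /rootP -> : root q x by rewrite root_prod_XsubC.
by rewrite mulr0 addr0 Hp.
Qed.

Lemma finite_avoid (B : set R) (e : R) : finite_set B -> 0 < e -> exists2 t, 0 < t < e & ~ B t.
Proof.
move=> /finite_seqP[r ->]; elim: r e => [|b r IH] e e0.
  by exists (e / 2) => //; apply/andP; split; lra.
have [b0|b0] := ltP 0 b.
  have [|t /andP[t0 tm] nt] := IH (Num.min e b); first by rewrite lt_min e0.
  move: tm; rewrite lt_min => /andP[te tb]; exists t; first by rewrite t0.
  by rewrite /= inE => /predU1P[E|//]; rewrite E ltxx in tb.
have [t /andP[t0 te] nt] := IH e e0; exists t; first by rewrite t0.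
by rewrite /= inE => /predU1P[E|//]; rewrite -E leNgt t0 in b0.
Qed.

End polynomials.

Section density.
Context {R : realType} {m : nat}.
Implicit Types f g : pwexp R m.

(** A common form for the two perturbations in use, contraction towards 1/2 and addition of a
    polynomial. *)
Lemma side_value_affine f g s (a : R) (k : R -> R) : pw_cut g = pw_cut f ->
  (forall x, pw_open f s.1 x -> g x = a * f x + k x) -> {for send f s, continuous k} ->
  side_value g s = a * side_value f s + k (send f s).
Proof.
move=> cutE gE kc; case: s gE kc => i [] /= gE kc.
  have lg := @bext_right _ _ g i; have lf := @bext_right _ _ f i.
  rewrite /side_value /send /= in kc *.
  rewrite [pw_right g i](congr1 (fun c => c (lift ord0 i)) cutE : _ = pw_right f i) in lg *.
  apply: (cvg_unique (@Rhausdorff R) lg).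
  apply: (@cvg_trans _ ((fun y => a * f y + k y) @ (pw_right f i)^'-)).
    apply: near_eq_cvg; near=> y; apply/esym/gE; near: y; exact: near_pw_right.
  apply: cvgD; first by apply: cvgM => //; exact: cvg_cst.
  exact: cvg_at_left_filter.
have lg := @bext_left _ _ g i; have lf := @bext_left _ _ f i.
rewrite /side_value /send /= in kc *.
rewrite [pw_left g i](congr1 (fun c => c (widen_ord (leqnSn m) i)) cutE : _ = pw_left f i) in lg *.
apply: (cvg_unique (@Rhausdorff R) lg).
apply: (@cvg_trans _ ((fun y => a * f y + k y) @ (pw_left f i)^'+)).
  apply: near_eq_cvg; near=> y; apply/esym/gE; near: y; exact: near_pw_left.
apply: cvgD; first by apply: cvgM => //; exact: cvg_cst.
exact: cvg_at_right_filter.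
Unshelve. all: by end_near. Qed.

(** A branch is monotone, so its values lie between its end values; at an end that belongs to the
    interval, the value is a limit of values inside. *)
Lemma interior_range f : (forall s, 0 < side_value f s < 1) ->
  exists2 c : R, 0 < c & forall i x, pw_int f i x -> c <= f x <= 1 - c.
Proof.
move=> side; have [|c c0 Hc] := @fin_pos_lb R _ (fun s => Num.min (side_value f s) (1 - side_value f s)).
  by move=> s; rewrite lt_min subr_gt0; exact: side.
have {}Hc s : c <= side_value f s <= 1 - c.
  by have := Hc s; rewrite le_min => /andP[h1 h2]; apply/andP; split; lra.
exists c => //.
have Hopen i x : pw_open f i x -> c <= f x <= 1 - c.
  move=> Ox; have ab : btw (send f (i, false)) x (send f (i, true)).
    by move: Ox; rewrite /pw_open /= in_itv/= /btw /send /= => ->.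
  have := bext_btw (send_closed f (i, false)) (send_closed f (i, true)) ab.
  rewrite -/(side_value f (i, false)) -/(side_value f (i, true)) /= (bext_open Ox).
  have /andP[h1 h2] := Hc (i, false); have /andP[h3 h4] := Hc (i, true).
  by move=> /orP[|] /andP[h5 h6]; apply/andP; split; lra.
move=> i x Ix.
have apx (e : R) : 0 < e -> c - e <= f x <= 1 - c + e.
  move=> e0; have [d d0 Hd] := has_slope_continuous Ix (pw_der_slope Ix) e0.
  have [y Oy [_ yx]] := pw_int_limit_pt Ix d0.
  have := Hd y (pw_open_int Oy) yx; have /andP[h1 h2] := Hopen i y Oy.
  by rewrite ltr_norml => /andP[h3 h4]; apply/andP; split; lra.
apply/andP; split.
  by apply/ler_addgt0Pr => e /apx/andP[h _]; lra.
by apply/ler_addgt0Pr => e /apx/andP[_ h]; lra.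
Qed.

(** Replacing [f] by [(1 - t) * f + t / 2] moves every one-sided limit into [[t / 2, 1 - t / 2]]. *)
Lemma dense_side f (e : R) : 0 < e -> exists2 g, pw_dist f g < e & generic_upto 0 g.
Proof.
move=> e0; have [s [M [L HC]]] := pw_consts f; have s1 := pwc_gt1 HC; have L0 := pwc_L HC.
(* One constant that bounds [1 / 2 - f], its derivative, and the Lipschitz constant of that
   derivative. *)
pose K := 1 + `|M| + L; have M0 := normr_ge0 M; have ML := ler_norm M.
have K1 : 1 <= K by rewrite /K; lra.
have K0 : 0 < K by lra.
pose t := Num.min (1 / 2) (Num.min ((s - 1) / 2 / K) (e / 8 / K)).
have t0 : 0 < t by rewrite !lt_min !divr_gt0 ?subr_gt0.
have t1 : t <= 1 / 2 by rewrite ge_min lexx.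
have t2 : t * K <= (s - 1) / 2 by rewrite -ler_pdivlMr// !ge_min lexx !orbT.
have t3 : t * K <= e / 8 by rewrite -ler_pdivlMr// !ge_min lexx !orbT.
clearbody t.
have f01 i x : pw_int f i x -> 0 <= f x <= 1 by move=> /pw_int01; exact: pw_fun01.
have [||||||||g [cutE gE dg]] := @perturbation _ _ f (fun i x => 1 / 2 + (-1) * f x)
    (fun i x => 0 + (-1) * pw_der f i x) t K s M L HC.
- exact: ltW.
- exact: ltW.
- by lra.
- move=> i x Ix; apply: has_slopeD; first exact: has_slope_cst.
  by apply: has_slopeM; exact: pw_der_slope.
- move=> i x /f01/andP[h1 h2]; apply: (@le_trans _ _ 1) => //.
  by rewrite ler_norml; apply/andP; split; lra.
- move=> i x Ix; rewrite add0r mulN1r normrN; apply: (le_trans (pwc_ub HC Ix)).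
  by rewrite /K; lra.
- move=> i x y Ix Iy; rewrite !add0r !mulN1r opprK addrC distrC; apply: (le_trans (pwc_lip HC Ix Iy)).
  by rewrite ler_wpM2r// /K; lra.
- move=> i x /f01/andP[h1 h2].
  have h3 : 0 <= t * f x by rewrite mulr_ge0// ltW.
  have h4 : t * f x <= f x / 2 by rewrite mulrC ler_wpM2l//; lra.
  have -> : f x + t * (1 / 2 + -1 * f x) = f x + t / 2 - t * f x by field.
  have h5 : 0 <= (1 - t) * (1 - f x) by rewrite mulr_ge0 ?subr_ge0//; lra.
  rewrite (_ : (1 - t) * (1 - f x) = 1 - t - f x + t * f x) in h5; last by ring.
  by apply/andP; split; lra.
exists g; first by lra.
split => // s'.
have -> : side_value g s' = (1 - t) * side_value f s' + t / 2.
  apply: (@side_value_affine f g s' (1 - t) (fun=> t / 2)) => //; last exact: cst_continuous.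
  by move=> x Ox; rewrite (gE _ _ Ox); field.
have /andP[h1 h2] := bext01 (send_closed f s'); rewrite -/(side_value f s') in h1 h2.
have h3 : 0 <= (1 - t) * side_value f s' by rewrite mulr_ge0// subr_ge0; lra.
have h4 : (1 - t) * side_value f s' <= 1 - t by rewrite ler_piMr// subr_ge0; lra.
by apply/andP; split; lra.
Qed.

Lemma poly_perturbation f (p : 'I_m -> {poly R}) : (forall s, 0 < side_value f s < 1) ->
  exists2 K : R, 0 < K & forall t, 0 < t < K^-1 -> exists g,
    [/\ pw_cut g = pw_cut f, forall i x, pw_open f i x -> g x = f x + t * (p i).[x] &
        pw_dist f g <= t * K].
Proof.
move=> /interior_range[c c0 Hc]; have [s [M [L HC]]] := pw_consts f; have s1 := pwc_gt1 HC.
have /choice[k Hk] : forall i, exists K : R, 0 <= K /\ forall x, 0 <= x <= 1 ->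
  [/\ `|(p i).[x]| <= K, `|(p i)^`().[x]| <= K &
      forall y, 0 <= y <= 1 -> `|(p i)^`().[x] - (p i)^`().[y]| <= K * `|x - y|].
  by move=> i; have [K K0 H] := poly_C1 (p i); exists K.
pose K := \sum_i k i; have K0 : 0 <= K by apply: sumr_ge0 => i _; case: (Hk i).
have kK i : k i <= K by rewrite /K (bigD1 i)//= lerDl sumr_ge0// => j _; case: (Hk j).
pose d := Num.min (s - 1) c; have d0 : 0 < d by rewrite lt_min subr_gt0 s1.
have d1 : d <= s - 1 by rewrite ge_min lexx.
have d2 : d <= c by rewrite ge_min lexx orbT.
(* The summand [7 * K] absorbs the factor in [perturbation]; the other forces [t * K < d], which
   preserves expansion and, since [d <= c], the range [[0, 1]]. *)
clearbody d K; pose C := 7 * K + (K + 1) / d.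
have C1 : 0 < (K + 1) / d by rewrite divr_gt0//; lra.
exists C; first by rewrite /C; lra.
move=> t /andP[t0 tC].
have C0 : 0 < C by rewrite /C; lra.
have tK : t * K < d.
  have h : t * C < 1 by rewrite -ltr_pdivlMr// div1r.
  have h1 : t * ((K + 1) / d) <= t * C by rewrite ler_wpM2l ?(ltW t0)// /C; lra.
  have h2 : t * (K + 1) < d.
    by rewrite -[ltRHS]mul1r -ltr_pdivrMr// -mulrA; exact: le_lt_trans h.
  by rewrite mulrDr mulr1 in h2; lra.
have i01 i x : pw_int f i x -> 0 <= x <= 1 by exact: pw_int01.
have [||||||||g [cutE gE dg]] := @perturbation _ _ f (fun i => horner (p i))
    (fun i => horner (p i)^`()) t K s M L HC.
- exact: ltW.
- exact: K0.
- by lra.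
- move=> i x _; apply: (@has_slopeS _ setT) => //; apply/has_slope_is_derive.
- by move=> i x /i01 Ix; case: ((Hk i).2 x Ix) => h _ _; exact: le_trans (kK i).
- by move=> i x /i01 Ix; case: ((Hk i).2 x Ix) => _ h _; exact: le_trans (kK i).
- move=> i x y /i01 Ix /i01 Iy; case: ((Hk i).2 x Ix) => _ _ /(_ y Iy) h.
  by apply: (le_trans h); rewrite ler_wpM2r.
- move=> i x Ix; have /andP[h1 h2] := Hc i x Ix.
  have : `|t * (p i).[x]| <= t * K.
    rewrite normrM gtr0_norm// ler_wpM2l ?(ltW t0)//.
    by case: ((Hk i).2 x (i01 i x Ix)) => h _ _; exact: le_trans (kK i).
  by rewrite ler_norml => /andP[h3 h4]; apply/andP; split; lra.
exists g; split => //; apply: (le_trans dg); rewrite mulrCA ler_wpM2l ?(ltW t0)//.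
by rewrite /C; lra.
Qed.

(** Distinct positive speeds, one for each branch end. *)
Let w (s : 'I_m * bool) : R := (enum_rank s).+1%:R.

Let w_gt0 s : 0 < w s. Proof. by rewrite ltr0n. Qed.

Let w_inj s s' : w s = w s' -> s = s'.
Proof. by move=> /eqP; rewrite eqr_nat eqSS => /eqP/val_inj/enum_rank_inj. Qed.

(* Moving each of the [N]-th orbit points at its own speed [w s] creates a coincidence
   for finitely many [t] only. *)
Lemma dense_next N f (K e : R) : generic_upto N f -> 0 < K -> 0 < e ->
  (forall t, 0 < t < K^-1 -> exists g, [/\ pw_cut g = pw_cut f, pw_dist f g <= t * K,
     forall s n, (n < N)%N -> side_orbit g s n = side_orbit f s n &
     forall s, side_orbit g s N = side_orbit f s N + t * w s]) ->
  exists2 g, pw_dist f g < e & generic_upto N.+1 g.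
Proof.
move=> Gf K0 e0 H; have [e1 e10 He1] := near_generic Gf.
pose y s := side_orbit f s N.
(* The parameters at which an [N]-th point meets a cut, another [N]-th point, or an earlier orbit
   point, in this order. *)
pose B : set R :=
  range (fun q : ('I_m * bool) * 'I_m.+1 => (pw_cut f q.2 - y q.1) / w q.1) `|`
  range (fun q : ('I_m * bool) * ('I_m * bool) => (y q.2 - y q.1) / (w q.1 - w q.2)) `|`
  range (fun q : ('I_m * bool) * (('I_m * bool) * 'I_N) =>
    (side_orbit f q.2.1 q.2.2 - y q.1) / w q.1).
have fB : finite_set B by rewrite /B !finite_setU; split; [split|]; exact: finite_image.
pose r := Num.min 1 (Num.min e e1).
have r0 : 0 < r by rewrite !lt_min ltr01 e0.
have [t /andP[t0 tr] nB] := finite_avoid fB (divr_gt0 r0 K0).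
have tK : t * K < r by rewrite -ltr_pdivlMr.
move: (tK); rewrite !lt_min => /and3P[tK1 tKe tKe1].
have [|g [cutE dg orb orbN]] := H t; first by rewrite t0 -div1r ltr_pdivlMr.
have Gg : generic_upto N g by apply: He1; exact: le_lt_trans tKe1.
have solve (a b c : R) : 0 < b -> a + t * b = c -> t = (c - a) / b.
  by move=> b0 <-; rewrite addrAC subrr add0r mulfK// gt_eqF.
have neq s s' n' : (n' < N)%N -> side_orbit g s N <> side_orbit g s' n'.
  move=> n'N; rewrite orbN orb// => /(solve _ _ _ (w_gt0 s)) E; apply: nB; right.
  by exists (s, (s', Ordinal n'N)).
exists g; first exact: le_lt_trans tKe.
split; first exact: gen_side Gg.
- move=> s n; rewrite ltnS leq_eqVlt => /predU1P[->|nN]; last exact: gen_cut Gg _ _ nN.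
  rewrite orbN => -[k _]; rewrite cutE => /esym/(solve _ _ _ (w_gt0 s)) E.
  by apply: nB; left; left; exists (s, k).
- move=> s n s' n'; rewrite ltnS leq_eqVlt => nN'; rewrite ltnS leq_eqVlt.
  move: nN' => /predU1P[->|nN] /predU1P[->|n'N]; last exact: gen_inj Gg _ _ _ _ nN n'N.
  + rewrite !orbN => E; split => //; apply: contrapT => /eqP ss'.
    apply: nB; left; right; exists (s, s') => //=.
    have ww : w s - w s' != 0 by rewrite subr_eq0; apply: contra_neq ss' => /w_inj.
    have E' : y s' - y s = t * (w s - w s') by move: E; rewrite -/(y s) -/(y s') mulrBr; lra.
    by rewrite E' mulfK.
  + by move=> /neq; case.
  + by move=> /esym/neq; case.
Qed.

Lemma dense_step N f (e : R) : 0 < e -> generic_upto N f ->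
  exists2 g, pw_dist f g < e & generic_upto N.+1 g.
Proof.
move=> e0 Gf; case: N Gf => [|N] Gf.
  (* At time 0 each branch needs its own polynomial: an inner cut is an end of two branches, and the
     two one-sided limits there must move at different speeds. *)
  have /choice[p Hp] : forall i, exists p : {poly R},
      forall b, p.[send f (i, b)] = w (i, b).
    move=> i; have [p Hp] := interpolation [:: send f (i, false); send f (i, true)]
      (fun x => if x == send f (i, true) then w (i, true) else w (i, false)).
    exists p => -[]; rewrite Hp ?inE ?eqxx ?orbT//.
    by rewrite /send /= lt_eqF// pw_left_lt_right.
  have [K K0 HK] := poly_perturbation p (gen_side Gf).
  apply: (dense_next Gf K0 e0) => t /HK[g [cutE gE dg]]; exists g; split => //.
  move=> -[i b]; rewrite -[LHS]/(side_value g (i, b)) -[X in X + _]/(side_value f (i, b)).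
  rewrite -[side_value f _]mul1r -Hp.
  apply: (@side_value_affine f g (i, b) 1 (fun x => t * (p i).[x])) => //.
    by move=> x /gE ->; rewrite mul1r.
  by apply: continuousM; [exact: cst_continuous|exact: continuous_horner].
(* Later one polynomial serves all branches: it vanishes at the cuts and at the earlier orbit
   points, which therefore stay, and equals [w s] at the last controlled point, so that the image of
   this point moves by [t * w s]. Genericity so far makes these demands compatible. *)
pose v x := if [pick s | x == side_orbit f s N] is Some s then w s else 0.
have vE s : v (side_orbit f s N) = w s.
  rewrite /v; case: pickP => [s' /eqP E|/(_ s)]; last by rewrite eqxx.
  by have [-> _] := gen_inj Gf (ltnSn N) (ltnSn N) E.
have v0 x : (forall s, x <> side_orbit f s N) -> v x = 0.
  by move=> nx; rewrite /v; case: pickP => // s /eqP/nx.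
have [p Hp] := interpolation
  ([seq pw_cut f k | k : 'I_m.+1] ++ [seq side_orbit f q.1 q.2 | q : ('I_m * bool) * 'I_N.+1]) v.
have pcut k : p.[pw_cut f k] = 0.
  rewrite Hp ?mem_cat ?codom_f// v0// => s E.
  by apply: (gen_cut Gf (s := s) (ltnSn N)); exists k.
have porb s n : (n < N.+1)%N -> p.[side_orbit f s n] = v (side_orbit f s n).
  by move=> nN; rewrite Hp// mem_cat; apply/orP; right; exact: (codom_f _ (s, Ordinal nN)).
have [K K0 HK] := poly_perturbation (fun=> p) (gen_side Gf).
apply: (dense_next Gf K0 e0) => t /HK[g [cutE gE dg]].
have step s n : (n < N.+1)%N -> g (side_orbit f s n) = side_orbit f s n.+1 + t * v (side_orbit f s n).
  move=> nN; have x01 : 0 <= side_orbit f s n <= 1 by apply: iter01; exact: bext01 (send_closed f s).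
  have [i Ox] := noncut_open x01 (gen_cut Gf (s := s) nN).
  by rewrite (gE i)// porb.
have orb s n : (n < N.+1)%N -> side_orbit g s n = side_orbit f s n.
  elim: n => [_|n IH nN].
    rewrite -[LHS]/(side_value g s) -[RHS]/(side_value f s).
    have -> : side_value g s = 1 * side_value f s + t * p.[send f s].
      apply: (@side_value_affine f g s 1 (fun x => t * p.[x])) => //.
        by move=> x /gE ->; rewrite mul1r.
      by apply: continuousM; [exact: cst_continuous|exact: continuous_horner].
    by rewrite /send mul1r; case: s.2; rewrite pcut mulr0 addr0.
  rewrite -[LHS]/(g (side_orbit g s n)) IH ?(ltnW nN)// step ?(ltnW nN)// v0 ?mulr0 ?addr0//.
  by move=> s' /(gen_inj Gf (ltnW nN) (ltnSn N))[_ E]; rewrite E ltnn in nN.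
exists g; split => // s.
by rewrite -[LHS]/(g (side_orbit g s N)) orb// step// vE.
Qed.

Lemma open_pw_op (W : set (pwexp R m)) : open W <-> pw_op W.
Proof. by []. Qed.

Lemma open_generic N : open [set f : pwexp R m | generic_upto N f].
Proof. by apply/open_pw_op => f /near_generic[e e0 H]; exists e. Qed.

(** Induction on time inside [W]: each perturbation is small enough to stay in the open set. *)
Lemma dense_generic N (W : set (pwexp R m)) : open W -> W !=set0 ->
  exists2 f, W f & generic_upto N f.
Proof.
move=> oW; elim: N => [|N IH] W0.
  have [f Wf] := W0; have /open_pw_op/(_ f Wf)[e e0 He] := oW.
  by have [g fg Gg] := dense_side f e0; exists g => //; exact: He.
have [f Wf Gf] := IH W0; have /open_pw_op/(_ f Wf)[e e0 He] := oW.
by have [g fg Gg] := dense_step e0 Gf; exists g => //; exact: He.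
Qed.

End density.

Theorem proposition3p9 (R : realType) (m : nat) :
  residual [set f : pwexp R m | separation_condition f].
Proof.
(* Each of these sets is closed by [open_generic] and has empty interior by [dense_generic]. *)
exists (fun N => ~` [set f : pwexp R m | generic_upto N f]); split.
  move=> N; rewrite /nowhere_dense.
  rewrite -(closure_id _).1; last by rewrite closedC; exact: open_generic.
  rewrite -subset0 => f If.
  have [g Ig Gg] := @dense_generic R m N _ (@open_interior _ _) (ex_intro _ f If).
  by have := interior_subset Ig; exact.
move=> f nsep; apply: contrapT => nf; apply: nsep; apply: generic_separation.
apply: generic_uptoP => N; apply: contrapT => nG; apply: nf.
by exists N.
Qed.
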